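(* Let $\omega$ be a continuous non-decreasing function on $[0,+\infty)$ with $\omega(0)=0$. There exists a nonlinear $C^{1,\omega}$-smooth map $\varphi$ of the circle into itself such that $f\circ\varphi\in\bigcap_{p>1}A_p(\mathbb T)$ for every $f\in A(\mathbb T)$ if and only if $$\lim_{\delta\to+0}\frac{\omega(\delta)}{\delta^\varepsilon}=\infty\qquad\text{for all }\varepsilon>0.$$ Moreover, if this condition holds, then there is a nowhere linear $C^{1,\omega}$-diffeomorphism $h$ of the circle such that the superposition operator $f\mapsto f\circ h$ is bounded from $A(\mathbb T)$ to $A_p(\mathbb T)$ for all $p>1$.
   Context: $\mathbb T=\mathbb R/2\pi\mathbb Z$; functions on $\mathbb T$ are identified with $2\pi$-periodic functions on $\mathbb R$. A map of the circle into itself is a function $\varphi:\mathbb R\to\mathbb R$ satisfying $\varphi(t+2\pi)=\varphi(t)\ (\mathrm{mod}\ 2\pi)$ for all $t$. It is $C^1$-smooth if $\varphi\in C^1(\mathbb R)$, and $C^{1,\omega}$-smooth if $\varphi$ is differentiable on $\mathbb R$ and $\sup_{|t_1-t_2|\le\delta}|\varphi'(t_1)-\varphi'(t_2)|=O(\omega(\delta))$ as $\delta\to+0$. It is a homeomorphism of the circle if it is continuous and one-to-one mod $2\pi$, a diffeomorphism if it is a homeomorphism and both it and its inverse are $C^1$-smooth, and a $C^{1,\omega}$-diffeomorphism if it is a diffeomorphism that is $C^{1,\omega}$-smooth. ''Linear'' means affine ($at+b$); ''nonlinear'' means not affine; ''nowhere linear'' means not affine on any interval. Fourier coefficients: $\widehat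 f(k)=\frac1{2\pi}\int_0^{2\pi}f(t)e^{-ikt}\,dt$, $k\in\mathbb Z$. $A(\mathbb T)$ is the space of continuous functions $f$ on $\mathbb T$ with $\|f\|_{A(\mathbb T)}=\sum_k|\widehat f(k)|<\infty$. For $1<p\le 2$, $A_p(\mathbb T)$ is the space of integrable functions $f$ on $\mathbb T$ with $\|f\|_{A_p(\mathbb T)}=\big(\sum_{k\in\mathbb Z}|\widehat f(k)|^p\big)^{1/p}<\infty$. The spaces $A_p(\mathbb T)$ are considered only for $p\le 2$, so ''$p>1$'' means $1<p\le2$. *)

(* Defs.v *)
From HB Require Import structures.
From mathcomp Require Import all_boot all_order all_algebra.
From mathcomp Require Import complex.
From mathcomp Require Import all_classical all_reals all_analysis.

Set Implicit Arguments.
Unset Strict Implicit.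
Unset Printing Implicit Defensive.

Import Order.TTheory GRing.Theory Num.Theory.
Import numFieldNormedType.Exports.

Local Open Scope classical_set_scope.
Local Open Scope complex_scope.
Local Open Scope ring_scope.

Definition eq_mod2pi (R : realType) (x y : R) : Prop :=
  exists k : int, x - y = k%:~R * (2 * pi).

(* Functions on the circle are 2pi-periodic functions on the line. *)
Definition periodic2pi (R : realType) (T : Type) (f : R -> T) : Prop :=
  forall t, f (t + 2 * pi) = f t.

(* Circle maps are given by lifts, of arbitrary degree. *)
Definition circle_map (R : realType) (phi : R -> R) : Prop :=
  forall t, eq_mod2pi (phi (t + 2 * pi)) (phi t).

Definition C1_smooth (R : realType) (phi : R -> R) : Prop :=
  (forall t, derivable phi t 1) /\ continuous (derive1 phi).

(* The estimate sup_(|t1 - t2| <= d) |phi'(t1) - phi'(t2)| = O(omega d) as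
   d -> 0+ is stated as a pointwise bound, since [sup] of an unbounded set of
   reals is 0. *)
Definition C1omega_smooth (R : realType) (omega phi : R -> R) : Prop :=
  (forall t, derivable phi t 1) /\
  exists C : R, \forall d \near 0^'+, forall t1 t2 : R,
    `|t1 - t2| <= d -> `|derive1 phi t1 - derive1 phi t2| <= C * omega d.

Definition circle_homeomorphism (R : realType) (phi : R -> R) : Prop :=
  [/\ circle_map phi, continuous phi &
      forall t1 t2, eq_mod2pi (phi t1) (phi t2) -> eq_mod2pi t1 t2].

(* [psi] is a lift of the inverse of the circle map induced by [phi]. *)
Definition circle_inverse (R : realType) (phi psi : R -> R) : Prop :=
  [/\ circle_map psi, forall t, eq_mod2pi (psi (phi t)) t &
      forall t, eq_mod2pi (phi (psi t)) t].

Definition circle_diffeomorphism (R : realType) (phi : R -> R) : Prop :=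
  [/\ circle_homeomorphism phi, C1_smooth phi &
      exists2 psi, circle_inverse phi psi & C1_smooth psi].

Definition C1omega_diffeomorphism (R : realType) (omega phi : R -> R) : Prop :=
  circle_diffeomorphism phi /\ C1omega_smooth omega phi.

Definition linear_on (R : realType) (D : set R) (phi : R -> R) : Prop :=
  exists a b : R, forall t, D t -> phi t = a * t + b.

Definition nonlinear (R : realType) (phi : R -> R) : Prop :=
  ~ linear_on setT phi.

Definition nowhere_linear (R : realType) (phi : R -> R) : Prop :=
  forall a b : R, a < b -> ~ linear_on `]a, b[ phi.

Definition circle_integrable (R : realType) (f : R -> R[i]) : Prop :=
  (@lebesgue_measure R).-integrable `[0, 2 * pi]
     (fun t => (complex.Re (f t))%:E) /\
  (@lebesgue_measure R).-integrable `[0, 2 * pi]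
     (fun t => (complex.Im (f t))%:E).

Definition circle_integral (R : realType) (f : R -> R[i]) : R[i] :=
  (\int[@lebesgue_measure R]_(t in `[0%R, (2 * pi)%R]) complex.Re (f t))%R +i*
  (\int[@lebesgue_measure R]_(t in `[0%R, (2 * pi)%R]) complex.Im (f t))%R.

(* exp (i x) *)
Definition cis (R : realType) (x : R) : R[i] := cos x +i* sin x.

Definition fourier_coef (R : realType) (f : R -> R[i]) (k : int) : R[i] :=
  ((2 * pi)^-1)%:C * circle_integral (fun t => f t * cis (- (k%:~R * t))).

(* [normc] is the modulus with values in [R] rather than [R[i]]. *)
Definition Ap_norm (R : realType) (p : R) (f : R -> R[i]) : \bar R :=
  poweR (\esum_(k in [set: int]) ((Normc.normc (fourier_coef f k)) `^ p)%:E)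
        p^-1.

Definition A_norm (R : realType) (f : R -> R[i]) : \bar R :=
  \esum_(k in [set: int]) (Normc.normc (fourier_coef f k))%:E.

(* [R[i]^o] carries the topology given by the modulus. *)
Definition in_A (R : realType) (f : R -> R[i]) : Prop :=
  [/\ periodic2pi f, continuous (f : R -> R[i]^o) & (A_norm f < +oo)%E].

Definition in_Ap (R : realType) (p : R) (f : R -> R[i]) : Prop :=
  [/\ periodic2pi f, circle_integrable f & (Ap_norm p f < +oo)%E].

Definition superposition_bounded (R : realType) (p : R) (h : R -> R) : Prop :=
  (forall f : R -> R[i], in_A f -> in_Ap p (f \o h)) /\
  exists C : R, forall f : R -> R[i], in_A f ->
    (Ap_norm p (f \o h) <= C%:E * A_norm f)%E.

(* Main.v *)
Require Import Defs.
From mathcomp Require Import all_boot all_order all_algebra.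
From mathcomp Require Import complex finmap.
From mathcomp Require Import all_classical all_reals all_analysis.
From mathcomp Require Import ring lra zify.

(** Necessity. If f o phi lies in A_p for all f in A(T), a gliding hump argument
    bounds the A_p norms of exp(i n phi) uniformly in n. Near a point where phi'
    is not constant, localize exp(i n phi) to windows of length delta, where
    n delta omega(delta) is small, with the nonnegative trigonometric kernel
    ((1 + cos(t - s)) / 2)^N. The local frequencies n phi' fill an interval of
    length comparable to n, so many coefficients have size about delta, and
    letting p tend to 1 forces omega(delta) >= delta^eps.

    Sufficiency. Write A_d F(t) = (F(t - d) + F(t + d)) / 2, and let q_M be the
    convex piecewise linear function with slope floor(2^M t / 2 pi). The maps
    phi_0(t) = t,
      phi_{M+1} = A_{d_M}(phi_M + eps_M q_M) - eps_M q_M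
    are piecewise linear with O(4^M) corners per period. Averaging halves the
    jumps of the derivative, while eps_M q_M creates new ones at the finer dyadic
    points, so the limit h is C^1 with a modulus of continuity 2^-M at scale d_M,
    and its corners are dense enough to make it nowhere linear. The functions
    exp(i n phi_{M+1}) and exp(i n phi_M) differ only on O(4^M) intervals of
    length at most d_M, on which both are pure exponentials. If d_M decays faster
    than any geometric sequence, this makes the A_p norms of exp(i n h) bounded
    for every p > 1; the growth condition on omega is what allows such a decay
    together with omega(d_M) >= 2^-M. By Jensen's inequality the bound on
    exponentials gives the bound on the superposition operator. *)

Set Implicit Arguments.
Unset Strict Implicit.
Unset Printing Implicit Defensive.

Import Order.TTheory GRing.Theory Num.Theory.
Import numFieldNormedType.Exports.

Local Open Scope classical_set_scope.
Local Open Scope ring_scope.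

(** * Sums of powers *)

(** Two obstacles shape the proof. In the necessity part, localization must not spoil p-sums with p
    near 1. Since (1 + cos)/2 has coefficients 1/4, 1/2, 1/4, multiplying by the kernel only
    averages neighbouring coefficients, wherever the kernel is centred, so a single p-sum controls
    all windows at once. With n about delta^(-1-e), some n coefficients of size delta^(1+eta)
    contribute, for p = 1 + eta, about delta^((1+eta)^2 - 1 - e), which blows up when eta is small
    compared with e. In the sufficiency part, phi_{M+1} - phi_M is the averaging defect (A -
    1)(phi_M + eps_M q_M) of one function, so one estimate by its slope variation on windows of
    length 8 d_M controls values, slopes and Lipschitz constants of the step. Averaging fixes affine
    functions; hence the defect lives near corners, and it is periodic although q_M is not.
    Convexity of q_M makes every new contribution nonnegative, so later stages cannot cancel a
    corner created earlier. *)

Lemma convex_powR_pair (R : realType) (p a b x y : R) : 1 <= p ->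
  0 <= a -> 0 <= b -> a + b = 1 -> 0 <= x -> 0 <= y ->
  (a * x + b * y) `^ p <= a * x `^ p + b * y `^ p.
Proof.
move=> p1 a0 b0 ab x0 y0.
have a1 : a <= 1 by lra.
have ta : Itv.spec (Itv.num_sem (R := R)) (Itv.Real `[0%Z, 1%Z]) a.
  by rewrite /= /Itv.num_sem /= in_itv /= a0 a1 andbT realE a0.
have := @convex_powR R p p1 (Itv.mk ta) x y.
rewrite !inE /= !in_itv /= !andbT => /(_ x0 y0).
rewrite convRE [X in X `^ _ <= _ -> _]convRE /= /unstable.onem.
by have -> : 1 - a = b by lra.
Qed.

(** The weights are not normalised and may all vanish, as the moduli of Fourier coefficients do for
    f = 0. *)
Lemma jensen_powR (R : realType) (I : Type) (r : seq I) (w x : I -> R) (p : R) :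
  1 <= p -> (forall i, 0 <= w i) -> (forall i, 0 <= x i) ->
  (\sum_(i <- r) w i * x i) `^ p <=
  (\sum_(i <- r) w i) `^ (p - 1) * \sum_(i <- r) w i * x i `^ p.
Proof.
move=> p1 w0 x0; have p0 : 0 < p by lra.
(* Normalised form, by induction: the head is split off as a convex combination of [x i] and the
   weighted mean of the tail; a tail of zero weight contributes nothing. *)
have norm : 0 < \sum_(i <- r) w i ->
    ((\sum_(i <- r) w i * x i) / \sum_(i <- r) w i) `^ p <=
    (\sum_(i <- r) w i * x i `^ p) / \sum_(i <- r) w i.
  elim: r => [|i r IH]; first by rewrite big_nil ltxx.
  rewrite !big_cons; set W := \sum_(_ <- r) w _ in IH *.
  set S := \sum_(_ <- r) _ * x _ in IH *.
  set T := \sum_(_ <- r) _ * _ `^ _ in IH *.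
  have W0 : 0 <= W by apply: sumr_ge0.
  have [{IH}W0e|W1] := eqVneq W 0.
    have S0 : S = 0.
      rewrite /S; clear -W0e w0; elim: r @W W0e => [|j r IH] /=.
        by rewrite !big_nil.
      rewrite !big_cons => /eqP; rewrite paddr_eq0 ?sumr_ge0//.
      by move=> /andP[/eqP -> /eqP/IH ->]; rewrite mul0r addr0.
    have T0 : 0 <= T by apply: sumr_ge0 => j _; rewrite mulr_ge0 ?powR_ge0.
    rewrite W0e S0 !addr0 => wi0.
    rewrite mulrAC divff ?mul1r ?gt_eqF//.
    rewrite mulrDl [w i * _ / _]mulrAC divff ?mul1r ?gt_eqF// lerDl.
    by rewrite divr_ge0// ltW.
  have {W1}W1 : 0 < W by rewrite lt_def W1 W0.
  move=> V0; set V := w i + W in V0 *.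
  have -> : (w i * x i + S) / V = (w i / V) * x i + (W / V) * (S / W).
    by field; rewrite !gt_eqF.
  apply: le_trans (convex_powR_pair p1 _ _ _ (x0 i) _) _.
  - by rewrite divr_ge0// ltW.
  - by rewrite divr_ge0// ltW.
  - by rewrite -mulrDl divff// gt_eqF.
  - by rewrite divr_ge0// sumr_ge0// => j _; rewrite mulr_ge0.
  have -> : (w i * x i `^ p + T) / V = (w i / V) * x i `^ p + (W / V) * (T / W).
    by field; rewrite !gt_eqF.
  by rewrite lerD2l ler_wpM2l ?IH// divr_ge0// ltW.
have W0 : 0 <= \sum_(i <- r) w i by apply: sumr_ge0.
have [W0e|W1] := eqVneq (\sum_(i <- r) w i) 0.
  suff -> : \sum_(i <- r) w i * x i = 0.
    rewrite powR0 ?gt_eqF// mulr_ge0 ?powR_ge0// sumr_ge0// => j _.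
    by rewrite mulr_ge0 ?powR_ge0.
  clear -W0e w0; elim: r W0e => [|j r IH] /=.
    by rewrite !big_nil.
  rewrite !big_cons => /eqP; rewrite paddr_eq0 ?sumr_ge0//.
  by move=> /andP[/eqP -> /eqP/IH ->]; rewrite mul0r addr0.
have {W1}W1 : 0 < \sum_(i <- r) w i by rewrite lt_def W1 W0.
move: (norm W1); set W := \sum_(_ <- _) w _ in W0 W1 *.
set S := \sum_(_ <- _) _ * x _; set T := \sum_(_ <- _) _ * _ `^ _ => H.
have S0 : 0 <= S by apply: sumr_ge0 => j _; rewrite mulr_ge0.
have -> : S = W * (S / W) by field; rewrite gt_eqF.
rewrite powRM// ?divr_ge0// -mulr_powRB1// -[W * _]mulrC -mulrA ler_wpM2l ?powR_ge0//.
have -> : T = W * (T / W) by field; rewrite gt_eqF.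
by rewrite ler_wpM2l.
Qed.

Lemma powR_sum_le (R : realType) (I : Type) (r : seq I) (x : I -> R) (p : R) :
  1 <= p -> (forall i, 0 <= x i) ->
  (\sum_(i <- r) x i) `^ p <= (size r)%:R `^ (p - 1) * \sum_(i <- r) x i `^ p.
Proof.
move=> p1 x0; have := @jensen_powR R I r (fun=> 1) x p p1 (fun=> ler01) x0.
under eq_bigr do rewrite mul1r.
under [X in _ <= _ * X -> _]eq_bigr do rewrite mul1r.
by rewrite big_const_seq count_predT iter_addr_0.
Qed.

Lemma powR_add_le (R : realType) (x y p : R) : 1 <= p -> 0 <= x -> 0 <= y ->
  (x + y) `^ p <= 2 `^ p * (x `^ p + y `^ p).
Proof.
move=> p1 x0 y0; have p0 : 0 < p by lra.
have : (x + y) `^ p <= (2 * Num.max x y) `^ p.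
  apply: ge0_ler_powR; rewrite ?nnegrE; try lra.
  - by rewrite mulr_ge0// le_max x0.
  - have := le_max x x y; have := le_max y x y; rewrite !lexx orbT /=; lra.
move/le_trans; apply; rewrite powRM ?le_max ?x0//; rewrite ler_wpM2l ?powR_ge0//.
by rewrite maxEle; case: ifP => _; rewrite ?lerDl ?lerDr powR_ge0.
Qed.

Lemma sum_uniq_subset_le (R : numDomainType) (I : eqType) (s t : seq I) (g : I -> R) :
  uniq s -> uniq t -> {subset s <= t} -> (forall i, 0 <= g i) ->
  \sum_(i <- s) g i <= \sum_(i <- t) g i.
Proof.
move=> us ut st g0.
have /(perm_big _) -> : perm_eq s [seq x <- t | x \in s].
  apply: uniq_perm => //; first exact: filter_uniq.
  move=> x; rewrite mem_filter; apply/idP/andP => [xs|[]//].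
  by split=> //; exact: st.
rewrite big_filter big_mkcond /=; apply: ler_sum => i _.
by case: ifP.
Qed.

Lemma sum_uniq_nat_le (R : numDomainType) (s : seq nat) (g : nat -> R) (Z : R) :
  uniq s -> (forall i, 0 <= g i) -> (forall n, \sum_(0 <= i < n) g i <= Z) ->
  \sum_(i <- s) g i <= Z.
Proof.
move=> us g0 gZ; apply: le_trans (gZ (\max_(i <- s) i).+1).
apply: sum_uniq_subset_le => //; first exact: iota_uniq.
move=> i si; rewrite mem_index_iota /= ltnS.
exact: (@leq_bigmax_seq _ s xpredT id i si isT).
Qed.

(** The map k to |k - m| is injective on each side of m, so two sums over naturals suffice. *)
Lemma sum_uniq_int_le (R : realFieldType) (s : seq int) (g : nat -> R) (Z : R) (m : int) :
  uniq s -> (forall i, 0 <= g i) -> (forall n, \sum_(0 <= i < n) g i <= Z) ->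
  \sum_(k <- s) g (absz (k - m)) <= 2 * Z.
Proof.
move=> us g0 gZ.
rewrite (bigID (fun k => m <= k)) /=.
have -> : 2 * Z = Z + Z by ring.
apply: lerD; rewrite -big_filter.
  rewrite -(big_map (fun k => absz (k - m)) xpredT g).
  apply: sum_uniq_nat_le => //; rewrite map_inj_in_uniq ?filter_uniq//.
  by move=> k l; rewrite !mem_filter => /andP[mk _] /andP[ml _]; lia.
rewrite -(big_map (fun k => absz (k - m)) xpredT g).
apply: sum_uniq_nat_le => //; rewrite map_inj_in_uniq ?filter_uniq//.
by move=> k l; rewrite !mem_filter => /andP[mk _] /andP[ml _]; lia.
Qed.

Lemma sum_geometric_le (R : realType) (x : R) (n : nat) : 0 <= x -> x < 1 ->
  \sum_(0 <= i < n) x ^+ i <= (1 - x)^-1.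
Proof.
move=> x0 x1; have xlt : 0 < 1 - x by rewrite subr_gt0.
rewrite -[leRHS]mulr1 ler_pdivlMl//.
have H : (1 - x) * (\sum_(0 <= i < n) x ^+ i) = 1 - x ^+ n.
  elim: n => [|n IH]; first by rewrite big_geq// mulr0 expr0 subrr.
  by rewrite big_nat_recr//= mulrDr IH exprSr; ring.
by rewrite H gerBl exprn_ge0.
Qed.

(** Cauchy condensation: the 2^m terms with index from 2^m on contribute at most 2^(m(1-s)), a
    geometric term. *)
Lemma pseries_bounded (R : realType) (s : R) : 1 < s ->
  exists Z : R, forall n, \sum_(0 <= i < n) (i.+1%:R : R) `^ (- s) <= Z.
Proof.
move=> s1; pose x : R := 2 `^ (1 - s).
have x0 : 0 <= x by exact: powR_ge0.
have x1 : x < 1.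
  have -> : 1 = (2 : R) `^ 0 by rewrite powRr0.
  rewrite /x /powR !ifN ?pnatr_eq0// ltr_expR mul0r.
  by rewrite nmulr_rlt0 ?subr_lt0// ln_gt0// ltr1n.
have dy m : \sum_(0 <= i < 2 ^ m) (i.+1%:R : R) `^ (- s) <= 1 + \sum_(0 <= j < m) x ^+ j.
  elim: m => [|m IH].
    by rewrite big_nat1 big_geq// addr0 powR1.
  rewrite (@big_cat_nat _ _ _ (2 ^ m)) //=; last by rewrite leq_exp2l.
  rewrite [X in _ <= _ + X]big_nat_recr//= addrA; apply: lerD => //.
  have le1 i : (2 ^ m <= i < 2 ^ m.+1)%N ->
      (i.+1%:R : R) `^ (- s) <= ((2 ^ m)%:R : R) `^ (- s).
    move=> /andP[mi _].
    rewrite !powRN lef_pV2 ?posrE ?powR_gt0 ?ltr0n ?expn_gt0//.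
    rewrite ge0_ler_powR ?nnegrE ?ler0n ?ler_nat//; last exact: leqW.
    by rewrite (le_trans _ (ltW s1)).
  rewrite big_nat; apply: le_trans (ler_sum _ le1) _.
  rewrite -big_nat sumr_const_nat.
  have -> : (2 ^ m.+1 - 2 ^ m = 2 ^ m)%N by rewrite expnS; lia.
  rewrite -[leLHS]mulr_natr natrX -!powR_mulrn ?ler0n ?powR_ge0// /x -!powRrM.
  rewrite -powRD; last by rewrite pnatr_eq0 /= implybT.
  by rewrite le_eqVlt; apply/orP; left; apply/eqP; congr (_ `^ _); ring.
exists (1 + (1 - x)^-1) => n.
have nm : (n <= 2 ^ n)%N by exact/ltnW/ltn_expl.
rewrite (le_trans _ (le_trans (dy n) _))//; last first.
  by rewrite lerD2l sum_geometric_le.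
by rewrite [leRHS](@big_cat_nat _ _ _ n)//= lerDl sumr_ge0.
Qed.

(** The exponent is split as p = (p-1)/2 + (p+1)/2: the first power of the minimum is bounded by
    that of d, and the second is summable because (p+1)/2 > 1. The minimum is the size of the k-th
    coefficient of an exponential of frequency near m restricted to an interval of length d. *)
Lemma sum_min_powR_le (R : realType) (p : R) : 1 < p ->
  exists2 Z : R, 0 < Z & forall (d : R) (m : int) (s : seq int),
    0 < d -> uniq s ->
    \sum_(k <- s) (Num.min d (6 / (1 + (absz (k - m))%:R))) `^ p
      <= Z * d `^ ((p - 1) / 2).
Proof.
move=> p1; have s1 : 1 < (p + 1) / 2 by lra.
have [Z HZ] := pseries_bounded s1.
have Z0 : 0 <= Z by have := HZ 0%N; rewrite big_geq.
pose c : R := 6 `^ ((p + 1) / 2).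
have c0 : 0 < c by rewrite powR_gt0.
exists (c * (2 * (Z + 1))); first by rewrite !mulr_gt0//; lra.
move=> d m s d0 us.
pose g (i : nat) : R := i.+1%:R `^ (- ((p + 1) / 2)).
have g0 i : 0 <= g i by exact: powR_ge0.
apply: (@le_trans _ _ (\sum_(k <- s) d `^ ((p - 1) / 2) * c * g (absz (k - m)))).
  apply: ler_sum => k _; set j := absz (k - m).
  have b0 : 0 < 6 / (1 + j%:R : R) by rewrite divr_gt0// ltr_pwDl.
  have -> : p = (p - 1) / 2 + (p + 1) / 2 by lra.
  rewrite powRD; last by apply/implyP => _; rewrite gt_eqF// lt_min d0.
  have -> : (p - 1) / 2 + (p + 1) / 2 = p by lra.
  rewrite -mulrA ler_pM ?powR_ge0//.
    apply: ge0_ler_powR; first lra.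
    - by rewrite nnegrE le_min !ltW.
    - by rewrite nnegrE ltW.
    - by rewrite ge_min lexx.
  have -> : c * g j = (6 / (1 + j%:R)) `^ ((p + 1) / 2).
    rewrite powRM ?invr_ge0 ?addr_ge0// /c /g powRN; congr (_ * _).
    by rewrite -[(1 + j%:R)^-1]powR_inv1 ?addr_ge0// -powRrM mulN1r powRN -natr1 addrC.
  apply: ge0_ler_powR; first lra.
  - by rewrite nnegrE le_min !ltW.
  - by rewrite nnegrE ltW.
  - by rewrite ge_min lexx orbT.
rewrite -mulr_sumr [leRHS](_ : _ = d `^ ((p - 1) / 2) * c * (2 * (Z + 1))); last by ring.
rewrite ler_wpM2l ?mulr_ge0 ?powR_ge0//.
have := sum_uniq_int_le m us g0 HZ; lra.
Qed.

Lemma cvg_dist_le (R : realType) (u : nat -> R) (l a B : R) (N : nat) :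
  u @ \oo --> l -> (forall n, (N <= n)%N -> `|u n - a| <= B) -> `|l - a| <= B.
Proof.
move=> ul uB; have h : (fun n => `|u n - a|) @ \oo --> `|l - a|.
  by apply: cvg_norm; apply: cvgB => //; exact: cvg_cst.
apply: (cvgr_to_le h); exists N => // n /= Nn; exact: uB.
Qed.

Lemma cvg_le (R : realType) (u : nat -> R) (l B : R) (N : nat) :
  u @ \oo --> l -> (forall n, (N <= n)%N -> u n <= B) -> l <= B.
Proof. by move=> ul uB; apply: (cvgr_to_le ul); exists N. Qed.

Lemma cvg_ge (R : realType) (u : nat -> R) (l B : R) (N : nat) :
  u @ \oo --> l -> (forall n, (N <= n)%N -> B <= u n) -> B <= l.
Proof. by move=> ul uB; apply: (cvgr_to_ge ul); exists N. Qed.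

Lemma cvg_geometric_bound (R : realType) (u : nat -> R) (l C : R) :
  (forall n, `|u n - l| <= C * 2^-1 ^+ n) -> u @ \oo --> l.
Proof.
move=> uC; apply/cvgrPdist_le => e e0.
have C0 : 0 <= C by have := uC 0%N; rewrite expr0 mulr1; apply: le_trans.
have h : geometric C (2^-1 : R) @ \oo --> (0 : R).
  by apply: cvg_geometric; rewrite ger0_norm// invf_lt1// ltr1n.
move/cvgrPdist_le : h => /(_ e e0); apply: filterS => n /=.
rewrite sub0r normrN ger0_norm ?mulr_ge0 ?exprn_ge0// => /(le_trans _); apply.
by rewrite distrC.
Qed.

Lemma geometric_cauchy_cvg (R : realType) (u : nat -> R) (C : R) :
  (forall n, `|u n.+1 - u n| <= C * 2^-1 ^+ n) ->
  exists2 l : R, u @ \oo --> l & forall n, `|l - u n| <= 2 * C * 2^-1 ^+ n.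
Proof.
move=> uC.
have C0 : 0 <= C by have := uC 0%N; rewrite expr0 mulr1; apply: le_trans.
(* Keeping the factor 1 - 2^-k makes the telescoping bound exact, so that the induction closes. *)
have dist n k : `|u (n + k)%N - u n| <= 2 * C * 2^-1 ^+ n * (1 - 2^-1 ^+ k).
  elim: k => [|k IH]; first by rewrite addn0 subrr normr0 expr0 subrr mulr0.
  have := uC (n + k)%N; rewrite -addnS => H.
  rewrite -(subrKA (u (n + k)%N)); apply: le_trans (ler_normD _ _) _.
  apply: le_trans (lerD H IH) _; rewrite !exprD exprS.
  by rewrite le_eqVlt; apply/orP; left; apply/eqP; field.
have dist' n k : (n <= k)%N -> `|u k - u n| <= 2 * C * 2^-1 ^+ n.
  move=> nk; rewrite -(subnKC nk); apply: le_trans (dist _ _) _.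
  by rewrite ler_piMr ?mulr_ge0 ?exprn_ge0// gerBl exprn_ge0.
have : cvgn u.
  apply/cauchy_cvgP/cauchy_ballP => e e0.
  have h : geometric (2 * C) (2^-1 : R) @ \oo --> (0 : R).
    by apply: cvg_geometric; rewrite ger0_norm// invf_lt1// ltr1n.
  have e2 : 0 < e / 3 by rewrite divr_gt0.
  move/cvgrPdist_le : h => /(_ _ e2) [N _ HN].
  have HN' := HN N (leqnn N); move: HN'; rewrite /= sub0r normrN ger0_norm ?mulr_ge0 ?exprn_ge0// => HN'.
  pose A := u @` [set n | (N <= n)%N].
  exists (A, A); first by split; exists N => // n Nn; exists n.
  move=> [_ _] /= [[n Nn <-] [m Nm <-]]; rewrite /ball /=.
  rewrite -(subrKA (u N)); apply: le_lt_trans (ler_normD _ _) _.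
  have := dist' _ _ Nn; have := dist' _ _ Nm; rewrite (distrC (u m)); lra.
move=> /cvg_ex [l ul]; exists l => // n.
by apply: (cvg_dist_le ul) => k; exact: dist'.
Qed.

(** Extended sums are handled through finite sums over duplicate-free lists, on which all later
    estimates are stated. *)
Lemma esum_int_le (R : realType) (a : int -> R) (C : R) :
  (forall s, uniq s -> \sum_(k <- s) a k <= C) ->
  (\esum_(k in [set: int]) (a k)%:E <= C%:E)%E.
Proof.
move=> aC; apply: ge_ereal_sup => /= _ [X [finX _] <-].
rewrite fsumEFin// lee_fin fsbig_finite//; apply: aC; exact: fset_uniq.
Qed.

Lemma esum_int_ge (R : realType) (a : int -> R) (s : seq int) : uniq s ->
  ((\sum_(k <- s) a k)%:E <= \esum_(k in [set: int]) (a k)%:E)%E.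
Proof.
move=> us; apply: esum_ge; exists [set` s]; first by split=> //; exact: finite_seq.
by rewrite fsumEFin ?lee_fin -?fsbig_seq//; exact: finite_seq.
Qed.

Section Ap.
Variables (R : realType) (p : R) (f : R -> R[i]).
Hypothesis p0 : 0 < p.
Let a k := Normc.normc (fourier_coef f k).

Lemma Ap_norm_le (C : R) : 0 <= C ->
  (forall s, uniq s -> \sum_(k <- s) a k `^ p <= C `^ p) -> (Ap_norm p f <= C%:E)%E.
Proof.
move=> C0 aC; rewrite /Ap_norm.
have -> : C%:E = poweR (C `^ p)%:E p^-1.
  by rewrite poweR_EFin -powRrM mulfV ?gt_eqF// powRr1.
apply: gt0_ler_poweR; first by rewrite invr_ge0 ltW.
- by rewrite in_itv /= leey andbT; apply: esum_ge0 => k _; rewrite lee_fin powR_ge0.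
- by rewrite in_itv /= leey andbT lee_fin powR_ge0.
by apply: esum_int_le => s us; exact: aC.
Qed.

Lemma Ap_norm_lty_bounded : (Ap_norm p f < +oo)%E ->
  exists C : R, forall s, uniq s -> \sum_(k <- s) a k `^ p <= C.
Proof.
move=> /lty_poweRy; rewrite invr_eq0 gt_eqF// => /(_ isT) h.
have h0 : (0 <= \esum_(k in [set: int]) (a k `^ p)%:E)%E.
  by apply: esum_ge0 => k _; rewrite lee_fin powR_ge0.
exists (fine (\esum_(k in [set: int]) (a k `^ p)%:E)) => s us.
by rewrite -lee_fin fineK ?ge0_fin_numE//; exact: esum_int_ge.
Qed.

Lemma A_norm_le (C : R) :
  (forall s, uniq s -> \sum_(k <- s) a k <= C) -> (A_norm f <= C%:E)%E.
Proof. by move=> aC; apply: esum_int_le. Qed.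

Lemma A_norm_lty_bounded : (A_norm f < +oo)%E ->
  exists2 C : R, A_norm f = C%:E & forall s, uniq s -> \sum_(k <- s) a k <= C.
Proof.
move=> h.
have a0 k : 0 <= a k by rewrite /a /Normc.normc; case: fourier_coef => x y; exact: sqrtr_ge0.
have h0 : (0 <= A_norm f)%E.
  by apply: esum_ge0 => k _; rewrite lee_fin; exact: a0.
exists (fine (A_norm f)); first by rewrite fineK ?ge0_fin_numE.
move=> s us.
by rewrite -lee_fin fineK ?ge0_fin_numE//; exact: esum_int_ge.
Qed.

End Ap.

(** * Fourier coefficients of continuous functions *)

Definition Int (R : realType) (a b : R) (F : R -> R) : R :=
  (\int[@lebesgue_measure R]_(t in `[a, b]) F t)%R.

Section Int.
Variable R : realType.
Implicit Types (a b c : R) (F G : R -> R).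
Local Notation mu := (@lebesgue_measure R).

Lemma continuous_integrable a b F : continuous F ->
  mu.-integrable `[a, b] (EFin \o F).
Proof.
move=> cF; apply: continuous_compact_integrable; first exact: segment_compact.
exact: continuous_subspaceT.
Qed.

Lemma eq_Int a b F G : (forall t, a <= t <= b -> F t = G t) -> Int a b F = Int a b G.
Proof. by move=> FG; apply: eq_Rintegral => t; rewrite inE /= in_itv /=; exact: FG. Qed.

Lemma IntD a b F G : continuous F -> continuous G ->
  Int a b (fun t => F t + G t) = Int a b F + Int a b G.
Proof. by move=> cF cG; apply: RintegralD => //; exact: continuous_integrable. Qed.

Lemma IntB a b F G : continuous F -> continuous G ->
  Int a b (fun t => F t - G t) = Int a b F - Int a b G.
Proof. by move=> cF cG; apply: RintegralB => //; exact: continuous_integrable. Qed.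

Lemma IntZ a b c F : continuous F -> Int a b (fun t => c * F t) = c * Int a b F.
Proof. by move=> cF; apply: RintegralZl => //; exact: continuous_integrable. Qed.

Lemma Int_cst a b c : a <= b -> Int a b (fun=> c) = c * (b - a).
Proof.
move=> ab; rewrite /Int Rintegral_cst//= lebesgue_measure_itv /= lte_fin.
by move: ab; rewrite le_eqVlt => /predU1P[->|ab]; rewrite ?ltxx ?subrr// ab -EFinD.
Qed.

Lemma le_Int a b F G : continuous F -> continuous G ->
  (forall t, a <= t <= b -> F t <= G t) -> Int a b F <= Int a b G.
Proof.
move=> cF cG FG; apply: le_Rintegral => //; try exact: continuous_integrable.
Qed.

Lemma Int_abs_le a b B F : a <= b -> continuous F ->
  (forall t, a <= t <= b -> `|F t| <= B) -> `|Int a b F| <= B * (b - a).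
Proof.
move=> ab cF FB; rewrite -(Int_cst B ab) ler_norml; apply/andP; split.
  rewrite Int_cst// -mulNr -(Int_cst (- B) ab).
  apply: le_Int; [exact: cst_continuous|exact: cF|].
  by move=> t /FB; rewrite ler_norml => /andP[].
apply: le_Int; [exact: cF|exact: cst_continuous|].
by move=> t /FB; rewrite ler_norml => /andP[].
Qed.

Lemma Int_split a b c F : a <= c -> c <= b -> continuous F ->
  Int a b F = Int a c F + Int c b F.
Proof.
move=> ac cb cF.
have := @Rintegral_itvB R F (BLeft a) (BRight b) c (continuous_integrable _ _ cF).
rewrite !bnd_simp ac cb => /(_ isT isT) h.
rewrite /Int -[in X in _ = _ + X]Rintegral_itv_obnd_cbnd; last first.
  apply: integrableS (continuous_integrable a b cF) => //.
  by apply: subset_itvr; rewrite bnd_simp.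
by rewrite -h addrC subrK.
Qed.

Lemma FTC_derive a b F (f : R -> R) : a < b -> continuous f ->
  (forall t : R, is_derive t 1 F (f t)) -> Int a b f = F b - F a.
Proof.
move=> ab cf dF; rewrite /Int /Rintegral (@continuous_FTC2 R f F a b)//.
- exact: continuous_subspaceT.
- have cF t : {for t, continuous F}.
    by apply/differentiable_continuous/derivable1_diffP; case: (dF t).
  split=> [t _||]; first by case: (dF t).
    by apply: cvg_at_right_filter; exact: cF.
  by apply: cvg_at_left_filter; exact: cF.
- by move=> t _; rewrite derive1E; apply: derive_val.
Qed.

Lemma continuous_affine (al be : R) : continuous (fun t : R => al * t + be).
Proof.
by move=> t; apply: cvgD; [apply: cvgM; [exact: cvg_cst|exact: cvg_id]|exact: cvg_cst].
Qed.

Lemma continuous_cos_comp F : continuous F -> continuous (fun t => cos (F t)).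
Proof.
by move=> cF t; apply: (continuous_comp (cF t)); exact: continuous_cos.
Qed.

Lemma continuous_sin_comp F : continuous F -> continuous (fun t => sin (F t)).
Proof.
by move=> cF t; apply: (continuous_comp (cF t)); exact: continuous_sin.
Qed.

Lemma Int_cos_le a b (al be : R) : a <= b -> al != 0 ->
  `|Int a b (fun t => cos (al * t + be))| <= 2 / `|al|.
Proof.
rewrite le_eqVlt => /predU1P[->|ab] al0.
  rewrite (_ : Int _ _ _ = 0) ?normr0 ?divr_ge0//.
  by rewrite /Int set_itv1 Rintegral_set1.
have dF (t : R) : is_derive t 1 (fun t => al^-1 * sin (al * t + be)) (cos (al * t + be)).
  have d1 : is_derive t 1 (fun t : R => al * t + be) al.
    by apply: is_derive_eq; rewrite addr0 /GRing.scale /= mulr1.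
  have d2 := @is_derive1_comp R sin (fun t => al * t + be) t _ _ (is_derive_sin _) d1.
  have := @is_deriveZ _ _ _ _ al^-1 _ _ _ d2.
  by rewrite /GRing.scale /= [X in is_derive _ _ _ X](_ : _ = cos (al * t + be)) //; field.
rewrite (FTC_derive ab _ dF); last exact/continuous_cos_comp/continuous_affine.
rewrite -mulrBr normrM normfV mulrC ler_wpM2r ?invr_ge0//.
apply: le_trans (ler_normB _ _) _.
by rewrite (_ : 2 = 1 + 1 :> R)// lerD// sin_max.
Qed.

End Int.

(** * The modulus, unimodular exponentials and continuity by components *)

Section normc.
Variable R : realType.
Implicit Types z w : R[i].
Local Notation normc := Normc.normc.

Lemma normc_ge0 z : 0 <= normc z.
Proof. by case: z => x y; exact: sqrtr_ge0. Qed.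

Lemma normcE' z : `|z| = (normc z)%:C%C.
Proof. by []. Qed.

Lemma normc_le_ReIm z : normc z <= `|complex.Re z| + `|complex.Im z|.
Proof.
case: z => x y /=; rewrite -(@ler_pXn2r _ 2) ?nnegrE ?sqrtr_ge0 ?addr_ge0//.
rewrite sqr_sqrtr ?addr_ge0 ?sqr_ge0// -[x ^+ 2]real_normK ?num_real//.
rewrite -[y ^+ 2]real_normK ?num_real// sqrrD -addrA [_ *+ 2 + _]addrC addrA lerDl.
by rewrite mulrn_wge0 ?mulr_ge0.
Qed.

Lemma Re_le_normc z : `|complex.Re z| <= normc z.
Proof.
case: z => x y /=; rewrite -[leLHS]sqrtr_sqr; apply: ler_wsqrtr.
by rewrite lerDl sqr_ge0.
Qed.

Lemma Im_le_normc z : `|complex.Im z| <= normc z.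
Proof.
case: z => x y /=; rewrite -[leLHS]sqrtr_sqr; apply: ler_wsqrtr.
by rewrite lerDr sqr_ge0.
Qed.

Lemma normc_cis (x : R) : normc (cis x) = 1.
Proof. by rewrite /cis /= cos2Dsin2 sqrtr1. Qed.

Lemma normc_real (x : R) : normc (x%:C%C) = `|x|.
Proof. by rewrite /= expr0n /= addr0 sqrtr_sqr. Qed.

Lemma cisD (x y : R) : cis (x + y) = cis x * cis y.
Proof.
rewrite /cis cosD sinD; apply/eqP; rewrite eq_complex /= eqxx /=.
by apply/eqP; ring.
Qed.

Lemma cis0 : cis (0 : R) = 1.
Proof. by rewrite /cis cos0 sin0. Qed.

Lemma cis_2pi (k : int) : cis (k%:~R * (2 * pi) : R) = 1.
Proof.
have h2 : cis (2 * pi : R) = 1.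
  by rewrite /cis mulr_natl cos2pi sin2pi.
have hn (n : nat) : cis (n%:R * (2 * pi) : R) = 1.
  elim: n => [|n IH]; first by rewrite mul0r cis0.
  by rewrite -natr1 mulrDl mul1r cisD IH h2 mulr1.
case: k => n; first exact: hn.
rewrite NegzE mulrNz mulNr; have := cis0.
by rewrite -(subrr (n.+1%:R * (2 * pi))) cisD hn mul1r.
Qed.

Lemma normcD z w : normc (z + w) <= normc z + normc w.
Proof. exact: le_normcD. Qed.

Lemma normcB z w : normc (z - w) <= normc z + normc w.
Proof. by apply: le_trans (normcD _ _) _; rewrite normcN. Qed.

Lemma normc_sum (I : Type) (r : seq I) (F : I -> R[i]) :
  normc (\sum_(i <- r) F i) <= \sum_(i <- r) normc (F i).
Proof.
elim: r => [|i r IH]; first by rewrite !big_nil Normc.normc0.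
by rewrite !big_cons; apply: le_trans (normcD _ _) _; rewrite lerD2l.
Qed.

End normc.

(** Continuity by components, because [circle_integral] is defined by components. *)
Definition ccont (R : realType) (f : R -> R[i]) : Prop :=
  continuous (fun t => complex.Re (f t)) /\ continuous (fun t => complex.Im (f t)).

Section ccont.
Variable R : realType.
Implicit Types f g : R -> R[i].

Lemma continuous_ccont f : continuous (f : R -> R[i]^o) -> ccont f.
Proof.
move=> cf; split=> t; apply/cvgrPdist_le => e e0.
  have e0' : 0 < e%:C%C by rewrite ltcR.
  have /cvgrPdist_le/(_ _ e0') := cf t; apply: filterS => s /=.
  rewrite normcE' lecR; apply: le_trans.
  by have := Re_le_normc (f t - f s); rewrite raddfB.
have e0' : 0 < e%:C%C by rewrite ltcR.
have /cvgrPdist_le/(_ _ e0') := cf t; apply: filterS => s /=.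
rewrite normcE' lecR; apply: le_trans.
by have := Im_le_normc (f t - f s); rewrite raddfB.
Qed.

Lemma ccont_continuous f : ccont f -> continuous (f : R -> R[i]^o).
Proof.
move=> [c1 c2] t; apply/cvgrPdist_le => e e0.
have [x x0 ->] : exists2 x : R, 0 < x & e = x%:C%C.
  case: e e0 => x y; rewrite ltcE /= => /andP[/eqP -> x0].
  by exists x.
have x2 : 0 < x / 2 by rewrite divr_gt0.
have /cvgrPdist_le/(_ _ x2) h1 := c1 t.
have /cvgrPdist_le/(_ _ x2) h2 := c2 t.
near=> s; rewrite normcE' lecR; apply: le_trans (normc_le_ReIm _) _.
rewrite [leRHS](splitr x); apply: lerD; rewrite raddfB /=; near: s.
  exact: h1.
exact: h2.
Unshelve. all: by end_near. Qed.

Lemma ccontD f g : ccont f -> ccont g -> ccont (fun t => f t + g t).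
Proof.
move=> [f1 f2] [g1 g2]; split=> t.
  rewrite (_ : (fun _ => _) = (fun t => complex.Re (f t) + complex.Re (g t))).
    by apply: cvgD; [exact: f1|exact: g1].
  by apply/funext => s; rewrite raddfD.
rewrite (_ : (fun _ => _) = (fun t => complex.Im (f t) + complex.Im (g t))).
  by apply: cvgD; [exact: f2|exact: g2].
by apply/funext => s; rewrite raddfD.
Qed.

Lemma ccontM f g : ccont f -> ccont g -> ccont (fun t => f t * g t).
Proof.
move=> [f1 f2] [g1 g2]; split=> t.
  rewrite (_ : (fun _ => _) = (fun t => complex.Re (f t) * complex.Re (g t)
    - complex.Im (f t) * complex.Im (g t))).
    by apply: cvgB; apply: cvgM; [exact: f1|exact: g1|exact: f2|exact: g2].
  by apply/funext => s; case: (f s); case: (g s).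
rewrite (_ : (fun _ => _) = (fun t => complex.Re (f t) * complex.Im (g t)
    + complex.Im (f t) * complex.Re (g t))).
  by apply: cvgD; apply: cvgM; [exact: f1|exact: g2|exact: f2|exact: g1].
by apply/funext => s; case: (f s); case: (g s).
Qed.

Lemma ccont_cst (z : R[i]) : ccont (fun=> z).
Proof. by split; exact: cst_continuous. Qed.

Lemma ccont_sum (I : Type) (r : seq I) (F : I -> R -> R[i]) :
  (forall i, ccont (F i)) -> ccont (fun t => \sum_(i <- r) F i t).
Proof.
move=> cF; elim: r => [|i r IH].
  rewrite (_ : (fun _ => _) = (fun=> 0)); first exact: ccont_cst.
  by apply/funext => t; rewrite big_nil.
rewrite (_ : (fun _ => _) = (fun t => F i t + \sum_(i <- r) F i t)).
  exact: ccontD.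
by apply/funext => t; rewrite big_cons.
Qed.

Lemma ccont_cis (F : R -> R) : continuous F -> ccont (fun t => cis (F t)).
Proof.
by move=> cF; split; [exact: continuous_cos_comp|exact: continuous_sin_comp].
Qed.

Lemma ccont_cis_char (k : int) : ccont (fun t : R => cis (- (k%:~R * t))).
Proof.
apply: ccont_cis; rewrite (_ : (fun _ => _) = (fun t => - k%:~R * t + 0)).
  exact: continuous_affine.
by apply/funext => t; rewrite mulNr addr0.
Qed.

Lemma ccont_comp f (phi : R -> R) : ccont f -> continuous phi -> ccont (f \o phi).
Proof.
move=> [f1 f2] cp; split=> t.
  exact: (@continuous_comp _ _ _ phi (fun t => complex.Re (f t)) t (cp t) (f1 _)).
exact: (@continuous_comp _ _ _ phi (fun t => complex.Im (f t)) t (cp t) (f2 _)).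
Qed.

End ccont.

Section fourier_coef.
Variable R : realType.
Implicit Types (f g : R -> R[i]) (k : int).
Local Notation normc := Normc.normc.

Lemma circle_integralE f : circle_integral f =
  (Int 0 (2 * pi) (fun t => complex.Re (f t)) +i*
   Int 0 (2 * pi) (fun t => complex.Im (f t)))%C.
Proof. by []. Qed.

Lemma twopi_gt0 : 0 < 2 * pi :> R.
Proof. by rewrite mulr_gt0 ?pi_gt0. Qed.

Lemma circle_integralD f g : ccont f -> ccont g ->
  circle_integral (fun t => f t + g t) = circle_integral f + circle_integral g.
Proof.
move=> [f1 f2] [g1 g2]; rewrite !circle_integralE; apply/eqP; rewrite eq_complex /=.
rewrite -!IntD//; apply/andP; split; apply/eqP; apply: eq_Int => t _.
  by rewrite raddfD.
by rewrite raddfD.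
Qed.

Lemma circle_integralZ (z : R[i]) f : ccont f ->
  circle_integral (fun t => z * f t) = z * circle_integral f.
Proof.
case: z => x y [f1 f2]; rewrite !circle_integralE; apply/eqP; rewrite eq_complex /=.
have cZ (c : R) (F : R -> R) : continuous F -> continuous (fun t => c * F t).
  by move=> cF t; apply: cvgM; [exact: cvg_cst|exact: cF].
apply/andP; split; apply/eqP.
  rewrite -(IntZ _ _ x f1) -(IntZ _ _ y f2) -(IntB _ _ (cZ _ _ f1) (cZ _ _ f2)).
  by apply: eq_Int => t _; case: (f t).
rewrite -(IntZ _ _ x f2) -(IntZ _ _ y f1) -(IntD _ _ (cZ _ _ f2) (cZ _ _ f1)).
by apply: eq_Int => t _; case: (f t).
Qed.

Lemma normc_circle_integral f (B : R) : ccont f ->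
  (forall t, 0 <= t <= 2 * pi -> normc (f t) <= B) ->
  normc (circle_integral f) <= 2 * (2 * pi) * B.
Proof.
move=> [f1 f2] fB; apply: le_trans (normc_le_ReIm _) _; rewrite circle_integralE /=.
have h0 : 0 <= 2 * pi :> R by exact/ltW/twopi_gt0.
rewrite (_ : 2 * _ * B = B * (2 * pi - 0) + B * (2 * pi - 0)); last by ring.
apply: lerD; apply: Int_abs_le => // t /fB; apply: le_trans.
  exact: Re_le_normc.
exact: Im_le_normc.
Qed.

Lemma eq_fourier_coef f g k : (forall t, f t = g t) -> fourier_coef f k = fourier_coef g k.
Proof. by move=> /funext ->. Qed.

Lemma fourier_coefD f g k : ccont f -> ccont g ->
  fourier_coef (fun t => f t + g t) k = fourier_coef f k + fourier_coef g k.
Proof.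
move=> cf cg; have ck := ccont_cis_char R k; rewrite /fourier_coef -mulrDr.
rewrite -circle_integralD; [|exact: ccontM..].
by congr (_ * circle_integral _); apply/funext => t; rewrite mulrDl.
Qed.

Lemma fourier_coefZ (z : R[i]) f k : ccont f ->
  fourier_coef (fun t => z * f t) k = z * fourier_coef f k.
Proof.
move=> cf; have ck := ccont_cis_char R k; rewrite /fourier_coef mulrCA.
rewrite -(circle_integralZ z (ccontM cf ck)).
by congr (_ * circle_integral _); apply/funext => t; rewrite mulrA.
Qed.

Lemma fourier_coefB f g k : ccont f -> ccont g ->
  fourier_coef (fun t => f t - g t) k = fourier_coef f k - fourier_coef g k.
Proof.
move=> cf cg; rewrite -mulN1r -fourier_coefZ// -fourier_coefD//; last first.
  by apply: ccontM => //; exact: ccont_cst.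
by apply: eq_fourier_coef => t; rewrite mulN1r.
Qed.

Lemma fourier_coef0 k : fourier_coef (fun _ : R => 0) k = 0.
Proof.
rewrite -[RHS](mul0r (fourier_coef (fun _ : R => 0) k)) -fourier_coefZ; last exact: ccont_cst.
by apply: eq_fourier_coef => t; rewrite mul0r.
Qed.

Lemma fourier_coef_sum (I : Type) (r : seq I) (F : I -> R -> R[i]) k :
  (forall i, ccont (F i)) ->
  fourier_coef (fun t => \sum_(i <- r) F i t) k = \sum_(i <- r) fourier_coef (F i) k.
Proof.
move=> cF; elim: r => [|i r IH].
  rewrite big_nil -[RHS](fourier_coef0 k); apply: eq_fourier_coef => t.
  by rewrite big_nil.
rewrite big_cons -IH -fourier_coefD//; last exact: ccont_sum.
by apply: eq_fourier_coef => t; rewrite big_cons.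
Qed.

Lemma normc_fourier_coef f k (B : R) : ccont f ->
  (forall t, 0 <= t <= 2 * pi -> normc (f t) <= B) ->
  normc (fourier_coef f k) <= 2 * B.
Proof.
move=> cf fB; rewrite /fourier_coef Normc.normcM normc_real.
have p0 := twopi_gt0.
rewrite ger0_norm ?invr_ge0 ?(ltW p0)// ler_pdivrMl// mulrA (mulrC _ 2).
apply: normc_circle_integral; first exact: ccontM (ccont_cis_char _ _).
by move=> t /fB; rewrite Normc.normcM normc_cis mulr1.
Qed.

Lemma fourier_coef_modulate f (m k : int) :
  fourier_coef (fun t => f t * cis (m%:~R * t)) k = fourier_coef f (k - m).
Proof.
rewrite /fourier_coef; congr (_ * circle_integral _); apply/funext => t.
by rewrite -mulrA -cisD intrB; congr (_ * cis _); ring.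
Qed.

Lemma continuous_intmul (n : int) : continuous (fun t : R => n%:~R * t).
Proof.
rewrite (_ : (fun _ => _) = (fun t => n%:~R * t + 0)); last first.
  by apply/funext => t; rewrite addr0.
exact: continuous_affine.
Qed.

Lemma ccont_cis_int (n : int) : ccont (fun t : R => cis (n%:~R * t)).
Proof. exact/ccont_cis/continuous_intmul. Qed.

Lemma fourier_coef_cis (n k : int) :
  fourier_coef (fun t : R => cis (n%:~R * t)) k = (n == k)%:R.
Proof.
have p0 := twopi_gt0; rewrite /fourier_coef circle_integralE.
rewrite (_ : (fun t => complex.Re _) = (fun t => cos ((n - k)%:~R * t))); last first.
  by apply/funext => t; rewrite -cisD /= intrB; congr cos; ring.
rewrite (_ : (fun t => complex.Im _) = (fun t => sin ((n - k)%:~R * t))); last first.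
  by apply/funext => t; rewrite -cisD /= intrB; congr sin; ring.
have [->|nk] := eqVneq n k.
  rewrite subrr (@eq_Int _ _ _ _ (fun=> 1)); last by move=> t _; rewrite mul0r cos0.
  rewrite [X in (_ +i* X)%C](@eq_Int _ _ _ _ (fun=> 0)); last by move=> t _; rewrite mul0r sin0.
  rewrite !Int_cst ?ltW// mul1r mul0r subr0.
  apply/eqP; rewrite eq_complex /= !mul0r mulr0 subr0 addr0 eqxx andbT.
  by rewrite mulVf// gt_eqF.
have a0 : (n - k)%:~R != 0 :> R by rewrite intr_eq0 subr_eq0.
have [a aE] : exists a : R, a = (n - k)%:~R by exists (n - k)%:~R.
rewrite -aE in a0 *.
have [c1 s0] : cos (a * (2 * pi)) = 1 /\ sin (a * (2 * pi)) = 0.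
  by have := cis_2pi R (n - k); rewrite -aE /cis => -[-> ->].
have d0 (t : R) : is_derive t 1 (fun t : R => a * t) a.
  by apply: is_derive_eq; rewrite /GRing.scale /= mulr1.
have ca : continuous (fun t : R => a * t) by rewrite aE; exact: continuous_intmul.
have dS (t : R) : is_derive t 1 (fun t => a^-1 * sin (a * t)) (cos (a * t)).
  have d2 := @is_derive1_comp R sin (fun t => a * t) t _ _ (is_derive_sin _) (d0 t).
  have := @is_deriveZ _ _ _ _ a^-1 _ _ _ d2.
  by rewrite /GRing.scale /= [X in is_derive _ _ _ X](_ : _ = cos (a * t)) //; field.
have dC (t : R) : is_derive t 1 (fun t => - a^-1 * cos (a * t)) (sin (a * t)).
  have d2 := @is_derive1_comp R cos (fun t => a * t) t _ _ (is_derive_cos _) (d0 t).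
  have := @is_deriveZ _ _ _ _ (- a^-1) _ _ _ d2.
  by rewrite /GRing.scale /= [X in is_derive _ _ _ X](_ : _ = sin (a * t)) //; field.
rewrite (FTC_derive p0 _ dS); last exact: continuous_cos_comp.
rewrite (FTC_derive p0 _ dC); last exact: continuous_sin_comp.
rewrite c1 s0 !mulr0 sin0 cos0 !mulr0 mulr1 !subrr.
by rewrite -[(0 +i* 0)%C]/(0 : R[i]) mulr0.
Qed.

(** Equal to cos((t - t0)/2)^(2N), the de la Vallée Poussin kernel without its normalisation: a
    nonnegative trigonometric polynomial with value 1 at [t0]. *)
Definition cker (t0 : R) (N : nat) (t : R) : R := ((1 + cos (t - t0)) / 2) ^+ N.

Lemma cker1E (t0 t : R) : ((1 + cos (t - t0)) / 2)%:C%C =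
  2^-1 + 4^-1 * cis (- t0) * cis (1%:~R * t) + 4^-1 * cis t0 * cis ((-1)%:~R * t) :> R[i].
Proof.
have -> : 2^-1 = ((2^-1 : R)%:C)%C by rewrite fmorphV rmorph_nat.
have -> : 4^-1 = ((4^-1 : R)%:C)%C by rewrite fmorphV rmorph_nat.
rewrite mul1r mulN1r /cis cosN sinN !cosN !sinN cosB.
by apply/eqP; rewrite eq_complex /=; apply/andP; split; apply/eqP; field.
Qed.

Lemma continuous_cker t0 N : continuous (cker t0 N).
Proof.
have c1 : continuous (fun t : R => (1 + cos (t - t0)) / 2).
  move=> t; apply: cvgM; last exact: cvg_cst.
  apply: cvgD; first exact: cvg_cst.
  apply: (@continuous_cos_comp _ (fun t : R => t - t0)) => s.
  by apply: cvgB; [exact: cvg_id|exact: cvg_cst].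
elim: N => [|N IH] t; first exact: cst_continuous.
rewrite /continuous_at (_ : cker t0 N.+1 = (fun t => (1 + cos (t - t0)) / 2 * cker t0 N t)).
  by apply: cvgM; [exact: c1|exact: IH].
by apply/funext => s; rewrite /cker exprS.
Qed.

Lemma ccont_real (F : R -> R) : continuous F -> ccont (fun t => (F t)%:C%C).
Proof. by move=> cF; split => //; exact: cst_continuous. Qed.

Lemma ccont_cker t0 N f : ccont f -> ccont (fun t => (cker t0 N t)%:C%C * f t).
Proof. by move=> cf; apply: ccontM => //; apply: ccont_real; exact: continuous_cker. Qed.

(** Effect of one kernel factor on the moduli of coefficients, read off from [cker1E]. The centre
    [t0] enters only through unimodular factors and disappears. *)
Definition smooth3 (a : int -> R) (k : int) : R :=
  2^-1 * a k + 4^-1 * a (k - 1) + 4^-1 * a (k + 1).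

Lemma smooth3_mono (a b : int -> R) : (forall k, a k <= b k) ->
  forall k, smooth3 a k <= smooth3 b k.
Proof. by move=> ab k; rewrite /smooth3 !lerD// ler_wpM2l. Qed.

Lemma fourier_coef_cker t0 N f k : ccont f ->
  normc (fourier_coef (fun t => (cker t0 N t)%:C%C * f t) k) <=
  iter N smooth3 (fun k => normc (fourier_coef f k)) k.
Proof.
move=> cf; elim: N k => [k|N IH k].
  rewrite (@eq_fourier_coef (fun t => (cker t0 0 t)%:C%C * f t) f)// => t.
  exact: mul1r.
apply: le_trans (smooth3_mono IH k); set g := fun t => (cker t0 N t)%:C%C * f t.
have cg : ccont g by exact: ccont_cker.
have -> : (fun t => (cker t0 N.+1 t)%:C%C * f t) = (fun t =>
    2^-1 * g t + (4^-1 * cis (- t0)) * (g t * cis (1%:~R * t))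
    + 4^-1 * cis t0 * (g t * cis ((-1)%:~R * t))).
  apply/funext => t; rewrite /g /cker exprS.
  have -> (x y : R) : (x * y)%:C%C = x%:C%C * y%:C%C by exact: rmorphM.
  by rewrite cker1E; ring.
have cs (n : int) (z : R[i]) : ccont (fun t => z * (g t * cis (n%:~R * t))).
  by apply: ccontM; [exact: ccont_cst|apply: ccontM => //; exact: ccont_cis_int].
have c2 : ccont (fun t => 2^-1 * g t) by apply: ccontM => //; exact: ccont_cst.
rewrite fourier_coefD//; last exact: ccontD.
rewrite fourier_coefD// !fourier_coefZ//; last 2 first.
- by apply: ccontM => //; exact: ccont_cis_int.
- by apply: ccontM => //; exact: ccont_cis_int.
rewrite !fourier_coef_modulate opprK /smooth3.
have n2 : normc (2^-1 : R[i]) = 2^-1.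
  by rewrite (_ : 2^-1 = ((2^-1 : R)%:C)%C) ?normc_real ?ger0_norm// fmorphV rmorph_nat.
have n4 : normc (4^-1 : R[i]) = 4^-1.
  by rewrite (_ : 4^-1 = ((4^-1 : R)%:C)%C) ?normc_real ?ger0_norm// fmorphV rmorph_nat.
apply: le_trans (normcD _ _) _; apply: lerD; last first.
  by rewrite !Normc.normcM n4 normc_cis mulr1.
apply: le_trans (normcD _ _) _; apply: lerD.
  by rewrite !Normc.normcM n2.
by rewrite !Normc.normcM n4 normc_cis mulr1.
Qed.

(** The weights 1/2, 1/4, 1/4 have sum 1, so convexity reduces the claim to three translates of the
    list, each again duplicate-free. *)
Lemma smooth3_lp (p C : R) (a : int -> R) : 1 <= p -> (forall k, 0 <= a k) ->
  (forall s, uniq s -> \sum_(k <- s) a k `^ p <= C) ->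
  forall s, uniq s -> \sum_(k <- s) smooth3 a k `^ p <= C.
Proof.
move=> p1 a0 aC s us.
apply: (@le_trans _ _ (\sum_(k <- s)
  (2^-1 * a k `^ p + 4^-1 * a (k - 1) `^ p + 4^-1 * a (k + 1) `^ p))).
  apply: ler_sum => k _.
  have := @jensen_powR R _ [:: 0%N; 1%N; 2%N] (nth 0 [:: 2^-1; 4^-1; 4^-1])
     (nth 0 [:: a k; a (k - 1); a (k + 1)]) p p1.
  rewrite !big_cons !big_nil /= !addr0 !addrA.
  have -> : 2^-1 + 4^-1 + 4^-1 = 1 :> R by field.
  rewrite powR1 mul1r; apply.
    by case=> [|[|[|[|n]]]] /=; rewrite ?invr_ge0.
  by case=> [|[|[|[|n]]]] /=.
rewrite !big_split /= -!mulr_sumr.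
have h1 := aC _ us.
have h2 : \sum_(k <- s) a (k - 1) `^ p <= C.
  rewrite -(big_map (fun k => k - 1) xpredT (fun k => a k `^ p)); apply: aC.
  by rewrite map_inj_uniq//; exact: addIr.
have h3 : \sum_(k <- s) a (k + 1) `^ p <= C.
  rewrite -(big_map (fun k => k + 1) xpredT (fun k => a k `^ p)); apply: aC.
  by rewrite map_inj_uniq//; exact: addIr.
lra.
Qed.

Lemma iter_smooth3_lp (p C : R) (a : int -> R) (N : nat) : 1 <= p ->
  (forall k, 0 <= a k) ->
  (forall s, uniq s -> \sum_(k <- s) a k `^ p <= C) ->
  forall s, uniq s -> \sum_(k <- s) (iter N smooth3 a k) `^ p <= C.
Proof.
move=> p1 a0 aC; elim: N => [//|N IH]; apply: smooth3_lp => //.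
elim: N {IH} => [//|N IH] k /=; rewrite /smooth3 !addr_ge0// mulr_ge0//.
Qed.

End fourier_coef.

(** * Trigonometric inequalities and concentration of the kernel *)

Section trigo_bounds.
Variable R : realType.
Implicit Types x y t r : R.

Lemma sin_MVT x : 0 < x -> exists2 c, 0 < c < x & sin x = cos c * x.
Proof.
move=> x0.
have [c cx] := @MVT R sin cos 0 x x0 (fun y _ => is_derive_sin y)
  (continuous_subspaceT (@continuous_sin R)).
by rewrite sin0 !subr0 => ->; exists c => //; move: cx; rewrite in_itv.
Qed.

Lemma normr_sin_le x : `|sin x| <= `|x|.
Proof.
wlog x0 : x / 0 <= x => [H|].
  by have [/H//|/ltW x0] := leP 0 x; rewrite -normrN -sinN -(normrN x) H// oppr_ge0.
move: x0; rewrite le_eqVlt => /predU1P[<-|x0]; first by rewrite sin0.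
have [c _ ->] := sin_MVT x0; rewrite normrM ler_piMl//.
exact: cos_max.
Qed.

Lemma cos_double_sin x : cos x = 1 - 2 * sin (x / 2) ^+ 2.
Proof.
rewrite [in LHS](splitr x) cosD.
have := cos2Dsin2 (x / 2).
by rewrite !expr2 => h; lra.
Qed.

Lemma cos_ge_quadratic x : 1 - x ^+ 2 / 2 <= cos x.
Proof.
rewrite cos_double_sin; have := normr_sin_le (x / 2).
rewrite -(@ler_pXn2r _ 2) ?nnegrE// !real_normK ?num_real// expr_div_n => h.
have : (2 : R) ^+ 2 = 4 by ring.
move=> h4; rewrite h4 in h; lra.
Qed.

Lemma sin_ge_half x : 0 <= x <= 1 -> x / 2 <= sin x.
Proof.
move=> /andP[]; rewrite le_eqVlt => /predU1P[<-|x0 x1]; first by rewrite mul0r sin0.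
have [c /andP[c0 cx] ->] := sin_MVT x0.
rewrite mulrC ler_pM2r//; have := cos_ge_quadratic c.
have : c ^+ 2 <= 1 by rewrite exprn_ile1 ?ltW//; lra.
lra.
Qed.

Lemma cos_le_of_dist x r : 0 <= r -> r <= `|x| -> `|x| <= 2 * pi - r -> cos x <= cos r.
Proof.
move=> r0; rewrite -[cos x]cos_norm; move: `|x| => {}x rx xr.
have mono y z : 0 <= y -> y <= z -> z <= pi -> cos z <= cos y.
  move=> y0 yz zp; have := @ltr_cos R z y.
  rewrite !in_itv /= y0 zp (le_trans y0 yz) (le_trans yz zp) => /(_ isT isT) H.
  by rewrite leNgt H -leNgt.
have [xp|/ltW xp] := leP x pi; first exact: mono.
have -> : cos x = cos (2 * pi - x).
  by rewrite cosB mulr_natl cos2pi sin2pi mul1r mul0r addr0.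
apply: mono => //; lra.
Qed.

Lemma cker_ge0 t0 N t : 0 <= cker t0 N t.
Proof. by apply: exprn_ge0; rewrite divr_ge0//; have := cos_geN1 (t - t0); lra. Qed.

(** Bernoulli's inequality for 1 - (1 - cos x)/2, where (1 - cos x)/2 <= x^2/4: the condition on N
    limits the loss to 1/2. *)
Lemma cker_ge_half t0 N t rho : N%:R * rho ^+ 2 <= 2 -> `|t - t0| <= rho ->
  2^-1 <= cker t0 N t.
Proof.
move=> Nr tr; rewrite /cker; set x := t - t0.
have bern (y : R) (n : nat) : 0 <= y -> y <= 1 -> 1 - n%:R * y <= (1 - y) ^+ n.
  move=> y0 y1; elim: n => [|n IH]; first by rewrite mul0r subr0 expr0.
  rewrite exprS; apply: le_trans (ler_wpM2l _ IH); last by rewrite subr_ge0.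
  rewrite -natr1; have : 0 <= n%:R * y * y by rewrite !mulr_ge0.
  nra.
pose y := (1 - cos x) / 2.
have -> : (1 + cos x) / 2 = 1 - y by rewrite /y; lra.
have y0 : 0 <= y by rewrite divr_ge0// subr_ge0 cos_le1.
have y1 : y <= 1 by rewrite /y; have := cos_geN1 x; lra.
apply: le_trans (bern y N y0 y1).
have yx : y <= x ^+ 2 / 4 by rewrite /y; have := cos_ge_quadratic x; lra.
have x2 : x ^+ 2 <= rho ^+ 2.
  rewrite -[x ^+ 2]real_normK ?num_real// ler_pXn2r ?nnegrE//.
  exact: le_trans tr.
have : N%:R * y <= N%:R * (rho ^+ 2 / 4) by rewrite ler_wpM2l//; lra.
by rewrite mulrA; lra.
Qed.

Lemma cker_le_far t0 N t r : 0 <= r -> r <= `|t - t0| -> `|t - t0| <= 2 * pi - r ->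
  cker t0 N t <= ((1 + cos r) / 2) ^+ N.
Proof.
move=> r0 rt tr; apply: lerXn2r; rewrite ?nnegrE.
- by have := cos_geN1 (t - t0); lra.
- by have := cos_geN1 r; lra.
- by have := cos_le_of_dist r0 rt tr; lra.
Qed.

(** The circle is cut into three zones: within [rho] the kernel is at least 1/2 and yields c rho,
    between [rho] and [r] the integrand is nonnegative, and beyond [r] the kernel is at most its
    value at distance [r]. *)
Lemma Int_cker_ge (G : R -> R) t0 N (rho r c M : R) : continuous G ->
  0 < rho -> rho <= r -> 0 <= t0 - r -> t0 + r <= 2 * pi -> N%:R * rho ^+ 2 <= 2 ->
  0 <= c -> 0 <= M ->
  (forall t, `|t - t0| <= r -> c <= G t) ->
  (forall t, 0 <= t <= 2 * pi -> - M <= G t) ->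
  c * rho - 2 * pi * M * ((1 + cos r) / 2) ^+ N
    <= Int 0 (2 * pi) (fun t => cker t0 N t * G t).
Proof.
move=> cG rho0 rhor tr1 tr2 Nr c0 M0 Gc GM.
set q := _ ^+ N; have q0 : 0 <= q.
  by rewrite exprn_ge0// divr_ge0//; have := cos_geN1 r; lra.
have cKG : continuous (fun t => cker t0 N t * G t).
  by move=> t; apply: cvgM; [exact: continuous_cker|exact: cG].
have far t : 0 <= t <= 2 * pi -> r <= `|t - t0| -> - (M * q) <= cker t0 N t * G t.
  move=> t02 rt; have tr3 : `|t - t0| <= 2 * pi - r by rewrite ler_norml; lra.
  have r0 : 0 <= r by lra.
  have kq : cker t0 N t <= q := cker_le_far N r0 rt tr3.
  have k0 := cker_ge0 t0 N t.
  have := GM _ t02; have := ler_wpM2r M0 kq.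
  move=> h1 h2; have := ler_wpM2l k0 h2; rewrite mulrN; lra.
have mid t : `|t - t0| <= r -> 0 <= cker t0 N t * G t.
  by move=> /Gc h; rewrite mulr_ge0 ?cker_ge0// (le_trans c0).
have cen t : `|t - t0| <= rho -> c / 2 <= cker t0 N t * G t.
  move=> tr; have h := cker_ge_half Nr tr.
  have h2 : c <= G t by apply: Gc; exact: le_trans rhor.
  by rewrite mulrC ler_pM.
have cc (z : R) : continuous (fun _ : R => z) by exact: cst_continuous.
rewrite (@Int_split _ _ _ (t0 - r)) //; last by lra.
rewrite (@Int_split _ (t0 - r) _ (t0 - rho)) //; [|lra..].
rewrite (@Int_split _ (t0 - rho) _ (t0 + rho)) //; [|lra..].
rewrite (@Int_split _ (t0 + rho) _ (t0 + r)) //; [|lra..].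
have i1 : - (M * q) * (t0 - r - 0) <= Int 0 (t0 - r) (fun t => cker t0 N t * G t).
  rewrite -Int_cst//; apply: le_Int => // t /andP[h1 h2]; apply: far; first lra.
  by rewrite ler_normr; lra.
have i2 : 0 * (t0 - rho - (t0 - r)) <= Int (t0 - r) (t0 - rho) (fun t => cker t0 N t * G t).
  rewrite -Int_cst//; last lra.
  by apply: le_Int => // t /andP[h1 h2]; apply: mid; rewrite ler_norml; lra.
have i3 : c / 2 * (t0 + rho - (t0 - rho)) <= Int (t0 - rho) (t0 + rho) (fun t => cker t0 N t * G t).
  rewrite -Int_cst//; last lra.
  by apply: le_Int => // t /andP[h1 h2]; apply: cen; rewrite ler_norml; lra.
have i4 : 0 * (t0 + r - (t0 + rho)) <= Int (t0 + rho) (t0 + r) (fun t => cker t0 N t * G t).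
  rewrite -Int_cst//; last lra.
  by apply: le_Int => // t /andP[h1 h2]; apply: mid; rewrite ler_norml; lra.
have i5 : - (M * q) * (2 * pi - (t0 + r)) <= Int (t0 + r) (2 * pi) (fun t => cker t0 N t * G t).
  rewrite -Int_cst//; apply: le_Int => // t /andP[h1 h2]; apply: far; first lra.
  by rewrite ler_normr; lra.
have Mq0 : 0 <= M * q by rewrite mulr_ge0.
have : 0 <= M * q * (2 * r) by rewrite mulr_ge0//; lra.
nra.
Qed.

Lemma cos_sub1_le r : 0 <= r <= 1 -> (1 + cos r) / 2 <= 1 - r ^+ 2 / 16.
Proof.
move=> /andP[r0 r1]; rewrite cos_double_sin.
have h : 0 <= r / 2 <= 1 by lra.
have := sin_ge_half h => h2.
have h3 : r ^+ 2 / 16 <= sin (r / 2) ^+ 2.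
  have -> : r ^+ 2 / 16 = (r / 2 / 2) ^+ 2 by field.
  by apply: lerXn2r; rewrite ?nnegrE//; lra.
lra.
Qed.

(** A rational substitute for exp(-n s), from (1 - s)(1 + (n+1)s) <= 1 + n s. *)
Lemma exprn_one_sub_le (s : R) (n : nat) : 0 <= s -> s <= 1 ->
  (1 - s) ^+ n * (1 + n%:R * s) <= 1.
Proof.
move=> s0 s1; elim: n => [|n IH]; first by rewrite expr0 mul0r addr0 mulr1.
apply: le_trans IH; rewrite exprS (mulrC (1 - s)) -mulrA ler_wpM2l ?exprn_ge0 ?subr_ge0//.
rewrite -natr1; have : 0 <= n%:R * s * s + s * s by rewrite addr_ge0 ?mulr_ge0.
nra.
Qed.

End trigo_bounds.

(** * Uniform limits *)

Section uniform_limits.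
Variable R : realType.
Local Notation normc := Normc.normc.

Lemma continuous_uniform_limit (F : nat -> R -> R) (G : R -> R) (b : nat -> R) :
  (forall n, continuous (F n)) -> (forall n t, `|G t - F n t| <= b n) ->
  b @ \oo --> 0 -> continuous G.
Proof.
move=> cF GF b0 t; apply/cvgrPdist_le => e e0.
have e3 : 0 < e / 3 by rewrite divr_gt0.
move/cvgrPdist_le : b0 => /(_ _ e3) [N _ /(_ N (leqnn N))] /=.
rewrite sub0r normrN => bN.
have /cvgrPdist_le/(_ _ e3) := cF N t; apply: filterS => s /= h.
have h1 := GF N t; have h2 := GF N s.
have h3 : b N <= e / 3 by apply: le_trans bN; exact: ler_norm.
have -> : G t - G s = (G t - F N t) + (F N t - F N s) - (G s - F N s) by ring.
apply: le_trans (ler_normB _ _) _; have := ler_normD (G t - F N t) (F N t - F N s).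
lra.
Qed.

Lemma real_cauchy_limit (u b : nat -> R) :
  (forall n m, (n <= m)%N -> `|u m - u n| <= b n) -> b @ \oo --> 0 ->
  exists l : R, forall n, `|l - u n| <= b n.
Proof.
move=> ub b0.
have : cvgn u.
  apply/cauchy_cvgP/cauchy_ballP => e e0.
  have e3 : 0 < e / 3 by rewrite divr_gt0.
  move/cvgrPdist_le : b0 => /(_ _ e3) [N _ /(_ N (leqnn N))] /=.
  rewrite sub0r normrN => bN.
  pose A := u @` [set n | (N <= n)%N].
  exists (A, A); first by split; exists N => // n Nn; exists n.
  move=> [_ _] /= [[n Nn <-] [m Nm <-]]; rewrite /ball /=.
  rewrite -(subrKA (u N)); apply: le_lt_trans (ler_normD _ _) _.
  have := ub _ _ Nn; have := ub _ _ Nm; rewrite (distrC (u N)).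
  have := ler_norm (b N); move: (e3); lra.
move=> /cvg_ex [l ul]; exists l => n.
by apply: (cvg_dist_le ul) => k; exact: ub.
Qed.

Lemma ccont_cauchy_limit (S : nat -> R -> R[i]) (b : nat -> R) :
  (forall n, ccont (S n)) ->
  (forall n m t, (n <= m)%N -> normc (S m t - S n t) <= b n) -> b @ \oo --> 0 ->
  exists2 g : R -> R[i], ccont g & forall n t, normc (g t - S n t) <= 2 * b n.
Proof.
move=> cS Sb b0.
have hRe t : exists l : R, forall n, `|l - complex.Re (S n t)| <= b n.
  apply: real_cauchy_limit => // n m nm; apply: le_trans (Sb n m t nm).
  by rewrite -raddfB; exact: Re_le_normc.
have hIm t : exists l : R, forall n, `|l - complex.Im (S n t)| <= b n.
  apply: real_cauchy_limit => // n m nm; apply: le_trans (Sb n m t nm).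
  by rewrite -raddfB; exact: Im_le_normc.
have [x Hx] := choice hRe; have [y Hy] := choice hIm.
exists (fun t => (x t +i* y t)%C).
  split.
    apply: (@continuous_uniform_limit (fun n t => complex.Re (S n t))) b0.
      by move=> n; case: (cS n).
    by move=> n t; exact: Hx.
  apply: (@continuous_uniform_limit (fun n t => complex.Im (S n t))) b0.
    by move=> n; case: (cS n).
  by move=> n t; exact: Hy.
move=> n t; apply: le_trans (normc_le_ReIm _) _; rewrite !raddfB /=.
by have := Hx t n; have := Hy t n; lra.
Qed.

Lemma fourier_coef_dist (f g : R -> R[i]) k (B : R) : ccont f -> ccont g ->
  (forall t, 0 <= t <= 2 * pi -> normc (f t - g t) <= B) ->
  normc (fourier_coef f k - fourier_coef g k) <= 2 * B.
Proof.
move=> cf cg fg; rewrite -fourier_coefB//; apply: normc_fourier_coef => //.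
have cg' : ccont (fun t => -1 * g t) by apply: ccontM => //; exact: ccont_cst.
have := ccontD cf cg'; congr ccont; apply/funext => t; by rewrite mulN1r.
Qed.

End uniform_limits.

(** * Uniqueness of Fourier coefficients *)

Section uniqueness.
Variable R : realType.
Local Notation normc := Normc.normc.

Lemma ccont_bounded (G : R -> R) (a b : R) : a <= b -> continuous G ->
  exists2 M, 0 <= M & forall t, a <= t <= b -> `|G t| <= M.
Proof.
move=> ab cG.
have cn : {within `[a, b], continuous (fun t => `|G t|)}.
  apply: continuous_subspaceT => t; apply: cvg_norm; exact: cG.
have [c cab H] := EVT_max ab cn.
by exists `|G c| => // t tab; apply: H; rewrite in_itv.
Qed.

(** If f(t0) is not 0, testing against kernels concentrated at t0 gives a positive integral, whereas
    vanishing coefficients force it to be 0. *)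
Lemma fourier_coef_eq0 (f : R -> R[i]) : ccont f -> (forall k, fourier_coef f k = 0) ->
  forall t, 0 < t < 2 * pi -> f t = 0.
Proof.
move=> cf f0 t0 /andP[t00 t02]; apply/eqP/negP => /negP ft0.
(* Multiplication by the conjugate of [f t0] makes the value at [t0] real and positive, so only a
   real part has to be tested. *)
pose z : R[i] := (f t0)^*%C.
pose g t := z * f t; pose G t := complex.Re (g t).
have cg : ccont g by apply: ccontM => //; exact: ccont_cst.
have cG : continuous G by case: cg.
have Gt0 : 0 < G t0.
  move: ft0; rewrite /G /g /z; case: (f t0) => x y; rewrite eq_complex /= negb_and.
  rewrite mulNr opprK -!expr2 => /orP[] h.
    by rewrite ltr_pwDl ?sqr_ge0// exprn_even_gt0.
  by rewrite ltr_wpDl ?sqr_ge0// exprn_even_gt0.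
have fg0 k : fourier_coef g k = 0 by rewrite (fourier_coefZ z k cf) f0 mulr0.
pose c := G t0 / 2; have c0 : 0 < c by rewrite divr_gt0.
(* The iterated averages of vanishing coefficients vanish, and they bound the zeroth coefficient of
   the kernel times [g]. *)
have kI N : Int 0 (2 * pi) (fun t => cker t0 N t * G t) = 0.
  have := fourier_coef_cker t0 N 0 cg.
  have -> : iter N (@smooth3 R) (fun k => normc (fourier_coef g k)) 0 = 0.
    elim: N (0 : int) => [k|N IH k]; first by rewrite /iter fg0 Normc.normc0.
    by rewrite iterS /smooth3 !IH !mulr0 !addr0.
  rewrite le_eqVlt ltNge normc_ge0 orbF => /eqP/Normc.eq0_normc.
  rewrite /fourier_coef => /eqP; rewrite mulf_eq0 => /orP[/eqP/(congr1 (@complex.Re _))/= /eqP|].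
    by rewrite invr_eq0 gt_eqF// twopi_gt0.
  move=> /eqP/(congr1 (@complex.Re _)); rewrite circle_integralE /= => {2}<-.
  apply: eq_Int => t _; rewrite /G mul0r oppr0 cis0 mulr1.
  by case: (g t) => x y /=; rewrite mul0r subr0.
have [r0 r0_gt0 Hr0] : exists2 r, 0 < r & forall t, `|t - t0| <= r -> c <= G t.
  have /cvgrPdist_lt/(_ _ c0) [e /= e0 He] := cG t0.
  exists (e / 2) => [|t tr]; first by rewrite divr_gt0.
  have /He /= : `|t0 - t| < e by rewrite distrC (le_lt_trans tr)// ltr_pdivrMr// ltr_pMr// ltr1n.
  by rewrite ltr_norml /c => /andP[_]; lra.
pose r := Num.min (Num.min r0 1) (Num.min t0 (2 * pi - t0)).
have r_gt0 : 0 < r by rewrite !lt_min r0_gt0 ltr01 t00 subr_gt0.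
have r1 : r <= 1 by rewrite !ge_min lexx orbT.
have rr0 : r <= r0 by rewrite !ge_min lexx.
have rt0 : r <= t0 by rewrite !ge_min lexx !orbT.
have rt1 : r <= 2 * pi - t0 by rewrite !ge_min lexx !orbT.
have [M M0 HM] := ccont_bounded (ltW (twopi_gt0 R)) cG.
pose s := r ^+ 2 / 16.
have s0 : 0 < s by rewrite divr_gt0// exprn_gt0.
have r2 : r ^+ 2 <= 1 by rewrite exprn_ile1// ltW.
have s1 : s <= 1 by rewrite /s; lra.
(* With order n^2 and radius 1/n the centre gives c/n and the far part at most 2 pi M / (1 + n^2 s);
   n > 2 pi M / (c s) makes these incompatible. *)
pose n := (Num.truncn (Num.max (2 * pi * M / (c * s)) r^-1)).+1.
have nM : 2 * pi * M / (c * s) < n%:R.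
  by apply: le_lt_trans (truncnS_gt _); rewrite le_max lexx.
have nr : r^-1 < n%:R.
  by apply: le_lt_trans (truncnS_gt _); rewrite le_max lexx orbT.
have n0 : 0 < n%:R :> R by rewrite ltr0n.
have := @Int_cker_ge R G t0 (n ^ 2) n%:R^-1 r c M cG.
rewrite kI invr_gt0 n0 => /(_ isT).
have -> : n%:R^-1 <= r by rewrite -[r]invrK lef_pV2 ?posrE ?invr_gt0// ltW.
rewrite subr_ge0 rt0 -lerBrDl rt1 natrX -exprMn divff ?gt_eqF// expr1n.
move=> /(_ isT isT isT _ (ltW c0) M0); rewrite (ler_nat _ 1 2) => /(_ isT).
have H1 t : `|t - t0| <= r -> c <= G t by move=> h; apply: Hr0; exact: le_trans rr0.
have H2 t : 0 <= t <= 2 * pi -> - M <= G t by move=> /HM; rewrite ler_norml => /andP[].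
move=> /(_ H1 H2).
set q := _ ^+ (n ^ 2).
have qle : q * (1 + n%:R ^+ 2 * s) <= 1.
  apply: le_trans (exprn_one_sub_le (n ^ 2) (ltW s0) s1).
  rewrite natrX ler_wpM2r ?addr_ge0 ?mulr_ge0 ?exprn_ge0 ?(ltW s0) ?(ltW r_gt0)//.
  rewrite /q; apply: lerXn2r; rewrite ?nnegrE.
  - by have := cos_geN1 r; lra.
  - by rewrite subr_ge0.
  - by apply: cos_sub1_le; rewrite (ltW r_gt0).
have q0 : 0 <= q by apply: exprn_ge0; have := cos_geN1 r; lra.
rewrite subr_le0 => h.
have h2 : 2 * pi * M < n%:R * (c * s) by rewrite -ltr_pdivrMr// mulr_gt0.
have D0 : 0 < 1 + n%:R ^+ 2 * s by rewrite addr_gt0// mulr_gt0// exprn_gt0.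
have h3 : c / n%:R * (1 + n%:R ^+ 2 * s) <= 2 * pi * M.
  apply: le_trans (ler_wpM2r (ltW D0) h) _.
  have pM : 0 <= 2 * pi * M by rewrite !mulr_ge0// pi_ge0.
  by rewrite -(mulrA _ q) -[leRHS]mulr1; apply: ler_wpM2l.
have h4 : c / n%:R * (1 + n%:R ^+ 2 * s) = c / n%:R + n%:R * (c * s).
  by field; rewrite gt_eqF.
have : 0 < c / n%:R by rewrite divr_gt0.
by move: h3; rewrite h4; lra.
Qed.

Lemma periodic2pi_int (T : Type) (f : R -> T) : periodic2pi f ->
  forall (k : int) t, f (t + k%:~R * (2 * pi)) = f t.
Proof.
move=> pf; have hn (n : nat) t : f (t + n%:R * (2 * pi)) = f t.
  elim: n => [|n IH]; first by rewrite mul0r addr0.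
  by rewrite -natr1 mulrDl mul1r addrA pf.
case=> n t; first exact: hn.
by rewrite NegzE mulrNz mulNr -[in RHS](subrK (n.+1%:R * (2 * pi)) t) hn.
Qed.

Lemma eq_mod2pi_periodic (T : Type) (f : R -> T) (x y : R) : periodic2pi f ->
  eq_mod2pi x y -> f x = f y.
Proof.
move=> pf [k xy]; rewrite -(periodic2pi_int pf k y) -xy; congr f; ring.
Qed.

Lemma periodic2pi_eq0 (f : R -> R[i]) : ccont f -> periodic2pi f ->
  (forall t, 0 < t < 2 * pi -> f t = 0) -> forall t, f t = 0.
Proof.
move=> cf pf f0.
have z0 (F : R -> R) : continuous F -> (forall t, 0 < t < 2 * pi -> F t = 0) -> F 0 = 0.
  move=> cF F0; apply/eqP/negP => /negP; rewrite -normr_gt0 => h.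
  have /cvgrPdist_lt/(_ _ h) [e /= e0 He] := cF 0.
  pose t := Num.min (e / 2) pi.
  have t0 : 0 < t by rewrite lt_min pi_gt0 divr_gt0.
  have tp : t <= pi by rewrite ge_min lexx orbT.
  have te : t <= e / 2 by rewrite ge_min lexx.
  have /He /= : `|0 - t| < e by rewrite sub0r normrN gtr0_norm//; lra.
  have tt : 0 < t < 2 * pi by apply/andP; split=> //; have := @pi_gt0 R; lra.
  by rewrite (F0 _ tt) subr0 ltxx.
have f00 : f 0 = 0.
  have [c1 c2] := cf.
  have h1 := z0 _ c1; have h2 := z0 _ c2.
  apply/eqP; rewrite eq_complex h1 ?h2 ?eqxx//.
    by move=> t /f0 ->.
  by move=> t /f0 ->.
move=> t; pose k := Num.floor (t / (2 * pi)).
have p0 := twopi_gt0 R.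
have -> : f t = f (t - k%:~R * (2 * pi)).
  by rewrite -[in LHS](subrK (k%:~R * (2 * pi)) t) (periodic2pi_int pf).
have k1 : k%:~R * (2 * pi) <= t by rewrite -ler_pdivlMr// floor_le_tmp.
have k2 : t < (k + 1)%:~R * (2 * pi) by rewrite -ltr_pdivrMr// floorD1_gt.
move: k2; rewrite intrD mulrDl mul1r => k2.
move: k1; rewrite le_eqVlt => /predU1P[->|k1]; first by rewrite subrr.
by apply: f0; rewrite subr_gt0 k1 /=; lra.
Qed.

End uniqueness.

(** * Fourier inversion in A(T) and superposition *)

Definition int_range (n : nat) : seq int := [seq (i%:Z - n%:Z) | i <- iota 0 n.*2.+1].

Lemma int_range_uniq n : uniq (int_range n).
Proof. by rewrite map_inj_uniq ?iota_uniq// => i j /addIr []. Qed.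

Lemma mem_int_range n (k : int) : (k \in int_range n) = (`|k| <= n)%N.
Proof.
apply/mapP/idP => [[j]|kn]; first by rewrite mem_iota => /andP[_ h] ->; lia.
by exists (absz (k + n%:Z)); [rewrite mem_iota|]; lia.
Qed.

Lemma int_range_perm n m : (n <= m)%N ->
  perm_eq (int_range m)
    (int_range n ++ [seq k <- int_range m | k \notin int_range n]).
Proof.
move=> nm; apply: uniq_perm; first exact: int_range_uniq.
  rewrite cat_uniq int_range_uniq filter_uniq ?int_range_uniq// andbT andTb.
  by apply/hasPn => k; rewrite mem_filter => /andP[].
move=> k; rewrite mem_cat mem_filter !mem_int_range.
by apply/idP/idP; lia.
Qed.

Lemma cvg_powR (R : realType) (u : nat -> R) (l p : R) : 0 < p ->
  (forall n, 0 <= u n) -> u @ \oo --> l -> (fun n => u n `^ p) @ \oo --> l `^ p.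
Proof.
move=> p0 u0 ul; have l0 : 0 <= l by apply: (cvg_ge (N := 0%N) ul).
(* A zero limit is treated by hand: the continuity of the power is taken from its derivative, which
   is available at positive points. *)
move: l0; rewrite le_eqVlt => /predU1P[l0|l0].
  rewrite -l0 powR0 ?gt_eqF//; apply/cvgrPdist_le => e e0.
  have e1 : 0 < e `^ p^-1 by rewrite powR_gt0.
  move/cvgrPdist_le : ul => /(_ _ e1); apply: filterS => n /=.
  rewrite -l0 !sub0r !normrN !ger0_norm ?powR_ge0// => h.
  apply: (@le_trans _ _ ((e `^ p^-1) `^ p)).
    by apply: ge0_ler_powR; rewrite ?nnegrE ?powR_ge0 ?(ltW p0).
  by rewrite -powRrM mulVf ?gt_eqF// powRr1// ltW.
have ch : {for l, continuous (fun x : R => x `^ p)}.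
  apply/differentiable_continuous/derivable1_diffP.
  by apply: derivable_powR; rewrite in_itv /= l0.
exact: (@continuous_cvg _ _ _ _ _ u (fun x : R => x `^ p) l ch ul).
Qed.

Lemma cvg_sum_seq (R : realType) (I : Type) (s : seq I) (u : nat -> I -> R) (l : I -> R) :
  (forall i, u n i @[n --> \oo] --> l i) ->
  (fun n => \sum_(i <- s) u n i) @ \oo --> \sum_(i <- s) l i.
Proof.
move=> ul; elim: s => [|i s IH].
  rewrite big_nil (_ : (fun _ => _) = (fun=> 0)); first exact: cvg_cst.
  by apply/funext => n; rewrite big_nil.
rewrite big_cons.
rewrite (_ : (fun _ => _) = (fun n => u n i + \sum_(i <- s) u n i)).
  by apply: cvgD.
by apply/funext => n; rewrite big_cons.
Qed.

Section inversion.
Variable R : realType.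
Local Notation normc := Normc.normc.

Lemma normc_dist (z w : R[i]) : `|normc z - normc w| <= normc (z - w).
Proof.
have h1 := normcD (z - w) w; have h2 := normcD (w - z) z.
rewrite !subrK in h1 h2; rewrite -(opprB z w) normcN in h2.
by rewrite ler_norml; lra.
Qed.

Definition fourier_sum (f : R -> R[i]) (n : nat) (t : R) : R[i] :=
  \sum_(k <- int_range n) fourier_coef f k * cis (k%:~R * t).

Lemma ccont_fourier_sum f n : ccont (fourier_sum f n).
Proof.
apply: ccont_sum => k; apply: ccontM; first exact: ccont_cst.
exact: ccont_cis_int.
Qed.

Lemma in_A_ccont (f : R -> R[i]) : in_A f -> ccont f.
Proof. by case=> _ cf _; exact: continuous_ccont. Qed.

(** The tails of the absolutely convergent series make the partial sums uniformly Cauchy; their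
    limit is continuous, periodic and has the coefficients of f, so the uniqueness theorem
    identifies it with f. *)
Lemma fourier_inversion (f : R -> R[i]) : in_A f ->
  exists2 b : nat -> R, b @ \oo --> 0 &
    forall n t, normc (f t - fourier_sum f n t) <= b n.
Proof.
move=> fA; have cf := in_A_ccont fA; case: fA => pf _ /A_norm_lty_bounded[W _ HW].
pose a k := normc (fourier_coef f k).
have a0 k : 0 <= a k by exact: normc_ge0.
pose A n := \sum_(k <- int_range n) a k.
have Asplit n m : (n <= m)%N ->
    A m = A n + \sum_(k <- [seq k <- int_range m | k \notin int_range n]) a k.
  by move=> nm; rewrite /A (perm_big _ (int_range_perm nm)) big_cat.
have Anon : {homo A : n m / (n <= m)%N >-> n <= m}.
  by move=> n m nm; rewrite (Asplit _ _ nm) lerDl sumr_ge0.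
have Acvg : cvgn A.
  apply: nondecreasing_is_cvgn => //; exists W => _ [n _ <-].
  by apply: HW; exact: int_range_uniq.
pose b n := limn A - A n.
have b0 : b @ \oo --> 0.
  rewrite -(subrr (limn A)); apply: cvgB; [exact: cvg_cst|exact: Acvg].
have Sb n m t : (n <= m)%N -> normc (fourier_sum f m t - fourier_sum f n t) <= b n.
  move=> nm; rewrite /fourier_sum (perm_big _ (int_range_perm nm)) big_cat.
  rewrite addrAC subrr add0r; apply: le_trans (normc_sum _ _) _.
  apply: (@le_trans _ _ (A m - A n)); last first.
    by rewrite /b lerD2r; exact: nondecreasing_cvgn_le.
  rewrite (Asplit n m nm) addrAC subrr add0r.
  by apply: ler_sum => k _; rewrite Normc.normcM normc_cis mulr1.
have [g cg Hg] := ccont_cauchy_limit (ccont_fourier_sum f) Sb b0.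
have b20 : (fun n => 2 * b n) @ \oo --> (0 : R).
  by rewrite -(mulr0 2); apply: cvgM => //; exact: cvg_cst.
(* From order |k| on, the k-th coefficient of the partial sum is exactly that of [f]. *)
have fcg k : fourier_coef g k = fourier_coef f k.
  apply/eqP; rewrite -subr_eq0; apply/eqP/Normc.eq0_normc/eqP.
  rewrite eq_le normc_ge0 andbT.
  have h4 : (fun n => 2 * (2 * b n)) @ \oo --> (0 : R).
    by rewrite -(mulr0 2); apply: cvgM => //; exact: cvg_cst.
  apply: (cvg_ge (N := absz k) h4) => n kn.
  have -> : fourier_coef f k = fourier_coef (fourier_sum f n) k.
    rewrite fourier_coef_sum; last first.
      by move=> j; apply: ccontM; [exact: ccont_cst|exact: ccont_cis_int].
    under eq_bigr => j _ do rewrite (fourier_coefZ _ _ (ccont_cis_int _ _)) fourier_coef_cis.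
    rewrite (bigD1_seq k) ?int_range_uniq ?mem_int_range//= eqxx mulr1 big1 ?addr0//.
    by move=> j /negPf ->; rewrite mulr0.
  by apply: fourier_coef_dist => //; exact: ccont_fourier_sum.
have pg : periodic2pi g.
  move=> t; apply/eqP; rewrite -subr_eq0; apply/eqP/Normc.eq0_normc/eqP.
  rewrite eq_le normc_ge0 andbT.
  have h4 : (fun n => 2 * (2 * b n)) @ \oo --> (0 : R).
    by rewrite -(mulr0 2); apply: cvgM => //; exact: cvg_cst.
  apply: (cvg_ge (N := 0%N) h4) => n _.
  have h : fourier_sum f n (t + 2 * pi) = fourier_sum f n t.
    apply: eq_bigr => k _; congr (_ * _).
    by rewrite mulrDr cisD cis_2pi mulr1.
  have h1 := Hg n t; have h2 := Hg n (t + 2 * pi); rewrite h in h2.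
  have -> : g (t + 2 * pi) - g t =
    (g (t + 2 * pi) - fourier_sum f n t) - (g t - fourier_sum f n t) by ring.
  by apply: le_trans (normcB _ _) _; lra.
have cd : ccont (fun t => f t - g t).
  have cg' : ccont (fun t => -1 * g t) by apply: ccontM => //; exact: ccont_cst.
  by have := ccontD cf cg'; congr ccont; apply/funext => t; rewrite mulN1r.
have fg t : f t = g t.
  apply/eqP; rewrite -subr_eq0; apply/eqP; move: t.
  apply: (periodic2pi_eq0 cd) => [t|]; first by rewrite pf pg.
  apply: (fourier_coef_eq0 cd) => k.
  by rewrite fourier_coefB// fcg subrr.
by exists (fun n => 2 * b n) => // n t; rewrite fg.
Qed.

Lemma ccont_in_A (f : R -> R[i]) (C : R) : periodic2pi f -> ccont f ->
  (forall s, uniq s -> \sum_(k <- s) normc (fourier_coef f k) <= C) -> in_A f.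
Proof.
move=> pf cf fC; split=> //; first exact: ccont_continuous.
by apply: le_lt_trans (A_norm_le fC) _; rewrite ltry.
Qed.

(* By Jensen with the weights |f^(k)|, the estimate for the exponentials passes
   to every f in A(T). *)
Lemma superposition_sum_le (p C W : R) (phi : R -> R) (f : R -> R[i]) :
  1 <= p -> 0 <= C -> continuous phi -> in_A f ->
  (forall s, uniq s -> \sum_(k <- s) normc (fourier_coef f k) <= W) ->
  (forall (n : int) s, uniq s ->
     \sum_(k <- s) normc (fourier_coef (fun t => cis (n%:~R * phi t)) k) `^ p <= C) ->
  forall s, uniq s -> \sum_(k <- s) normc (fourier_coef (f \o phi) k) `^ p <= W `^ p * C.
Proof.
move=> p1 C0 cphi fA HW HC s us.
have cf := in_A_ccont fA.
have W0 : 0 <= W by have := HW [::] isT; rewrite big_nil.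
have p0 : 0 < p by lra.
have [b b0 Hb] := fourier_inversion fA.
have cE (n : int) : ccont (fun t => cis (n%:~R * phi t)).
  have cn := @continuous_intmul R n.
  by apply: ccont_cis => t; apply: (continuous_comp (cphi t)); exact: cn.
pose S n := fourier_sum f n \o phi.
have cS n : ccont (S n) by apply: ccont_comp => //; exact: ccont_fourier_sum.
have cfp : ccont (f \o phi) by exact: ccont_comp.
(* The bound is proved for partial sums, uniformly in n; the list [s] being finite, it passes to the
   limit. *)
have SnC n : \sum_(k <- s) normc (fourier_coef (S n) k) `^ p <= W `^ p * C.
  pose w k := normc (fourier_coef f k).
  pose y j k := normc (fourier_coef (fun t => cis (j%:~R * phi t)) k).
  have w0 k : 0 <= w k by exact: normc_ge0.
  have y0 j k : 0 <= y j k by exact: normc_ge0.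
  have Wn : \sum_(j <- int_range n) w j <= W by apply: HW; exact: int_range_uniq.
  have Wn0 : 0 <= \sum_(j <- int_range n) w j by exact: sumr_ge0.
  apply: (@le_trans _ _ (\sum_(k <- s) W `^ (p - 1) *
      \sum_(j <- int_range n) w j * y j k `^ p)).
    apply: ler_sum => k _.
    apply: (@le_trans _ _ ((\sum_(j <- int_range n) w j * y j k) `^ p)).
      apply: ge0_ler_powR; rewrite ?nnegrE ?normc_ge0 ?(ltW p0)//.
        by apply: sumr_ge0 => j _; rewrite mulr_ge0.
      rewrite fourier_coef_sum; last first.
        by move=> j; apply: ccontM => //; exact: ccont_cst.
      apply: le_trans (normc_sum _ _) _; apply: ler_sum => j _.
      by rewrite fourier_coefZ// Normc.normcM.
    apply: le_trans (jensen_powR _ p1 w0 (y0^~ k)) _.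
    rewrite ler_wpM2r ?sumr_ge0// => [j _|]; first by rewrite mulr_ge0 ?powR_ge0.
    by apply: ge0_ler_powR; rewrite ?nnegrE// subr_ge0.
  rewrite -mulr_sumr exchange_big /=.
  rewrite -[W `^ p]mulr_powRB1// (mulrC W) -mulrA ler_wpM2l ?powR_ge0//.
  apply: (@le_trans _ _ (\sum_(j <- int_range n) w j * C)).
    by apply: ler_sum => j _; rewrite -mulr_sumr ler_wpM2l// HC.
  by rewrite -mulr_suml ler_wpM2r.
have cvk k : (fun n => normc (fourier_coef (S n) k)) @ \oo -->
    normc (fourier_coef (f \o phi) k).
  apply/cvgrPdist_le => e e0; have e2 : 0 < e / 2 by rewrite divr_gt0.
  move/cvgrPdist_le : b0 => /(_ _ e2); apply: filterS => n /=.
  rewrite sub0r normrN => /(le_trans (ler_norm _)) bn.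
  have h : normc (fourier_coef (f \o phi) k - fourier_coef (S n) k) <= e.
    rewrite (_ : e = 2 * (e / 2)); last by field.
    by apply: fourier_coef_dist => // t _; apply: le_trans (Hb n (phi t)) bn.
  exact: le_trans (normc_dist _ _) h.
have cvp k : (fun n => normc (fourier_coef (S n) k) `^ p) @ \oo -->
    normc (fourier_coef (f \o phi) k) `^ p.
  by apply: cvg_powR => // n; exact: normc_ge0.
have H := @cvg_sum_seq R _ s (fun n k => normc (fourier_coef (S n) k) `^ p)
  (fun k => normc (fourier_coef (f \o phi) k) `^ p) cvp.
by have := @cvg_le R _ _ _ 0%N H (fun n _ => SnC n).
Qed.

End inversion.

Lemma limit_periodic2pi (R : realType) (S : nat -> R -> R[i]) (g : R -> R[i]) (b : nat -> R) :
  (forall n, periodic2pi (S n)) -> (forall n t, Normc.normc (g t - S n t) <= b n) ->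
  b @ \oo --> 0 -> periodic2pi g.
Proof.
move=> pS Hg b0 t; apply/eqP; rewrite -subr_eq0; apply/eqP/Normc.eq0_normc/eqP.
rewrite eq_le normc_ge0 andbT.
have h4 : (fun n => 2 * b n) @ \oo --> (0 : R).
  by rewrite -(mulr0 2); apply: cvgM => //; exact: cvg_cst.
apply: (cvg_ge (N := 0%N) h4) => n _.
have h1 := Hg n t; have h2 := Hg n (t + 2 * pi); rewrite pS in h2.
have -> : g (t + 2 * pi) - g t =
  (g (t + 2 * pi) - S n t) - (g t - S n t) by ring.
by apply: le_trans (normcB _ _) _; lra.
Qed.

(** * Necessity *)

Section gliding_hump.
Variables (R : realType) (p : R) (phi : R -> R).
Local Notation normc := Normc.normc.

Definition comp_sum (s : seq int) (f : R -> R[i]) : R :=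
  \sum_(k <- s) normc (fourier_coef (f \o phi) k) `^ p.

(** For a fixed finite list the sum is stable under uniform perturbation; this protects a hump from
    the later ones. *)
Lemma comp_sum_perturb s (f g : R -> R[i]) (B : R) :
  1 <= p -> continuous phi -> ccont f -> ccont g ->
  (forall t, normc (f t - g t) <= B) ->
  comp_sum s f <= 2 `^ p * (comp_sum s g + (size s)%:R * (2 * B) `^ p).
Proof.
move=> p1 cphi cf cg fg.
have B0 : 0 <= B by apply: le_trans (fg 0); exact: normc_ge0.
have p0 : 0 <= p := le_trans ler01 p1.
have -> : (size s)%:R * (2 * B) `^ p = \sum_(k <- s) (2 * B) `^ p.
  by rewrite big_const_seq count_predT iter_addr_0 mulr_natl.
rewrite /comp_sum -big_split mulr_sumr; apply: ler_sum => k _.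
have B2 : 0 <= 2 * B by rewrite mulr_ge0.
apply: (le_trans _ (powR_add_le p1 (normc_ge0 (fourier_coef (g \o phi) k)) B2)).
apply: ge0_ler_powR => //; rewrite ?nnegrE ?normc_ge0//.
  by rewrite addr_ge0 ?normc_ge0// mulr_ge0.
have h := fourier_coef_dist k (ccont_comp cf cphi) (ccont_comp cg cphi) (fun t _ => fg (phi t)).
have := normc_dist (fourier_coef (f \o phi) k) (fourier_coef (g \o phi) k).
by rewrite ler_norml => /andP[_]; lra.
Qed.

Let E (n : nat) (t : R) : R[i] := cis (n%:Z%:~R * t).

Lemma in_A_addE (f : R -> R[i]) (c B : R) n : 0 <= c -> ccont f -> periodic2pi f ->
  (forall s, uniq s -> \sum_(k <- s) normc (fourier_coef f k) <= B) ->
  let f' := fun t => f t + c%:C%C * E n t in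
  [/\ ccont f', periodic2pi f' &
   forall s, uniq s -> \sum_(k <- s) normc (fourier_coef f' k) <= B + c].
Proof.
move=> c0 cf pf fB f'; have cE : ccont (E n) by exact: ccont_cis_int.
have cE' : ccont (fun t => c%:C%C * E n t) by apply: ccontM => //; exact: ccont_cst.
split; first exact: ccontD.
  by move=> t; rewrite /f' pf /E mulrDr cisD cis_2pi mulr1.
move=> s us; rewrite /f'.
apply: (@le_trans _ _ (\sum_(k <- s) (normc (fourier_coef f k) + c * (n%:Z == k)%:R))).
  apply: ler_sum => k _; rewrite fourier_coefD// (fourier_coefZ _ _ cE) fourier_coef_cis.
  apply: le_trans (normcD _ _) _; rewrite lerD2l Normc.normcM normc_real ger0_norm//.
  by case: eqP => _; rewrite ?Normc.normc0 ?Normc.normc1.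
rewrite big_split /= -mulr_sumr; apply: lerD; first exact: fB.
rewrite -[leRHS]mulr1 ler_wpM2l// -natr_sum -[leRHS]/(1%:R) ler_nat.
have -> : (\sum_(k <- s) (n%:Z == k) = count_mem n%:Z s)%N.
  rewrite -sum1_count [RHS]big_mkcond /=; apply: eq_bigr => k _.
  by rewrite eq_sym; case: eqP.
by rewrite count_uniq_mem//; case: (_ \in _).
Qed.

(** One hump: [n] is chosen after [f], so that the exponential outweighs everything f contributes,
    and the remaining budget [r'] is chosen after the list [s], so that changes of uniform size 2 r'
    cannot undo it. *)
Lemma gliding_step (f : R -> R[i]) (r : R) (j : nat) :
  1 <= p -> continuous phi ->
  (forall f, in_A f -> exists C : R, forall s, uniq s -> comp_sum s f <= C) ->
  (forall C : R, exists n s, uniq s /\ C < comp_sum s (E n)) ->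
  0 < r -> in_A f -> exists n (r' : R), [/\ 0 < r', r' <= r / 2 &
    exists2 s, uniq s & forall g, ccont g ->
      (forall t, normc (g t - (f t + (r / 2)%:C%C * E n t)) <= 2 * r') ->
      j%:R <= 2 `^ p * (comp_sum s g + 1)].
Proof.
move=> p1 cphi compA unb r0 fA; have [Cf HCf] := compA _ fA.
have cf := in_A_ccont fA.
have p0 : 0 < p := lt_le_trans ltr01 p1.
have c0 : 0 < r / 2 by rewrite divr_gt0.
(* The value comes from (r/2)^p S(E n) <= 2^p (S(f') + S(f)) with S(f) <= Cf, where S is
   [comp_sum]. *)
have [n [s [us Hs]]] := unb (2 `^ p * (j%:R + Cf) / (r / 2) `^ p).
have cE : ccont (E n) by exact: ccont_cis_int.
pose f' t := f t + (r / 2)%:C%C * E n t.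
have cE' : ccont (fun t => (r / 2)%:C%C * E n t).
  by apply: ccontM => //; exact: ccont_cst.
have cf' : ccont f' by exact: ccontD.
have jf' : j%:R <= comp_sum s f'.
  have h1 : (r / 2) `^ p * comp_sum s (E n) <= 2 `^ p * (comp_sum s f' + comp_sum s f).
    rewrite /comp_sum -big_split !mulr_sumr; apply: ler_sum => k _.
    apply: (le_trans _ (powR_add_le p1 (normc_ge0 (fourier_coef (f' \o phi) k))
      (normc_ge0 (fourier_coef (f \o phi) k)))).
    rewrite -(@powRM _ _ _ p (ltW c0) (normc_ge0 (fourier_coef (E n \o phi) k))).
    apply: ge0_ler_powR; rewrite ?nnegrE ?(ltW p0)//.
    - by rewrite mulr_ge0 ?normc_ge0 ?(ltW c0).
    - by rewrite addr_ge0 ?normc_ge0.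
    have cEp := ccont_comp cE cphi; have cf'p := ccont_comp cf' cphi.
    have cfp := ccont_comp cf cphi.
    have fE : (fun t => (f' \o phi) t - (f \o phi) t) =
        (fun t => (r / 2)%:C%C * (E n \o phi) t).
      by apply/funext => t; rewrite /f' /= addrAC subrr add0r.
    have := normcB (fourier_coef (f' \o phi) k) (fourier_coef (f \o phi) k).
    rewrite -(fourier_coefB k cf'p cfp) fE (fourier_coefZ _ k cEp) Normc.normcM.
    by rewrite normc_real (ger0_norm (ltW c0)).
  have rp : 0 < (r / 2) `^ p by rewrite powR_gt0.
  move: Hs; rewrite ltr_pdivrMr// [X in _ < X]mulrC => h2.
  have := lt_le_trans h2 h1; rewrite ltr_pM2l ?powR_gt0// => h3.
  by rewrite -(lerD2r Cf); apply/ltW/(lt_le_trans h3); rewrite lerD2l HCf.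
(* The perturbation term is (size s)(4 r')^p; here 4 r' <= 1/(size s + 1) <= 1 and p >= 1 bound it
   by 1. *)
pose r' := Num.min (r / 2) (4 * (size s).+1%:R)^-1.
have r'0 : 0 < r' by rewrite lt_min c0 invr_gt0 mulr_gt0.
exists n, r'; split => //; first by rewrite ge_min lexx.
exists s => // g cg Hg.
have Hg' t : normc (f' t - g t) <= 2 * r' by rewrite -normcN opprB; exact: Hg.
have h := comp_sum_perturb s p1 cphi cf' cg Hg'; apply: le_trans jf' (le_trans h _).
rewrite ler_wpM2l ?powR_ge0// lerD2l mulrA.
have -> : 2 * 2 = 4 :> R by ring.
have r4 : 4 * r' <= (size s).+1%:R^-1.
  by rewrite -ler_pdivlMl// -invfM ge_min lexx orbT.
have r41 : 4 * r' <= 1.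
  by apply: le_trans r4 _; rewrite invf_le1// ler1n.
have r4p : (4 * r') `^ p <= 4 * r'.
  by apply: ge1r_powR => //; rewrite r41 mulr_gt0.
apply: le_trans (ler_wpM2l _ (le_trans r4p r4)) _ => //.
by rewrite ler_pdivrMr// mul1r ler_nat.
Qed.

Lemma exponentials_bounded :
  1 <= p -> continuous phi ->
  (forall f, in_A f -> exists C : R, forall s, uniq s -> comp_sum s f <= C) ->
  exists C : R, forall (n : nat) s, uniq s ->
  \sum_(k <- s) normc (fourier_coef (fun t => cis (n%:Z%:~R * phi t)) k) `^ p <= C.
Proof.
move=> p1 cphi compA; apply: contrapT => nC.
have unb C : exists n s, uniq s /\ C < comp_sum s (E n).
  apply: contrapT => h; apply: nC; exists C => n s us; rewrite leNgt; apply/negP => h2.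
  by apply: h; exists n, s.
pose st := ((R -> R[i]) * R)%type.
(* Existence is stated for every state, with its hypotheses inside, so that the axiom of choice
   yields a step function on all states. *)
have step (x : nat * st) : exists y : st, 0 < x.2.2 -> in_A x.2.1 ->
   [/\ 0 < y.2, y.2 <= x.2.2 / 2,
    (exists n, y.1 = fun t => x.2.1 t + (x.2.2 / 2)%:C%C * E n t) &
    exists2 s, uniq s & forall g, ccont g ->
      (forall t, normc (g t - y.1 t) <= 2 * y.2) ->
      x.1%:R <= 2 `^ p * (comp_sum s g + 1)].
  case: x => j [f r] /=.
  have [r0|nr] := pselect (0 < r); last by exists (f, r).
  have [fA|nf] := pselect (in_A f); last by exists (f, r).
  have [n [r' [r'0 r'r [s us Hs]]]] := gliding_step j p1 cphi compA unb r0 fA.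
  exists (fun t => f t + (r / 2)%:C%C * E n t, r') => _ _; split => //; last by exists s.
  by exists n.
have [F HF] := choice step.
pose q := fix q (j : nat) : st := if j is j'.+1 then F (j', q j') else (fun=> 0, 1).
(* The coefficient sum plus the remaining budget stays at most 1: a step spends r/2 and keeps at
   most r/2. *)
have inv j : [/\ 0 < (q j).2, ccont (q j).1, periodic2pi (q j).1 &
    forall s, uniq s -> \sum_(k <- s) normc (fourier_coef (q j).1 k) <= 1 - (q j).2].
  elim: j => [|j [r0 cf pf fB]].
    split; [exact: ltr01|exact: ccont_cst|by []|move=> s _].
    by rewrite [leRHS]subrr big1// => k _; rewrite fourier_coef0 Normc.normc0.
  have fA := ccont_in_A pf cf fB.
  have [y0 yr [n yE] _] := HF (j, q j) r0 fA.
  rewrite /= yE.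
  have c0 : 0 <= (q j).2 / 2 by rewrite divr_ge0// ltW.
  have [c' p' B'] := in_A_addE n c0 cf pf fB.
  split => // s us; apply: le_trans (B' s us) _; move: yr => /=; lra.
have fA j : in_A (q j).1 by have [r0 cf pf fB] := inv j; exact: ccont_in_A pf cf fB.
have Hq j := HF (j, q j) (let: And4 h _ _ _ := inv j in h) (fA j).
have qr j : (q j).2 <= 2^-1 ^+ j.
  elim: j => [|j IH]; first by rewrite expr0.
  by have [_ h _ _] := Hq j; apply: le_trans h _; rewrite exprS /= mulrC ler_wpM2l.
have b0 : (fun j => (q j).2) @ \oo --> 0.
  apply: (@cvg_geometric_bound R _ 0 1) => n.
  by rewrite subr0 mul1r ger0_norm//; have [/ltW] := inv n.
have Sb n m t : (n <= m)%N -> normc ((q m).1 t - (q n).1 t) <= (q n).2.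
  move=> nm; suff : normc ((q m).1 t - (q n).1 t) <= (q n).2 - (q m).2.
    by have [h _ _ _] := inv m; lra.
  rewrite -(subnKC nm); elim: (m - n)%N => [|k IH].
    by rewrite addn0 !subrr Normc.normc0.
  have [_ h [l hl] _] := Hq (n + k)%N; rewrite addnS /= hl /= in h *.
  rewrite addrAC; apply: le_trans (normcD _ _) _.
  rewrite Normc.normcM normc_cis mulr1 normc_real ger0_norm; first by lra.
  by have [h0 _ _ _] := inv (n + k)%N; lra.
have [g cg Hg] := ccont_cauchy_limit (fun n => let: And4 _ h _ _ := inv n in h) Sb b0.
have b2 : (fun j => 2 * (q j).2) @ \oo --> (0 : R).
  by rewrite -(mulr0 2); apply: cvgM => //; exact: cvg_cst.
have pg : periodic2pi g.
  by apply: limit_periodic2pi Hg b2 => n; have [] := inv n.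
have gA : in_A g.
  apply: (@ccont_in_A _ g 1) => // s us.
  have h : (fun j => 1 + (size s)%:R * (2 * (2 * (q j).2))) @ \oo --> (1 + (size s)%:R * (2 * 0) : R).
    by apply: cvgD; [exact: cvg_cst|apply: cvgM; [exact: cvg_cst|apply: cvgM => //; exact: cvg_cst]].
  rewrite !mulr0 addr0 in h; apply: (cvg_ge (N := 0%N) h) => j _.
  have [r0 cj _ Bj] := inv j.
  apply: (@le_trans _ _ (\sum_(k <- s) (normc (fourier_coef (q j).1 k) + 2 * (2 * (q j).2)))).
    apply: ler_sum => k _.
    have h1 := fourier_coef_dist k cg cj (fun t _ => Hg j t).
    have := normc_dist (fourier_coef g k) (fourier_coef (q j).1 k).
    by rewrite ler_norml => /andP[_]; lra.
  rewrite big_split; apply: lerD; first by apply: le_trans (Bj s us) _; lra.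
  by rewrite big_const_seq count_predT iter_addr_0 [leRHS]mulr_natl.
have [C HC] := compA _ gA.
have p2 : 0 < 2 `^ p :> R by rewrite powR_gt0.
(* The limit is within the tolerance reserved at step j, so its sum over the j-th list grows at
   least linearly in j, although it is bounded by C. *)
have jC (j : nat) : j%:R <= 2 `^ p * (C + 1).
  have [_ _ _ [s us Hs]] := Hq j.
  apply: le_trans (Hs g cg (Hg j.+1)) _.
  by rewrite ler_pM2l// lerD2r HC.
have := jC (Num.truncn (2 `^ p * (C + 1))).+1.
by rewrite leNgt truncnS_gt.
Qed.

End gliding_hump.

(** * Lower bounds for localized coefficients *)

Section necessity.
Variable R : realType.
Local Notation normc := Normc.normc.

(** At [t0] the local frequency n w(t0) equals k, so the phase n psi(t) - k t is stationary there
    and varies by at most 1 on the window; no oscillation cancels the central mass of the kernel. *)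
Lemma normc_fourier_coef_cker_ge (psi w : R -> R) (n : nat) (k : int)
    (t0 d rho B : R) (N : nat) :
  (forall t : R, is_derive t 1 psi (w t)) ->
  (forall s t, `|s - t| <= d -> `|w s - w t| <= B) ->
  n%:R * w t0 = k%:~R -> n%:R * d * B <= 1 ->
  0 <= t0 - d -> t0 + d <= 2 * pi -> 0 < rho -> rho <= d -> N%:R * rho ^+ 2 <= 2 ->
  (2 * pi)^-1 * (rho / 2 - 2 * pi * ((1 + cos d) / 2) ^+ N) <=
  normc (fourier_coef (fun t => (cker t0 N t)%:C%C * cis (n%:Z%:~R * psi t)) k).
Proof.
move=> dpsi wB wk ndB td1 td2 rho0 rhod Nrho.
have cpsi : continuous psi.
  by move=> t; apply/differentiable_continuous/derivable1_diffP; case: (dpsi t).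
pose th t := n%:R * psi t - k%:~R * t.
pose G t := cos (th t - th t0).
have cth : continuous (fun t => th t - th t0).
  move=> t; apply: cvgB; last exact: cvg_cst.
  by apply: cvgB; apply: cvgM; by [exact: cvg_cst|exact: cvg_id|exact: cpsi].
have cG : continuous G by exact: continuous_cos_comp.
(* By the mean value theorem the phase moves by at most n d B <= 1, and cos x >= 1 - x^2/2. *)
have G1 t : `|t - t0| <= d -> 2^-1 <= G t.
  move=> tt0; have h : `|th t - th t0| <= 1.
    have [c hc psiE] : exists2 c, `|c - t0| <= d & psi t - psi t0 = w c * (t - t0).
      have cw a b : {within `[a, b], continuous psi} by exact: continuous_subspaceT.
      have [le|/ltW le] := leP t0 t.
        have [c] := MVT_segment le (fun x _ => dpsi x) (cw _ _).
        rewrite in_itv /= => /andP[h1 h2] ->; exists c => //.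
        by move: tt0; rewrite !ler_norml; lra.
      have [c] := MVT_segment le (fun x _ => dpsi x) (cw _ _).
      rewrite in_itv /= => /andP[h1 h2] E; exists c; last by move: E; lra.
      by move: tt0; rewrite !ler_norml; lra.
    have -> : th t - th t0 = n%:R * (w c - w t0) * (t - t0).
      rewrite /th -wk.
      have -> : n%:R * psi t = n%:R * (psi t0 + (w c * (t - t0))) by rewrite -psiE; ring.
      by ring.
    rewrite !normrM normr_nat.
    have hw := wB _ _ hc.
    apply: le_trans ndB; rewrite -!mulrA ler_wpM2l// mulrC.
    by apply: ler_pM.
  rewrite /G; have := cos_ge_quadratic (th t - th t0).
  have : (th t - th t0) ^+ 2 <= 1.
    by rewrite -real_normK ?num_real// exprn_ile1.
  lra.
have G2 t : 0 <= t <= 2 * pi -> - 1 <= G t by move=> _; exact: cos_geN1.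
have h2 : 0 <= 2^-1 :> R by rewrite invr_ge0.
have h := Int_cker_ge cG rho0 rhod td1 td2 Nrho h2 ler01 G1 G2.
have p0 := twopi_gt0 R.
pose g t := (cker t0 N t)%:C%C * cis (n%:Z%:~R * psi t).
(* A unimodular rotation brings the phase at [t0] to 0, so that the real part captures the whole
   main term. *)
have -> : normc (fourier_coef g k) = normc (cis (- th t0) * fourier_coef g k).
  by rewrite [RHS]Normc.normcM normc_cis mul1r.
apply: le_trans (le_trans (ler_norm _) (Re_le_normc _)).
have cg : ccont g.
  apply/ccont_cker/ccont_cis => t; apply: (continuous_comp (cpsi t)).
  exact: continuous_intmul.
rewrite -fourier_coefZ// /fourier_coef circle_integralE /= mul0r subr0.
rewrite ler_pM2l ?invr_gt0//; move: h; rewrite mulr1 mulrC => /le_trans; apply.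
rewrite le_eqVlt; apply/orP; left; apply/eqP; apply: eq_Int => t _.
rewrite /G (_ : th t = n%:~R * psi t - k%:~R * t)//.
by rewrite !cosN !sinN cosB cosB sinB; ring.
Qed.

Lemma iter_smooth3_ge0 (a : int -> R) (N : nat) (k : int) :
  (forall j, 0 <= a j) -> 0 <= iter N (@smooth3 R) a k.
Proof.
move=> a0; elim: N k => [k|N IH k]; first exact: a0.
by rewrite iterS /smooth3 !addr_ge0// mulr_ge0.
Qed.

(* Few coefficients can carry e^{i n psi}: the local frequencies n psi' fill an
   interval of length n(be - al). *)
Lemma sum_fourier_coef_ge (psi w : R -> R) (n : nat) (a b d rho B p C : R) (N : nat) :
  1 <= p -> a <= b ->
  (forall t : R, is_derive t 1 psi (w t)) -> continuous w ->
  (forall s t, `|s - t| <= d -> `|w s - w t| <= B) ->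
  n%:R * d * B <= 1 -> d <= a -> b <= 2 * pi - d ->
  0 < rho -> rho <= d -> N%:R * rho ^+ 2 <= 2 ->
  0 <= rho / 2 - 2 * pi * ((1 + cos d) / 2) ^+ N ->
  (forall s, uniq s ->
    \sum_(k <- s) normc (fourier_coef (fun t => cis (n%:Z%:~R * psi t)) k) `^ p <= C) ->
  (n%:R * `|w b - w a| - 1) *
    ((2 * pi)^-1 * (rho / 2 - 2 * pi * ((1 + cos d) / 2) ^+ N)) `^ p <= C.
Proof.
move=> p1 ab dpsi cw wB ndB da bd rho0 rhod Nrho; set c0 := _ - _ => c00 HC.
have p0 := twopi_gt0 R.
have cpsi : continuous psi.
  by move=> t; apply/differentiable_continuous/derivable1_diffP; case: (dpsi t).
pose al := Num.min (w a) (w b); pose be := Num.max (w a) (w b).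
have abE : `|w b - w a| = be - al.
  rewrite /be /al; have [h|h] := leP (w a) (w b).
    by rewrite ger0_norm// subr_ge0.
  by rewrite ltr0_norm ?subr_lt0// opprB.
have albe : al <= be by rewrite -subr_ge0 -abE.
(* The list of k starts just above n al and has at most n(be - al) entries, so every entry is a
   value of n w on [a, b]. *)
pose L := Num.truncn (n%:R * (be - al)).
pose F := Num.floor (n%:R * al).
pose s := [seq (F + 1 + i%:Z) | i <- iota 0 L].
have us : uniq s by rewrite map_inj_uniq ?iota_uniq// => i j /addrI [].
have nba0 : 0 <= n%:R * (be - al) by rewrite mulr_ge0// subr_ge0.
have LE : (n%:R * (be - al) - 1) <= L%:R.
  have := truncnS_gt (n%:R * (be - al)); rewrite -/L -natr1; lra.
have size_s : size s = L by rewrite size_map size_iota.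
pose g t := cis (n%:Z%:~R * psi t).
have cg : ccont g.
  apply: ccont_cis => t; apply: (continuous_comp (cpsi t)).
  exact: continuous_intmul.
(* The iterated average does not involve the kernel's centre, so one sum serves all k although the
   point [t0] found below depends on k. *)
have HS := iter_smooth3_lp N p1 (fun k => normc_ge0 (fourier_coef g k)) HC us.
apply: le_trans HS.
apply: (@le_trans _ _ (\sum_(k <- s) ((2 * pi)^-1 * c0) `^ p)); last first.
  rewrite !big_seq; apply: ler_sum => k ks.
  have [l] : exists2 l, l \in iota 0 L & k = F + 1 + l%:Z by exact/mapP.
  rewrite mem_iota add0n => /andP[_ iL] kE.
  have hk : n%:R * al <= k%:~R <= n%:R * be.
    have h1 : n%:R * al < (F + 1)%:~R by exact: floorD1_gt.
    have h2 : F%:~R <= n%:R * al by exact: floor_le_tmp.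
    have h3 : l.+1%:R <= n%:R * (be - al) by rewrite -truncn_ge_nat.
    have i0 : 0 <= l%:R :> R by [].
    move: h1 h3; rewrite kE !intrD -natr1 mulrBr => h1 h3.
    have -> : l%:Z%:~R = l%:R :> R by [].
    by apply/andP; split; move: h1 h2 h3; lra.
  have cnw : {within `[a, b], continuous (fun t => n%:R * w t)}.
    apply: continuous_subspaceT => t; apply: cvgM; [exact: cvg_cst|exact: cw].
  have hmin : Num.min (n%:R * w a) (n%:R * w b) <= k%:~R <=
              Num.max (n%:R * w a) (n%:R * w b).
    by rewrite -minr_pMr// -maxr_pMr.
  have [t0 ht0 t0E] := IVT ab cnw hmin.
  have /andP[at0 t0b] : a <= t0 <= b by move: ht0; rewrite in_itv.
  apply: ge0_ler_powR; rewrite ?nnegrE.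
  - exact: le_trans ler01 p1.
  - by rewrite mulr_ge0// invr_ge0 ltW.
  - apply: iter_smooth3_ge0 => j; exact: normc_ge0.
  apply: le_trans (fourier_coef_cker t0 N k cg).
  apply: (normc_fourier_coef_cker_ge dpsi wB t0E ndB) => //; lra.
rewrite big_const_seq count_predT size_s iter_addr_0 -[leRHS]mulr_natl abE.
by rewrite ler_wpM2r// powR_ge0.
Qed.

End necessity.

(** * The resulting lower bound for omega *)

Section modulus_lower_bound.
Variable R : realType.
Local Notation normc := Normc.normc.

Lemma powR_near0_lt (x c : R) : 0 < x -> 0 < c -> \forall d \near 0^'+, d `^ x < c.
Proof. by move=> x0 c0; apply: (cvgr_lt _ (powR_cvg0 x0)). Qed.

Lemma powRD_gt0 (x r s : R) : 0 < x -> x `^ (r + s) = x `^ r * x `^ s.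
Proof. by move=> x0; rewrite powRD// (gt_eqF x0) implybT. Qed.

(** A kernel of order N' about (d z)^-2 is only of size 16 z^2 at distance d. Its m-th power gains
    16^m z^(2m), which beats the width d z / m of the peak. *)
Lemma far_kernel_le (m : nat) (d z : R) : (0 < m)%N -> 0 < d -> d <= 1 -> 0 < z ->
  z <= 1 -> z ^+ (2 * m) <= d * z ^+ 2 ->
  exists2 N : nat, N%:R * (d * z / m%:R) ^+ 2 <= 2 &
    ((1 + cos d) / 2) ^+ N <= 16 ^+ m * (d * z ^+ 2).
Proof.
move=> m0 d0 d1 z0 z1 zm.
have m0' : 0 < m%:R :> R by rewrite ltr0n.
have m1 : 1 <= m%:R :> R by rewrite ler1n.
pose Y := ((d * z) ^+ 2)^-1.
have dz0 : 0 < d * z by rewrite mulr_gt0.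
have dz1 : d * z <= 1 by rewrite mulr_ile1// ltW.
have Y1 : 1 <= Y by rewrite invf_ge1 ?exprn_gt0// exprn_ile1// ltW.
pose N' := (Num.truncn Y).+1.
have NY : Y < N'%:R by exact: truncnS_gt.
have NY2 : N'%:R <= 2 * Y.
  have : (Num.truncn Y)%:R <= Y by rewrite truncn_le; lra.
  by rewrite /N' -natr1; lra.
exists (m * N')%N.
  rewrite natrM expr_div_n.
  have -> : m%:R * N'%:R * ((d * z) ^+ 2 / m%:R ^+ 2) = N'%:R * (d * z) ^+ 2 / m%:R.
    by field; rewrite gt_eqF.
  rewrite ler_pdivrMr//; apply: (@le_trans _ _ (2 * Y * (d * z) ^+ 2)).
    by rewrite ler_wpM2r// exprn_ge0// ltW.
  by rewrite /Y -mulrA mulVf ?mulr1 ?gt_eqF ?exprn_gt0//; lra.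
pose s := d ^+ 2 / 16.
have s0 : 0 <= s by rewrite divr_ge0// exprn_ge0// ltW.
have s1 : s <= 1.
  have : d ^+ 2 <= 1 by rewrite exprn_ile1// ltW.
  by rewrite /s; lra.
have q0 : 0 <= (1 + cos d) / 2 by have := cos_geN1 d; lra.
have qs : (1 + cos d) / 2 <= 1 - s by apply: cos_sub1_le; rewrite (ltW d0) d1.
have qN : ((1 + cos d) / 2) ^+ N' <= 16 * z ^+ 2.
  have D0 : 0 < 1 + N'%:R * s by rewrite ltr_pwDl// mulr_ge0.
  have h1 := exprn_one_sub_le N' s0 s1.
  have h2 : ((1 + cos d) / 2) ^+ N' <= (1 - s) ^+ N'.
    by apply: lerXn2r; rewrite ?nnegrE// subr_ge0.
  have h3 : (1 - s) ^+ N' <= (1 + N'%:R * s)^-1 by rewrite -[leRHS]mul1r ler_pdivlMr.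
  apply: le_trans h2 (le_trans h3 _).
  have Ys : Y * s = (16 * z ^+ 2)^-1 by rewrite /Y /s; field; rewrite !gt_eqF.
  have zz : 0 < 16 * z ^+ 2 by rewrite mulr_gt0// exprn_gt0.
  rewrite -[leRHS]invrK lef_pV2 ?posrE ?invr_gt0//.
  rewrite -Ys; have : Y * s <= N'%:R * s by rewrite ler_wpM2r// ltW.
  lra.
rewrite mulnC exprM.
apply: (@le_trans _ _ ((16 * z ^+ 2) ^+ m)).
  by apply: lerXn2r; rewrite ?nnegrE ?exprn_ge0// mulr_ge0// exprn_ge0// ltW.
by rewrite exprMn -exprM ler_wpM2l// exprn_ge0.
Qed.

(** If omega(d) were smaller, n about d^(-1-e) would still satisfy the phase condition, and n D
    frequencies with coefficients of order d^(1+eta) would give a p-sum of order at least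
    d^(-e/2). *)
Lemma modulus_ge_powR (psi w omega : R -> R) (a b C d0 : R) :
  (forall t : R, is_derive t 1 psi (w t)) -> continuous w ->
  0 < C -> 0 < d0 ->
  (forall d, 0 < d -> d < d0 -> forall s t, `|s - t| <= d -> `|w s - w t| <= C * omega d) ->
  0 < a -> a <= b -> b < 2 * pi -> w a != w b ->
  (forall p : R, 1 < p -> p <= 2 -> exists Cp : R, forall (n : nat) s, uniq s ->
    \sum_(k <- s) normc (fourier_coef (fun t => cis (n%:Z%:~R * psi t)) k) `^ p <= Cp) ->
  forall eps : R, 0 < eps -> \forall d \near 0^'+, C^-1 * d `^ eps <= omega d.
Proof.
move=> dpsi cw C0 d00 wC a0 ab b2 wab Hp eps eps0.
pose e := Num.min eps 1.
have e0 : 0 < e by rewrite lt_min eps0 ltr01.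
have e1 : e <= 1 by rewrite ge_min lexx orbT.
have eeps : e <= eps by rewrite ge_min lexx.
(* With e <= 1 this gives (1 + eta)^2 <= 1 + e/2, leaving a surplus d^(-e/2) against the number
   d^(-1-e) of frequencies. *)
pose eta := e / 6.
have eta0 : 0 < eta by rewrite divr_gt0.
have p1 : 1 < 1 + eta by lra.
have p2 : 1 + eta <= 2 by rewrite /eta; lra.
have [Cp HCp] := Hp _ p1 p2.
have Cp0 : 0 <= Cp by have := HCp 0%N [::] isT; rewrite big_nil.
pose D := `|w b - w a|.
have D0 : 0 < D by rewrite normr_gt0 subr_eq0 eq_sym.
(* Makes z^(2m-2) = d^(eta(2m-2)) at most d, as [far_kernel_le] requires for z = d^eta. *)
have [m m2 metaE] : exists2 m, (2 <= m)%N & 1 <= eta * (2 * m%:R - 2).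
  exists (Num.truncn eta^-1).+2 => //.
  have := truncnS_gt eta^-1; rewrite -[in X in _ -> X]natr1 => h.
  rewrite -ler_pdivrMl// mulr1; have : 0 <= eta^-1 by rewrite invr_ge0 ltW.
  lra.
have m0 : 0 < m%:R :> R by rewrite ltr0n; exact: leq_trans m2.
have m22 : (2 <= 2 * m)%N by rewrite leq_pmulr// ltnW.
have pi0 : 0 < pi :> R by exact: pi_gt0.
(* With z < k1 the far part of the integral is at most rho/4, half of the main term rho/2. *)
pose k1 : R := (8 * pi * m%:R * 16 ^+ m)^-1.
have k10 : 0 < k1.
  rewrite invr_gt0; apply: mulr_gt0; last exact: exprn_gt0.
  by apply: mulr_gt0 => //; exact: mulr_gt0.
(* The remaining rho/4, divided by 2 pi, is ka d z. *)
pose ka : R := (8 * pi * m%:R)^-1.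
have ka0 : 0 < ka by rewrite invr_gt0 !mulr_gt0.
(* Final threshold: Cp + 1 in the denominator makes the concluding inequality strict even when Cp =
   0. *)
pose k2 := D * ka `^ (1 + eta) / (4 * (Cp + 1)).
have k20 : 0 < k2 by rewrite divr_gt0 ?mulr_gt0 ?powR_gt0//; lra.
near=> d.
have dgt0 : 0 < d by near: d; exact: nbhs_right_gt.
have dlt1 : d < 1 by near: d; exact: nbhs_right_lt.
have dlt0 : d < d0 by near: d; exact: nbhs_right_lt.
have da : d < a by near: d; exact: nbhs_right_lt.
have db : d < 2 * pi - b by near: d; apply: nbhs_right_lt; rewrite subr_gt0.
have dz : d `^ eta < k1 by near: d; exact: powR_near0_lt.
have dX1 : d `^ (1 + e) < D / 4 by near: d; apply: powR_near0_lt; [lra|rewrite divr_gt0].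
have dX2 : d `^ (1 + e) < 2^-1 by near: d; apply: powR_near0_lt => //; lra.
have dk2 : d `^ (e / 2) < k2 by near: d; apply: powR_near0_lt => //; rewrite divr_gt0.
have dle1 := ltW dlt1.
rewrite leNgt; apply/negP => om.
have om' : C * omega d <= d `^ e.
  rewrite -ler_pdivlMl//; apply/ltW/(lt_le_trans om).
  by rewrite ler_pM2l ?invr_gt0// ger_powR// dgt0.
pose z := d `^ eta.
have z0 : 0 < z by rewrite powR_gt0.
have z1 : z <= 1.
  have -> : 1 = d `^ 0 :> R by rewrite powRr0.
  by rewrite ger_powR ?dgt0// ltW.
(* The largest frequency, up to rounding, for which the assumed bound on C omega(d) keeps n d C
   omega(d) <= 1. *)
pose X := (d `^ (1 + e))^-1.
have dX0 : 0 < d `^ (1 + e) by rewrite powR_gt0.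
have X0 : 0 < X by rewrite invr_gt0.
have X2 : 2 <= X by rewrite -[leLHS]invrK lef_pV2 ?posrE ?invr_gt0// ltW.
have XD : 4 <= X * D.
  by rewrite mulrC ler_pdivlMr// mulrC -ler_pdivlMr// ltW.
have [n nX Xn] : exists2 n : nat, n%:R <= X & X - 1 < n%:R.
  exists (Num.truncn X); first by rewrite truncn_le ltW.
  by rewrite ltrBlDr natr1 truncnS_gt.
have dd : d * d `^ e = d `^ (1 + e).
  by rewrite (powRD_gt0 _ _ dgt0) powRr1// ltW.
have ndB : n%:R * d * (C * omega d) <= 1.
  have B0 : 0 <= C * omega d.
    by apply: le_trans (wC d dgt0 dlt0 0 0 _); rewrite ?normr_ge0// subrr normr0 ltW.
  apply: (@le_trans _ _ (X * d * d `^ e)).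
    by apply: ler_pM => //; rewrite ?mulr_ge0// ?(ltW dgt0)// ler_wpM2r// ltW.
  by rewrite -mulrA dd mulVf// gt_eqF.
have zm : z ^+ (2 * m) <= d * z ^+ 2.
  have -> : (2 * m = (2 * m - 2) + 2)%N by rewrite subnK.
  rewrite exprD ler_wpM2r ?exprn_ge0 ?(ltW z0)//.
  rewrite /z -powR_mulrn ?powR_ge0// -powRrM.
  rewrite -[leRHS]powRr1 ?(ltW dgt0)// ger_powR ?dgt0//.
  by rewrite natrB ?natrM.
have [N HN1 HN2] := far_kernel_le (ltnW m2) dgt0 dle1 z0 z1 zm.
pose rho := d * z / m%:R.
have rho0 : 0 < rho by rewrite divr_gt0// mulr_gt0.
have rhod : rho <= d.
  rewrite ler_pdivrMr// ler_wpM2l ?(ltW dgt0)//.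
  by apply: le_trans z1 _; rewrite ler1n; exact: ltnW.
have far : 2 * pi * ((1 + cos d) / 2) ^+ N <= rho / 4.
  apply: (@le_trans _ _ (2 * pi * (16 ^+ m * (d * z ^+ 2)))).
    by rewrite ler_wpM2l// mulr_ge0// ltW.
  apply: (@le_trans _ _ (2 * pi * (16 ^+ m * (d * z * k1)))).
    rewrite ler_wpM2l ?mulr_ge0 ?(ltW pi0)// ler_wpM2l ?exprn_ge0//.
    by rewrite expr2 mulrA ler_wpM2l ?mulr_ge0 ?(ltW dgt0) ?(ltW z0)// ltW.
  rewrite le_eqVlt; apply/orP; left; apply/eqP; rewrite /k1 /rho.
  have : 16 ^+ m != 0 :> R by rewrite expf_neq0.
  have pin : pi != 0 :> R by rewrite gt_eqF.
  have mn : m%:R != 0 :> R by rewrite gt_eqF.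
  by move: (16 ^+ m) (@pi R) pin => u c c0 u0; field; rewrite mn u0 c0.
have c00 : 0 <= rho / 2 - 2 * pi * ((1 + cos d) / 2) ^+ N.
  move: rho0 far; clear; lra.
have bd : b <= 2 * pi - d by rewrite lerBrDr addrC -lerBrDr ltW.
have := @sum_fourier_coef_ge R psi w n a b d rho (C * omega d) (1 + eta) Cp N (ltW p1)
  ab dpsi cw (wC d dgt0 dlt0) ndB (ltW da) bd rho0 rhod HN1 c00 (HCp n).
rewrite -/D; set c0 := (2 * pi)^-1 * _ => hmain.
have c0ge : ka * (d * z) <= c0.
  have -> : ka * (d * z) = (2 * pi)^-1 * (rho / 4).
    have pin : pi != 0 :> R by rewrite gt_eqF.
    have mn : m%:R != 0 :> R by rewrite gt_eqF.
    by rewrite /ka /rho; move: (@pi R) pin => c c0'; field; rewrite mn c0'.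
  have pi2 := twopi_gt0 R.
  by rewrite ler_pM2l ?invr_gt0//; move: far; clear; lra.
have nD : X * D / 4 <= n%:R * D - 1.
  have : (X - 1) * D <= n%:R * D by rewrite ler_pM2r// ltW.
  have : 2 * D <= X * D by rewrite ler_pM2r.
  move: XD; clear; lra.
have h3 : X * D / 4 * (ka * (d * z)) `^ (1 + eta) <= Cp.
  apply: le_trans hmain; apply: ler_pM => //.
  - by rewrite divr_ge0// mulr_ge0 ?ltW.
  - exact: powR_ge0.
  apply: ge0_ler_powR => //; rewrite ?nnegrE.
  - by rewrite (le_trans _ (ltW p1)).
  - by rewrite !mulr_ge0 ?(ltW ka0) ?(ltW dgt0) ?(ltW z0).
  - by apply: le_trans c0ge; rewrite !mulr_ge0 ?(ltW ka0) ?(ltW dgt0) ?(ltW z0).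
have dzp : d `^ (1 + e / 2) <= (d * z) `^ (1 + eta).
  have -> : d * z = d `^ (1 + eta).
    by rewrite (powRD_gt0 _ _ dgt0) powRr1// ltW.
  rewrite -powRrM ger_powR ?dgt0// /eta.
  have : e * e <= e by rewrite ler_piMl// ltW.
  by move=> ee; clear -ee e0; lra.
have h4 : X * D / 4 * (ka `^ (1 + eta) * d `^ (1 + e / 2)) <= Cp.
  apply: le_trans h3; rewrite powRM ?mulr_ge0 ?(ltW ka0) ?(ltW dgt0) ?(ltW z0)//.
  rewrite ler_wpM2l ?divr_ge0 ?mulr_ge0 ?(ltW X0) ?(ltW D0)//.
  by rewrite ler_wpM2l// powR_ge0.
have dE : d `^ (1 + e) = d `^ (1 + e / 2) * d `^ (e / 2).
  rewrite -powRD_gt0//.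
  by congr (_ `^ _); clear; lra.
have e20 : 0 < d `^ (e / 2) by rewrite powR_gt0.
have e30 : 0 < d `^ (1 + e / 2) by rewrite powR_gt0.
have h5 : D * ka `^ (1 + eta) / 4 <= Cp * d `^ (e / 2).
  rewrite -ler_pdivrMr//; apply: le_trans _ h4; rewrite /X dE.
  rewrite le_eqVlt; apply/orP; left; apply/eqP.
  by move: (ka `^ _) => u; field; rewrite !gt_eqF.
have h6 : Cp * d `^ (e / 2) <= Cp * k2 by rewrite ler_wpM2l// ltW.
have h7 : Cp * k2 < D * ka `^ (1 + eta) / 4.
  have v0 : 0 < D * ka `^ (1 + eta) / 4 by rewrite divr_gt0// mulr_gt0// powR_gt0.
  have -> : Cp * k2 = D * ka `^ (1 + eta) / 4 * (Cp / (Cp + 1)).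
    have Cp1 : Cp + 1 != 0 by rewrite gt_eqF// ltr_wpDl.
    by rewrite /k2; move: (ka `^ _) => u; clear -Cp1; field.
  have Cp1 : 0 < Cp + 1 by exact: ltr_wpDl.
  by rewrite -[ltRHS]mulr1 (ltr_pM2l v0) (ltr_pdivrMr _ _ Cp1) mul1r ltrDl.
by have := lt_le_trans h7 (le_trans h5 h6); rewrite ltxx.
Unshelve. all: by end_near. Qed.

End modulus_lower_bound.

(** * Reduction of a nonlinear circle map to one window *)

Section necessity_final.
Variable R : realType.

Lemma continuous_cst_closure (F : R -> R) (x y c : R) : continuous F -> x < y ->
  (forall t, x < t -> t < y -> F t = c) -> F x = c /\ F y = c.
Proof.
move=> cF xy Fc; split.
  have h1 : F t @[t --> x^'+] --> F x by apply: cvg_at_right_filter; exact: cF.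
  have h2 : F t @[t --> x^'+] --> c.
    apply: cvg_near_cst; near=> t; apply: Fc; near: t.
      exact: nbhs_right_gt.
    exact: nbhs_right_lt.
  exact: (cvg_unique _ h1 h2).
have h1 : F t @[t --> y^'-] --> F y by apply: cvg_at_left_filter; exact: cF.
have h2 : F t @[t --> y^'-] --> c.
  apply: cvg_near_cst; near=> t; apply: Fc; near: t.
    exact: nbhs_left_gt.
  exact: nbhs_left_lt.
exact: (cvg_unique _ h1 h2).
Unshelve. all: by end_near. Qed.

Lemma circle_map_int (phi : R -> R) : circle_map phi ->
  forall (m : int) t, eq_mod2pi (phi (t + m%:~R * (2 * pi))) (phi t).
Proof.
move=> cphi.
have hn (n : nat) t : eq_mod2pi (phi (t + n%:R * (2 * pi))) (phi t).
  elim: n => [|n [k IH]]; first by exists 0; rewrite !mul0r addr0 subrr.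
  have [l hl] := cphi (t + n%:R * (2 * pi)); exists (k + l).
  rewrite -[n.+1%:R]natr1 (mulrDl n%:R) mul1r addrA.
  rewrite intrD (mulrDl k%:~R) -IH -hl; ring.
case=> n t; first exact: hn.
have [k hk] := hn n.+1 (t - n.+1%:R * (2 * pi)); exists (- k).
rewrite NegzE mulrNz mulNr mulrNz mulNr -hk subrK; ring.
Qed.

Lemma cis_eq_mod2pi (x y : R) (n : int) : eq_mod2pi x y ->
  cis (n%:~R * x) = cis (n%:~R * y).
Proof.
move=> [k xy]; have -> : x = y + k%:~R * (2 * pi) by rewrite -xy; ring.
by rewrite mulrDr cisD mulrA -intrM cis_2pi mulr1.
Qed.

Lemma cst_derive_linear (phi : R -> R) (c : R) :
  (forall t : R, is_derive t 1 phi c) -> linear_on setT phi.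
Proof.
move=> dphi; exists c, (phi 0) => t _.
pose g t := phi t - c * t.
have dg (x : R) : is_derive x 1 g 0.
  have d1 : is_derive x 1 (fun t : R => c * t) c.
    by apply: is_derive_eq; rewrite /GRing.scale /= mulr1.
  have := @is_deriveB _ _ _ phi (fun t => c * t) x 1 _ _ (dphi x) d1.
  by rewrite subrr.
have := is_derive_0_is_cst t 0 dg; rewrite /g mulr0 subr0; lra.
Qed.

(* phi is replaced by a translate by a multiple of 2pi, which does not change
   exp(i n phi), so that phi' is not constant inside ]0, 2pi[. *)
Lemma nonlinear_window (phi v : R -> R) :
  (forall t : R, is_derive t 1 phi (v t)) -> continuous v -> nonlinear phi ->
  exists (m : int) (a b : R), [/\ 0 < a, a <= b, b < 2 * pi &
    v (a + m%:~R * (2 * pi)) != v (b + m%:~R * (2 * pi))].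
Proof.
move=> dphi cv nl; apply: contrapT => H; apply: nl.
have p0 := twopi_gt0 R.
have wc (m : int) (a b : R) : 0 < a -> a < 2 * pi -> 0 < b -> b < 2 * pi ->
    v (a + m%:~R * (2 * pi)) = v (b + m%:~R * (2 * pi)).
  move=> a0 a2 b0 b2; apply/eqP/negP => /negP ne; apply: H.
  have [ab|/ltW ba] := leP a b; first by exists m, a, b.
  by exists m, b, a; rewrite eq_sym.
pose c (m : int) := v (pi + m%:~R * (2 * pi)).
have pi0 := @pi_gt0 R.
have vc (m : int) t : m%:~R * (2 * pi) < t -> t < (m + 1)%:~R * (2 * pi) -> v t = c m.
  rewrite intrD mulrDl mul1r => h1 h2.
  have -> : t = (t - m%:~R * (2 * pi)) + m%:~R * (2 * pi) by ring.
  apply: wc; lra.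
have mlt (m : int) : m%:~R * (2 * pi) < (m + 1)%:~R * (2 * pi) :> R.
  by rewrite intrD mulrDl mul1r; lra.
have vend (m : int) := continuous_cst_closure cv (mlt m) (vc m).
(* Adjacent periods share an endpoint, where continuity forces their constants to agree. *)
have cS (m : int) : c (m + 1) = c m.
  by have [h1 h2] := vend m; have [h3 h4] := vend (m + 1); rewrite -h2 -h3.
have cn (n : nat) : c n%:Z = c 0.
  elim: n => [//|n IH]; rewrite -IH -[RHS]cS.
  by rewrite (_ : n%:Z + 1 = n.+1%:Z)// intS addrC.
have cNn (n : nat) : c (- n%:Z) = c 0.
  elim: n => [//|n IH]; rewrite -IH -[LHS]cS.
  by rewrite (_ : - n.+1%:Z + 1 = - n%:Z)// intS opprD addrAC addNr add0r.
have cm (m : int) : c m = c 0.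
  case: m => n; first exact: cn.
  by rewrite NegzE; exact: cNn.
apply: (@cst_derive_linear phi (c 0)) => t.
suff -> : c 0 = v t by exact: dphi.
pose k := Num.floor (t / (2 * pi)).
have k1 : k%:~R * (2 * pi) <= t by rewrite -ler_pdivlMr// floor_le_tmp.
have k2 : t < (k + 1)%:~R * (2 * pi) by rewrite -ltr_pdivrMr// floorD1_gt.
rewrite -(cm k); move: k1; rewrite le_eqVlt => /predU1P[<-|k1].
  by have [-> _] := vend k.
by rewrite (vc k).
Qed.

Lemma necessity (omega phi : R -> R) :
  {within `[0, +oo[, continuous omega} ->
  (forall x y : R, 0 <= x -> x <= y -> omega x <= omega y) -> omega 0 = 0 ->
  circle_map phi -> C1omega_smooth omega phi -> nonlinear phi ->
  (forall f : R -> R[i], in_A f ->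
     forall p : R, 1 < p -> p <= 2 -> in_Ap p (f \o phi)) ->
  forall eps : R, 0 < eps -> omega d / (d `^ eps) @[d --> 0^'+] --> +oo.
Proof.
move=> oc om o0 cm [dphi [C0 HC0]] nl HA eps eps0.
pose v := derive1 phi.
have dv (t : R) : is_derive t 1 phi (v t).
  by rewrite /v derive1E; apply: derivableP; exact: dphi.
pose C := `|C0| + 1.
have Cgt0 : 0 < C by rewrite ltr_wpDl.
have [d0 /= d00 Hd0] := HC0.
have wC d : 0 < d -> d < d0 -> forall s t, `|s - t| <= d -> `|v s - v t| <= C * omega d.
  move=> dgt0 dlt s t st.
  have := Hd0 d; rewrite /= sub0r normrN gtr0_norm// => /(_ dlt dgt0 s t st).
  move=> /le_trans; apply; apply: ler_wpM2r; last by rewrite /C; have := ler_norm C0; lra.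
  by rewrite -o0; apply: om => //; exact: ltW.
have o_right : omega x @[x --> 0^'+] --> (0 : R).
  by rewrite -[X in _ --> X]o0; have /continuous_within_itvcyP[_] := oc.
(* This is where the continuity of [omega] at 0 enters. *)
have cv : continuous v.
  move=> t; apply/cvgrPdist_le => e e0.
  have eC : 0 < e / C by rewrite divr_gt0.
  have /cvgrPdist_le/(_ _ eC) [d1 /= d10 Hd1] := o_right.
  pose d := Num.min (d0 / 2) (d1 / 2).
  have dgt0 : 0 < d by rewrite lt_min !divr_gt0.
  have dd0 : d <= d0 / 2 by rewrite ge_min lexx.
  have dd1 : d <= d1 / 2 by rewrite ge_min lexx orbT.
  exists d => // s /= ts.
  apply: le_trans (wC d dgt0 _ t s (ltW ts)) _; first lra.
  have := Hd1 d; rewrite /= sub0r normrN gtr0_norm// => /(_ _ dgt0).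
  have -> : d < d1 by lra.
  move=> /(_ isT); rewrite sub0r normrN => h.
  by rewrite mulrC -ler_pdivlMr//; apply: le_trans (ler_norm _) h.
have [m [a [b [a0 ab b2 vab]]]] := nonlinear_window dv cv nl.
pose T := m%:~R * (2 * pi) : R.
pose psi t := phi (t + T); pose w t := v (t + T).
have dT (t : R) : is_derive t 1 (fun t : R => t + T) 1.
  by apply: is_derive_eq; rewrite addr0.
have dpsi (t : R) : is_derive t 1 psi (w t).
  have := @is_derive1_comp R phi (fun t => t + T) t _ _ (dv _) (dT t).
  by rewrite mulr1.
have cw : continuous w.
  have cT : continuous (fun t : R => t + T).
    by move=> t; apply: cvgD; [exact: cvg_id|exact: cvg_cst].
  by move=> t; apply: (continuous_comp (cT t)); exact: cv.
have wC' d : 0 < d -> d < d0 -> forall s t, `|s - t| <= d -> `|w s - w t| <= C * omega d.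
  move=> dgt0 dlt s t st; apply: wC => //.
  by have -> : s + T - (t + T) = s - t by ring.
have cphi : continuous phi.
  by move=> t; apply/differentiable_continuous/derivable1_diffP; case: (dv t).
have Hp p : 1 < p -> p <= 2 -> exists Cp : R, forall (n : nat) s, uniq s ->
    \sum_(k <- s) Normc.normc (fourier_coef (fun t => cis (n%:Z%:~R * psi t)) k) `^ p <= Cp.
  move=> p1 p2.
  have compA (f : R -> R[i]) : in_A f -> exists C : R, forall s, uniq s -> comp_sum p phi s f <= C.
    move=> fA; have [_ _ hA] := HA f fA p p1 p2.
    by apply: Ap_norm_lty_bounded hA; lra.
  have [Cp HCp] := exponentials_bounded (ltW p1) cphi compA.
  exists Cp => n s us.
  have -> : (fun t => cis (n%:Z%:~R * psi t)) = (fun t => cis (n%:Z%:~R * phi t)).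
    by apply/funext => t; apply: cis_eq_mod2pi; exact: circle_map_int.
  exact: HCp.
apply/cvgryPge => A.
(* Half of the exponent serves for the lower bound of omega; the other half sends the quotient to
   infinity. *)
have e2 : 0 < eps / 2 by rewrite divr_gt0.
have hlow := modulus_ge_powR dpsi cw Cgt0 d00 wC' a0 ab b2 vab Hp e2.
near=> d.
have dgt0 : 0 < d by near: d; exact: nbhs_right_gt.
have h1 : C^-1 * d `^ (eps / 2) <= omega d by near: d.
have h2 : d `^ (eps / 2) < (C * (`|A| + 1))^-1.
  near: d; apply: powR_near0_lt => //; rewrite invr_gt0 mulr_gt0// ltr_wpDl//.
have u0 : 0 < d `^ (eps / 2) by rewrite powR_gt0.
have dE : d `^ eps = d `^ (eps / 2) * d `^ (eps / 2).
  by rewrite -powRD_gt0//; congr (_ `^ _); lra.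
rewrite dE ler_pdivlMr ?mulr_gt0//; apply: le_trans h1.
rewrite mulrA ler_wpM2r ?(ltW u0)//.
have A1 : 0 < `|A| + 1 by rewrite ltr_wpDl.
have : (`|A| + 1) * d `^ (eps / 2) <= C^-1.
  have -> : C^-1 = (`|A| + 1) * (C * (`|A| + 1))^-1 by field; rewrite !gt_eqF.
  by rewrite ler_pM2l// ltW.
move: u0; move: (d `^ _) => u u0 h3; apply: le_trans h3.
by rewrite ler_pM2r//; have := ler_norm A; lra.
Unshelve. all: by end_near. Qed.

End necessity_final.

(** * The piecewise linear approximations *)

Section steplike.
Variable R : realType.
Implicit Types (Phi v F : R -> R).

(* Phi is a primitive of v, and the nondecreasing function F bounds the
   variation of v. *)
Definition steplike Phi v F : Prop :=
  (forall a b, a <= b -> `|v b - v a| <= F b - F a) /\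
  (forall a t b, a <= t -> t <= b ->
     `|Phi b - Phi a - v t * (b - a)| <= (F b - F a) * (b - a)).

Definition window_le F (L J : R) : Prop :=
  forall a b, a <= b -> b - a <= L -> F b - F a <= J.

Definition avg (d : R) F (t : R) : R := 2^-1 * F (t - d) + 2^-1 * F (t + d).

Lemma steplike_mono Phi v F : steplike Phi v F -> forall a b, a <= b -> F a <= F b.
Proof. by move=> [h _] a b ab; rewrite -subr_ge0; apply: le_trans (h a b ab). Qed.

Lemma steplikeD Phi1 v1 F1 Phi2 v2 F2 : steplike Phi1 v1 F1 -> steplike Phi2 v2 F2 ->
  steplike (fun t => Phi1 t + Phi2 t) (fun t => v1 t + v2 t) (fun t => F1 t + F2 t).
Proof.
move=> [a1 b1] [a2 b2]; split=> [a b ab|a t b hat htb].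
  have := a1 a b ab; have := a2 a b ab; rewrite !ler_norml; lra.
have := b1 a t b hat htb; have := b2 a t b hat htb; rewrite !ler_norml; lra.
Qed.

Lemma steplikeZ (c : R) Phi v F : steplike Phi v F ->
  steplike (fun t => c * Phi t) (fun t => c * v t) (fun t => `|c| * F t).
Proof.
move=> [h1 h2]; split=> [a b ab|a t b hat htb].
  by rewrite -!mulrBr normrM ler_wpM2l// h1.
have -> : c * Phi b - c * Phi a - c * v t * (b - a) = c * (Phi b - Phi a - v t * (b - a)).
  by ring.
by rewrite -mulrBr normrM -mulrA ler_wpM2l// h2.
Qed.

Lemma steplike_shift (h : R) Phi v F : steplike Phi v F ->
  steplike (fun t => Phi (t + h)) (fun t => v (t + h)) (fun t => F (t + h)).
Proof.
move=> [h1 h2]; split=> [a b ab|a t b hat htb]; first by apply: h1; rewrite lerD2r.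
have := h2 (a + h) (t + h) (b + h); rewrite !lerD2r => /(_ hat htb).
by have -> : b + h - (a + h) = b - a by ring.
Qed.

Lemma steplike_avg (d : R) Phi v F : steplike Phi v F ->
  steplike (avg d Phi) (avg d v) (avg d F).
Proof.
move=> h; have h1 := steplikeZ 2^-1 (steplike_shift (- d) h).
have h2 := steplikeZ 2^-1 (steplike_shift d h).
have := steplikeD h1 h2; rewrite ger0_norm//.
Qed.

Lemma steplike_id : steplike (fun t : R => t) (fun=> 1) (fun=> 0).
Proof.
split=> [a b _|a t b _ _]; first by rewrite !subrr normr0.
by rewrite mul1r !subrr mul0r normr0.
Qed.

Lemma window_le_avg F (L J d : R) : window_le F L J -> window_le (avg d F) L J.
Proof.
move=> h a b ab bl; rewrite /avg.
have h1 := h (a - d) (b - d); have h2 := h (a + d) (b + d).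
have e1 : F (b - d) - F (a - d) <= J by apply: h1; lra.
have e2 : F (b + d) - F (a + d) <= J by apply: h2; lra.
lra.
Qed.

(* The averaging step halves the jumps: both shifted copies of a short window
   lie in one window, of length less than 8d. *)
Lemma window_le_avg_half F (J d : R) : 0 < d ->
  (forall a b, a <= b -> F a <= F b) -> window_le F (8 * d) J ->
  window_le (avg d F) d (J / 2).
Proof.
move=> d0 mF h a b ab bl; rewrite /avg.
have h1 := h (a - d) (b + d); have e1 : F (b + d) - F (a - d) <= J by apply: h1; lra.
have e2 : F (b - d) <= F (a + d) by apply: mF; lra.
lra.
Qed.

Lemma avg_dist Phi v F (J d t : R) : 0 < d -> steplike Phi v F ->
  window_le F (8 * d) J -> `|avg d Phi t - Phi t| <= J * d.
Proof.
move=> d0 [h1 h2] w; rewrite /avg.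
have e1 : `|Phi (t + d) - Phi t - v t * (t + d - t)| <= (F (t + d) - F t) * (t + d - t).
  by apply: h2 => //; lra.
have e2 : `|Phi t - Phi (t - d) - v t * (t - (t - d))| <= (F t - F (t - d)) * (t - (t - d)).
  by apply: h2 => //; lra.
have w1 : F (t + d) - F t <= J by apply: w; lra.
have w2 : F t - F (t - d) <= J by apply: w; lra.
have t1 : t + d - t = d by ring.
have t2 : t - (t - d) = d by ring.
rewrite t1 in e1; rewrite t2 in e2.
have w1' : (F (t + d) - F t) * d <= J * d by rewrite ler_pM2r.
have w2' : (F t - F (t - d)) * d <= J * d by rewrite ler_pM2r.
move: e1 e2; rewrite !ler_norml => /andP[e11 e12] /andP[e21 e22]; apply/andP; split; lra.
Qed.

Lemma avg_dist_deriv Phi v F (J d t : R) : 0 < d -> steplike Phi v F ->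
  window_le F (8 * d) J -> `|avg d v t - v t| <= J.
Proof.
move=> d0 [h1 h2] w; rewrite /avg.
have e1 : `|v (t + d) - v t| <= F (t + d) - F t by apply: h1; lra.
have e2 : `|v t - v (t - d)| <= F t - F (t - d) by apply: h1; lra.
have w1 : F (t + d) - F t <= J by apply: w; lra.
have w2 : F t - F (t - d) <= J by apply: w; lra.
move: e1 e2; rewrite !ler_norml => /andP[e11 e12] /andP[e21 e22]; apply/andP; split; lra.
Qed.

(** Beyond length d the uniform bound J d at the two ends suffices. On shorter intervals, increments
    over translated intervals are compared through slopes taken in one common window. *)
Lemma avg_dist_lip Phi v F (J d a b : R) : 0 < d -> steplike Phi v F ->
  window_le F (8 * d) J -> a <= b ->
  `|(avg d Phi b - Phi b) - (avg d Phi a - Phi a)| <= 2 * J * (b - a).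
Proof.
move=> d0 sl w ab.
have J0 : 0 <= J.
  by apply: le_trans (w 0 0 _ _); rewrite ?subrr// mulr_ge0// ltW.
have [bad|dba] := leP (b - a) d; last first.
  have e1 := avg_dist a d0 sl w; have e2 := avg_dist b d0 sl w.
  apply: le_trans (ler_normB _ _) _; apply: le_trans (lerD e2 e1) _.
  have : J * d <= J * (b - a) by rewrite ler_wpM2l// ltW.
  by rewrite -mulrA => h; lra.
have [h1 h2] := sl; rewrite /avg.
have ba0 : 0 <= b - a by lra.
have right : `|(Phi (b + d) - Phi (a + d)) - (Phi b - Phi a)| <= J * (b - a).
  have e1 : `|Phi (b + d) - Phi (a + d) - v (a + d) * (b + d - (a + d))| <=
      (F (b + d) - F (a + d)) * (b + d - (a + d)) by apply: h2; lra.
  have e2 : `|Phi b - Phi a - v b * (b - a)| <= (F b - F a) * (b - a) by apply: h2; lra.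
  have e3 : `|v (a + d) - v b| <= F (a + d) - F b by apply: h1; lra.
  have t1 : b + d - (a + d) = b - a by ring.
  rewrite t1 in e1.
  have e4 : `|(v (a + d) - v b) * (b - a)| <= (F (a + d) - F b) * (b - a).
    by rewrite normrM (ger0_norm ba0) ler_wpM2r.
  have w1 : (F (b + d) - F a) * (b - a) <= J * (b - a).
    by rewrite ler_wpM2r//; apply: w; lra.
  apply: le_trans w1; clear -e1 e2 e4.
  move: e1 e2 e4; rewrite !ler_norml => /andP[a1 a2] /andP[a3 a4] /andP[a5 a6].
  by apply/andP; split; lra.
have left : `|(Phi b - Phi a) - (Phi (b - d) - Phi (a - d))| <= J * (b - a).
  have e1 : `|Phi (b - d) - Phi (a - d) - v (b - d) * (b - d - (a - d))| <=
      (F (b - d) - F (a - d)) * (b - d - (a - d)) by apply: h2; lra.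
  have e2 : `|Phi b - Phi a - v a * (b - a)| <= (F b - F a) * (b - a) by apply: h2; lra.
  have e3 : `|v a - v (b - d)| <= F a - F (b - d) by apply: h1; lra.
  have t1 : b - d - (a - d) = b - a by ring.
  rewrite t1 in e1.
  have e4 : `|(v a - v (b - d)) * (b - a)| <= (F a - F (b - d)) * (b - a).
    by rewrite normrM (ger0_norm ba0) ler_wpM2r.
  have w1 : (F b - F (a - d)) * (b - a) <= J * (b - a).
    by rewrite ler_wpM2r//; apply: w; lra.
  apply: le_trans w1; clear -e1 e2 e4.
  move: e1 e2 e4; rewrite !ler_norml => /andP[a1 a2] /andP[a3 a4] /andP[a5 a6].
  by apply/andP; split; lra.
have J2 : 0 <= J * (b - a) by rewrite mulr_ge0.
clear -right left J2; move: right left; rewrite !ler_norml => /andP[a1 a2] /andP[a3 a4].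
by apply/andP; split; lra.
Qed.

(* The convex piecewise linear function with slope floor x. *)
Definition floor_prim (x : R) : R :=
  (Num.floor x)%:~R * x - (Num.floor x)%:~R * ((Num.floor x)%:~R + 1) / 2.

Lemma floor_itvE (x : R) : (Num.floor x)%:~R <= x < (Num.floor x)%:~R + 1.
Proof. by rewrite floor_le_tmp /= -[X in _ < _ + X]/(1%:~R) -intrD floorD1_gt. Qed.

(** Convexity: lines with integer slopes m and n differ at y by (n - m)(y - (n + m + 1)/2), whose
    sign is known because y lies in [n, n + 1[. *)
Lemma floor_prim_subgrad (x y : R) :
  floor_prim x + (Num.floor x)%:~R * (y - x) <= floor_prim y.
Proof.
have /andP[x1 x2] := floor_itvE x; have /andP[y1 y2] := floor_itvE y.
rewrite /floor_prim.
have : (Num.floor x)%:~R = (Num.floor y)%:~R :> R \/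
   (Num.floor x)%:~R + 1 <= (Num.floor y)%:~R :> R \/
   (Num.floor y)%:~R + 1 <= (Num.floor x)%:~R :> R.
  have [h|h|->] := ltgtP (Num.floor x) (Num.floor y); last by left.
    by right; left; rewrite -[X in _ + X]/(1%:~R) -intrD ler_int lezD1.
  by right; right; rewrite -[X in _ + X]/(1%:~R) -intrD ler_int lezD1.
move: x1 x2 y1 y2; move: ((Num.floor x)%:~R : R) ((Num.floor y)%:~R : R) => m n.
move=> x1 x2 y1 y2 [->|[h|h]]; first by lra.
  have : 0 <= (n - m) * (y - (n + m + 1) / 2) by rewrite mulr_ge0//; lra.
  lra.
have : 0 <= (m - n) * ((n + m + 1) / 2 - y) by rewrite mulr_ge0//; lra.
lra.
Qed.

Lemma steplike_floor_prim :
  steplike floor_prim (fun x => (Num.floor x)%:~R) (fun x => (Num.floor x)%:~R).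
Proof.
have mono (a b : R) : a <= b -> (Num.floor a)%:~R <= (Num.floor b)%:~R :> R.
  by move=> ab; rewrite ler_int; exact: le_floor.
split=> [a b ab|a t b hat htb]; first by rewrite ger0_norm// subr_ge0 mono.
have ba : 0 <= b - a by lra.
have e1 := floor_prim_subgrad a b; have e2 := floor_prim_subgrad b a.
have m1 := ler_wpM2r ba (mono _ _ hat); have m2 := ler_wpM2r ba (mono _ _ htb).
rewrite ler_norml mulrBl; move: m1 m2 e1 e2.
move: ((Num.floor a)%:~R : R) ((Num.floor b)%:~R : R) ((Num.floor t)%:~R : R) => x y z.
by move=> m1 m2 e1 e2; apply/andP; split; lra.
Qed.

(** Rescaling puts the corners at the multiples of 1/u and keeps unit slope jumps. *)
Definition comb (u : R) (t : R) : R := u^-1 * floor_prim (u * t).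
Definition comb_deriv (u : R) (t : R) : R := (Num.floor (u * t))%:~R.

Lemma steplike_comb (u : R) : 0 < u -> steplike (comb u) (comb_deriv u) (comb_deriv u).
Proof.
move=> u0; have [h1 h2] := steplike_floor_prim; split=> [a b ab|a t b hat htb].
  by apply: h1; rewrite ler_pM2l.
have := h2 (u * a) (u * t) (u * b); rewrite !ler_pM2l// => /(_ hat htb).
rewrite -mulrBr /comb /comb_deriv.
move: (floor_prim (u * b)) (floor_prim (u * a)) ((Num.floor (u * t))%:~R : R) => x y p.
move: ((Num.floor (u * b))%:~R : R) ((Num.floor (u * a))%:~R : R) => q r h.
have -> : u^-1 * x - u^-1 * y - p * (b - a) = u^-1 * (x - y - p * (u * (b - a))).
  by field; rewrite gt_eqF.
have ui : 0 < u^-1 by rewrite invr_gt0.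
rewrite normrM (ger0_norm (ltW ui)) (_ : (q - r) * (b - a) = u^-1 * ((q - r) * (u * (b - a)))).
  by rewrite ler_pM2l.
by field; rewrite gt_eqF.
Qed.

Lemma window_le_comb (u L : R) : 0 < u -> u * L <= 1 -> window_le (comb_deriv u) L 1.
Proof.
move=> u0 uL a b ab bl; rewrite /comb_deriv.
have /andP[a1 a2] := floor_itvE (u * a); have /andP[b1 b2] := floor_itvE (u * b).
have ub : u * b - u * a <= u * L by rewrite -mulrBr ler_pM2l.
rewrite lerBlDr addrC -[X in _ <= _ + X]/(1%:~R) -intrD ler_int.
rewrite -ltzD1 -(ltr_int R) intrD intrD /=.
by apply: le_lt_trans b1 _; rewrite /= ; lra.
Qed.

Lemma comb_convex (u d t : R) : 0 < u -> comb u t <= avg d (comb u) t.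
Proof.
move=> u0; rewrite /avg /comb.
have e1 := floor_prim_subgrad (u * t) (u * (t - d)).
have e2 := floor_prim_subgrad (u * t) (u * (t + d)).
have ui : 0 <= u^-1 by rewrite invr_ge0 ltW.
have h : floor_prim (u * t) <= 2^-1 * floor_prim (u * (t - d)) + 2^-1 * floor_prim (u * (t + d)).
  move: e1 e2; move: (floor_prim (u * t)) (floor_prim (u * (t - d))) (floor_prim (u * (t + d))).
  by move: ((Num.floor (u * t))%:~R : R) => w x y z; clear; lra.
by move: (ler_wpM2l ui h); clear; lra.
Qed.

Lemma avg_affine (d al be : R) F (t : R) : 
  (forall s, t - d <= s <= t + d -> F s = al * s + be) -> 0 <= d -> avg d F t = F t.
Proof.
move=> h d0; rewrite /avg !h; try by apply/andP; split; lra.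
lra.
Qed.

End steplike.

(** * The approximating sequence and its variation budget *)

Section phi_seq.
Variables (R : realType) (d : nat -> R).

(** Chosen so that [comb (freq M)] is q_M; the period 2 pi contains 2^M of its corners. *)
Definition freq (M : nat) : R := 2 ^+ M / (2 * pi).
(** The eps_M of the construction. The sum over M is 1/6, which keeps slopes near 1, and 2 eps_M =
    4^-(M+1) fits the budget in [window_var_seq]. *)
Definition amp (M : nat) : R := 8^-1 * 4^-1 ^+ M.

(** The factor 8 lets a window of stage M+1 fit into length d_M, where averaging has halved the
    variation; the last clause separates neighbouring corners of q_M by at least 16 d_M. *)
Definition good_scales : Prop :=
  [/\ forall M, 0 < d M, forall M, 8 * d M.+1 <= d M &
      forall M, freq M * (16 * d M) <= 1].

Fixpoint phi_seq (M : nat) (t : R) : R :=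
  if M is M'.+1 then
    avg (d M') (phi_seq M') t
    + amp M' * (avg (d M') (comb (freq M')) t - comb (freq M') t)
  else t.

Fixpoint slope_seq (M : nat) (t : R) : R :=
  if M is M'.+1 then
    avg (d M') (slope_seq M') t
    + amp M' * (avg (d M') (comb_deriv (freq M')) t - comb_deriv (freq M') t)
  else 1.

(** The recursion of the slopes with a plus sign: variations of a difference add up. *)
Fixpoint var_seq (M : nat) (t : R) : R :=
  if M is M'.+1 then
    avg (d M') (var_seq M') t
    + amp M' * (avg (d M') (comb_deriv (freq M')) t + comb_deriv (freq M') t)
  else 0.

Lemma freq_gt0 M : 0 < freq M.
Proof. by rewrite divr_gt0 ?twopi_gt0// exprn_gt0. Qed.

Lemma amp_gt0 M : 0 < amp M.
Proof. by rewrite mulr_gt0// exprn_gt0. Qed.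

Lemma half_gt0 M : 0 < (2^-1 : R) ^+ M.
Proof. by rewrite exprn_gt0. Qed.

Lemma half_le1 M : (2^-1 : R) ^+ M <= 1.
Proof. by rewrite exprn_ile1//; lra. Qed.

Lemma steplike_phi_seq M : steplike (phi_seq M) (slope_seq M) (var_seq M).
Proof.
elim: M => [|M IH]; first exact: steplike_id.
have sc := steplike_comb (freq_gt0 M).
have h1 := steplike_avg (d M) IH.
have h2 := steplikeZ (amp M) (steplike_avg (d M) sc).
have h3 := steplikeZ (- amp M) sc.
have := steplikeD (steplikeD h1 h2) h3.
rewrite normrN (ger0_norm (ltW (amp_gt0 M))).
rewrite (_ : (fun t => _) = phi_seq M.+1); last by apply/funext => t /=; ring.
rewrite (_ : (fun t => _ + - amp M * _) = slope_seq M.+1); last by apply/funext => t /=; ring.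
by rewrite (_ : (fun t => _ + amp M * _) = var_seq M.+1)//; apply/funext => t /=; ring.
Qed.

Hypothesis gd : good_scales.

Lemma window_comb M : window_le (comb_deriv (freq M)) (8 * d M) 1.
Proof.
have [d0 _ h] := gd; apply: window_le_comb; first exact: freq_gt0.
apply: le_trans (h M); rewrite ler_pM2l ?freq_gt0//.
by rewrite ler_wpM2r// ?(ltW (d0 M))// ler_nat.
Qed.

(** Averaging halves 2^-M - 4^-M and the two combs add 2 eps_M = 4^-(M+1), which is exactly the
    bound for M+1. The subtracted 4^-M is the room for new corners. *)
Lemma window_var_seq M : window_le (var_seq M) (8 * d M) (2^-1 ^+ M - 4^-1 ^+ M).
Proof.
have [d0 d8 _] := gd.
elim: M => [|M IH]; first by move=> a b _ _ /=; rewrite !expr0 !subrr.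
move=> a b ab bl; have bl' : b - a <= d M by apply: le_trans (d8 M).
have e1 := window_le_avg_half (d0 M) (steplike_mono (steplike_phi_seq M)) IH ab bl'.
have bl8 : b - a <= 8 * d M by have := d0 M; lra.
have wc := window_comb (M := M).
have e2 := window_le_avg (d M) wc ab bl8.
have e3 := wc a b ab bl8.
have a0 := ltW (amp_gt0 M).
have e4 := ler_wpM2l a0 (lerD e2 e3).
have h4 : (4^-1 : R) ^+ M.+1 = 4^-1 * 4^-1 ^+ M by rewrite exprS.
have h2 : (2^-1 : R) ^+ M.+1 = 2^-1 * 2^-1 ^+ M by rewrite exprS.
rewrite h4 h2 /=; move: e1 e4; rewrite /amp.
move: ((4^-1 : R) ^+ M) ((2^-1 : R) ^+ M) => x y; clear; lra.
Qed.

(** With this function the step is a single averaging defect, to which the [avg_dist] estimates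
    apply. *)
Definition pre_seq (M : nat) (t : R) : R := phi_seq M t + amp M * comb (freq M) t.

Lemma phi_seqS M t : phi_seq M.+1 t = phi_seq M t + (avg (d M) (pre_seq M) t - pre_seq M t).
Proof. by rewrite /= /pre_seq /avg; ring. Qed.

Lemma steplike_pre M : steplike (pre_seq M)
  (fun t => slope_seq M t + amp M * comb_deriv (freq M) t)
  (fun t => var_seq M t + amp M * comb_deriv (freq M) t).
Proof.
have := steplikeD (steplike_phi_seq M) (steplikeZ (amp M) (steplike_comb (freq_gt0 M))).
by rewrite (ger0_norm (ltW (amp_gt0 M))).
Qed.

Lemma window_pre M :
  window_le (fun t => var_seq M t + amp M * comb_deriv (freq M) t) (8 * d M) (2^-1 ^+ M).
Proof.
move=> a b ab bl; have := window_var_seq ab bl.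
have := ler_wpM2l (ltW (amp_gt0 M)) (window_comb ab bl).
have : 0 <= (4^-1 : R) ^+ M by rewrite exprn_ge0.
by rewrite /amp; move: ((4^-1 : R) ^+ M) => x; lra.
Qed.

Lemma phi_seq_step M t : `|phi_seq M.+1 t - phi_seq M t| <= d M * 2^-1 ^+ M.
Proof.
have [d0 _ _] := gd; rewrite phi_seqS addrAC subrr add0r mulrC.
exact: avg_dist (d0 M) (steplike_pre M) (@window_pre M).
Qed.

Lemma slope_seq_step M t : `|slope_seq M.+1 t - slope_seq M t| <= 2^-1 ^+ M.
Proof.
have [d0 _ _] := gd.
have := avg_dist_deriv t (d0 M) (steplike_pre M) (@window_pre M).
by rewrite (_ : avg _ _ t - _ = slope_seq M.+1 t - slope_seq M t)//= /avg; ring.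
Qed.

Lemma phi_seq_step_lip M a b : a <= b ->
  `|(phi_seq M.+1 b - phi_seq M b) - (phi_seq M.+1 a - phi_seq M a)|
     <= 2 * 2^-1 ^+ M * (b - a).
Proof.
move=> ab; have [d0 _ _] := gd; rewrite !phi_seqS.
rewrite [phi_seq M b + _]addrC addrK [phi_seq M a + _]addrC addrK.
exact: avg_dist_lip (d0 M) (steplike_pre M) (@window_pre M) ab.
Qed.

Lemma d_le1 M : d M <= 1.
Proof.
have [d0 d8 h] := gd; have d01 : d 0 <= 1.
  have := h 0%N; rewrite /freq expr0 mul1r ler_pdivrMl ?twopi_gt0// mulr1.
  by have := @pihalf_lt2 R; lra.
elim: M => [//|M IH]; have := d8 M; have := d0 M.+1; lra.
Qed.

(** Averaging does not increase the distance to 1, and the combs add at most the partial sums of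
    eps_M. *)
Lemma slope_seq_near1 M t : `|slope_seq M t - 1| <= 6^-1 * (1 - 4^-1 ^+ M).
Proof.
have [d0 _ _] := gd; elim: M t => [|M IH] t /=.
    by rewrite ?expr0 !subrr normr0 mulr0.
have a0 := amp_gt0 M.
have wc := window_comb (M := M); have sc := steplike_comb (freq_gt0 M).
have e3 := avg_dist_deriv t (d0 M) sc wc.
have e1 := IH (t - d M); have e2 := IH (t + d M).
have e4 : `|amp M * (avg (d M) (comb_deriv (freq M)) t - comb_deriv (freq M) t)| <= amp M * 1.
  by rewrite normrM (ger0_norm (ltW a0)) ler_pM2l.
have ampE : amp M = 8^-1 * 4^-1 ^+ M by [].
have gE : avg (d M) (slope_seq M) t =
  2^-1 * slope_seq M (t - d M) + 2^-1 * slope_seq M (t + d M) by [].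
rewrite exprS gE; move: e1 e2 e4 ampE.
move: (amp M * (avg _ _ _ - _)) (slope_seq M (t - d M)) (slope_seq M (t + d M)).
move: ((4^-1 : R) ^+ M) (amp M) => x a w y z; clear; rewrite !ler_norml.
by move=> /andP[a1 a2] /andP[a3 a4] /andP[a5 a6] aE; apply/andP; split; lra.
Qed.

End phi_seq.

(** * Counting corners *)

Section piecewise_linear.
Variable R : realType.
Implicit Types F G : R -> R.

Definition affine_on F (a b : R) : Prop :=
  exists al be : R, forall t, a <= t -> t <= b -> F t = al * t + be.

Definition avoids (s : seq R) (a b : R) : Prop :=
  forall x, x \in s -> a < x -> x < b -> False.

(* At most N corners in each window of length 16 > 2 pi. *)
Definition piecewise_linear (N : nat) F : Prop :=
  forall c, exists2 s : seq R, (size s <= N)%N &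
    forall a b, c <= a -> a <= b -> b <= c + 16 -> avoids s a b -> affine_on F a b.

Lemma avoids_cat (s1 s2 : seq R) a b : avoids (s1 ++ s2) a b -> avoids s1 a b /\ avoids s2 a b.
Proof.
by move=> h; split=> x xs; apply: h; rewrite mem_cat xs ?orbT.
Qed.

Lemma avoids_shift (s : seq R) (h a b : R) :
  avoids [seq x + h | x <- s] a b -> avoids s (a - h) (b - h).
Proof.
move=> H x xs ax xb; apply: (H (x + h)); first exact: map_f.
  by rewrite -ltrBlDr.
by rewrite -ltrBrDr.
Qed.

Lemma affine_onD F G (c : R) a b : affine_on F a b -> affine_on G a b ->
  affine_on (fun t => F t + c * G t) a b.
Proof.
move=> [al [be h1]] [al' [be' h2]]; exists (al + c * al'), (be + c * be') => t ta tb.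
by rewrite h1// h2//; ring.
Qed.

Lemma affine_on_shift F (h a b : R) : affine_on F (a + h) (b + h) ->
  affine_on (fun t => F (t + h)) a b.
Proof.
move=> [al [be h1]]; exists al, (be + al * h) => t ta tb.
by rewrite h1 ?lerD2r//; ring.
Qed.

Lemma piecewise_linear_le (N N' : nat) F : (N <= N')%N ->
  piecewise_linear N F -> piecewise_linear N' F.
Proof. by move=> NN h c; have [s ss hs] := h c; exists s => //; exact: leq_trans NN. Qed.

Lemma piecewise_linearD (N N' : nat) F G (c : R) :
  piecewise_linear N F -> piecewise_linear N' G ->
  piecewise_linear (N + N') (fun t => F t + c * G t).
Proof.
move=> h1 h2 e; have [s1 ss1 hs1] := h1 e; have [s2 ss2 hs2] := h2 e.
exists (s1 ++ s2); first by rewrite size_cat leq_add.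
move=> a b ea ab be /avoids_cat[v1 v2].
by apply: affine_onD; [exact: hs1|exact: hs2].
Qed.

Lemma piecewise_linear_shift (N : nat) F (h : R) :
  piecewise_linear N F -> piecewise_linear N (fun t => F (t + h)).
Proof.
move=> h1 c; have [s ss hs] := h1 (c + h).
exists [seq x - h | x <- s]; first by rewrite size_map.
move=> a b ca ab bc /avoids_shift; rewrite opprK => v.
by apply: affine_on_shift; apply: hs => //; lra.
Qed.

Lemma piecewise_linear_cst0 : piecewise_linear 0 (fun=> 0).
Proof. by move=> c; exists [::] => // a b _ _ _ _; exists 0, 0 => t _ _; rewrite mul0r addr0. Qed.

Lemma piecewise_linear_id : piecewise_linear 0 (fun t => t).
Proof. by move=> c; exists [::] => // a b _ _ _ _; exists 1, 0 => t _ _; rewrite mul1r addr0. Qed.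

Lemma piecewise_linear_avg (N : nat) F (d : R) :
  piecewise_linear N F -> piecewise_linear (2 * N) (avg d F).
Proof.
move=> h; have h1 := piecewise_linear_shift (- d) h; have h2 := piecewise_linear_shift d h.
have := piecewise_linearD 2^-1 (piecewise_linearD 2^-1 piecewise_linear_cst0 h1) h2.
rewrite add0n addnn -mul2n; congr piecewise_linear.
by apply/funext => t; rewrite add0r.
Qed.

Lemma floor_prim_ge_line (m : int) (x : R) :
  m%:~R * x - m%:~R * (m%:~R + 1) / 2 <= floor_prim x.
Proof.
have := floor_prim_subgrad (m%:~R : R) x.
by rewrite /floor_prim intrKfloor; lra.
Qed.

Lemma floor_prim_line (m : int) (x : R) : m%:~R <= x -> x <= m%:~R + 1 ->
  floor_prim x = m%:~R * x - m%:~R * (m%:~R + 1) / 2.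
Proof.
move=> mx; rewrite le_eqVlt => /predU1P[->|xm].
  rewrite /floor_prim -[X in Num.floor (_ + X)]/(1%:~R) -intrD intrKfloor intrD.
  by field.
have fx : Num.floor x = m by apply: floor_def; rewrite intrD mx.
by rewrite /floor_prim fx.
Qed.

Lemma comb_ge_line (u : R) (m : int) (t : R) : 0 < u ->
  m%:~R * t - u^-1 * (m%:~R * (m%:~R + 1) / 2) <= comb u t.
Proof.
move=> u0; have ui : 0 < u^-1 by rewrite invr_gt0.
have := floor_prim_ge_line m (u * t); rewrite -(ler_pM2l ui) => h.
rewrite /comb; apply: le_trans h; rewrite le_eqVlt; apply/orP; left; apply/eqP.
by move: (m%:~R : R) => x; field; rewrite gt_eqF.
Qed.

Lemma comb_line (u : R) (m : int) (t : R) : 0 < u -> m%:~R <= u * t -> u * t <= m%:~R + 1 ->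
  comb u t = m%:~R * t - u^-1 * (m%:~R * (m%:~R + 1) / 2).
Proof.
move=> u0 h1 h2; rewrite /comb (floor_prim_line h1 h2).
by move: (m%:~R : R) => x; field; rewrite gt_eqF.
Qed.

Lemma comb_affine (u : R) (a b : R) : 0 < u -> a <= b ->
  (forall k : int, a < k%:~R / u -> k%:~R / u < b -> False) ->
  affine_on (comb u) a b.
Proof.
move=> u0 ab h; pose m := Num.floor (u * a).
have /andP[m1 m2] := floor_itvE (u * a).
exists m%:~R, (- (u^-1 * (m%:~R * (m%:~R + 1) / 2))) => t ta tb.
apply: comb_line => //; first by apply: le_trans m1 _; rewrite ler_pM2l.
rewrite leNgt; apply/negP => hm; apply: (h (m + 1)).
  by rewrite ltr_pdivlMr// intrD mulrC.
rewrite ltr_pdivrMr// intrD; apply: lt_le_trans hm _.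
by rewrite mulrC ler_pM2r.
Qed.

Lemma piecewise_linear_comb (M : nat) : piecewise_linear (6 * 2 ^ M) (comb (freq R M)).
Proof.
move=> c; set u := freq R M; have u0 : 0 < u := freq_gt0 R M.
pose F := Num.floor (u * c).
(* The next 6 * 2^M multiples of 1/u after c: since pi >= 2, a window of length 16 spans at most 4 *
   2^M spacings. *)
exists [seq (F + i%:Z)%:~R / u | i <- iota 1 (6 * 2 ^ M)]; first by rewrite size_map size_iota.
move=> a b ca ab bc av; apply: comb_affine => // k ak kb.
apply: (av (k%:~R / u)) => //.
have /andP[f1 f2] := floor_itvE (u * c).
have Fk : F < k.
  rewrite -(ltr_int R); apply: le_lt_trans f1 _.
  by rewrite mulrC -ltr_pdivlMr//; exact: le_lt_trans ak.
apply/mapP; exists (absz (k - F)); last by congr (_%:~R / _); lia.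
rewrite mem_iota; apply/andP; split; first by lia.
have : (k%:~R : R) < (F + 1 + (4 * 2 ^ M)%:Z)%:~R.
  have ub : (k%:~R : R) < u * (c + 16).
    by rewrite mulrC -ltr_pdivrMr//; exact: lt_le_trans bc.
  apply: lt_le_trans ub _; rewrite !intrD mulrDr; apply: lerD; first exact: ltW.
  rewrite /u /freq; have p0 := twopi_gt0 R.
  rewrite mulrAC ler_pdivrMr//.
  have -> : (4 * 2 ^ M)%:Z%:~R = 4 * 2 ^+ M :> R by rewrite -[LHS]/((4 * 2 ^ M)%:R) natrM natrX.
  have p2 : 2 <= pi :> R := @pi_ge2 R.
  have : 0 <= (2 : R) ^+ M by rewrite exprn_ge0.
  move: ((2 : R) ^+ M) => x x0.
  have : x * 2 <= x * pi by rewrite ler_wpM2l.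
  lra.
rewrite ltr_int; have : (1 <= 2 ^ M)%N by rewrite expn_gt0.
lia.
Qed.

Variable d : nat -> R.

(** Averaging doubles the number of corners, and the combs add 12 * 2^M and 6 * 2^M; both fit into
    the growth factor 4. *)
Lemma piecewise_linear_phi_seq M : piecewise_linear (18 * 4 ^ M) (phi_seq d M).
Proof.
elim: M => [|M IH].
  by apply: piecewise_linear_le piecewise_linear_id.
have hc := piecewise_linear_comb M.
have h1 := piecewise_linear_avg (d M) IH.
have h2 := piecewise_linear_avg (d M) hc.
have := piecewise_linearD (- amp R M) (piecewise_linearD (amp R M) h1 h2) hc.
rewrite (_ : (fun t => _) = phi_seq d M.+1); last by apply/funext => t /=; ring.
apply: piecewise_linear_le.
have : (2 ^ M <= 4 ^ M)%N by case: (M) => [|m]//; rewrite leq_exp2r.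
rewrite [(4 ^ M.+1)%N]expnS; move: (2 ^ M)%N (4 ^ M)%N => x y; lia.
Qed.

Lemma piecewise_linear_pre_seq M : piecewise_linear (24 * 4 ^ M) (pre_seq d M).
Proof.
have := piecewise_linearD (amp R M) (piecewise_linear_phi_seq M) (piecewise_linear_comb M).
apply: piecewise_linear_le.
have : (2 ^ M <= 4 ^ M)%N by case: (M) => [|m]//; rewrite leq_exp2r.
move: (2 ^ M)%N (4 ^ M)%N => x y; lia.
Qed.

(* On an interval free of corners and of their d-translates, averaging changes
   nothing unless the interval is short. *)
Lemma avg_eq_or_short (s : seq R) F (e c a b : R) : 0 < e ->
  (forall a b, c <= a -> a <= b -> b <= c + 16 -> avoids s a b -> affine_on F a b) ->
  c + e <= a -> b + e <= c + 16 -> a <= b ->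
  avoids s a b -> avoids [seq x + e | x <- s] a b -> avoids [seq x - e | x <- s] a b ->
  b - a <= e \/ forall t, a <= t -> t <= b -> avg e F t = F t.
Proof.
move=> e0 hF ca bc ab v1 v2 v3; have [|eab] := leP (b - a) e; first by left.
right=> t ta tb.
have [al [be hl]] : affine_on F (t - e) (t + e).
  apply: hF; [lra|lra|lra|] => x xs x1 x2.
  have [xa|ax] := leP x a.
    apply: (v2 (x + e)); first exact: map_f.
      lra.
    lra.
  have [bx|xb] := leP b x; last exact: (v1 x).
  apply: (v3 (x - e)); first exact: (map_f (fun x => x - e)).
    lra.
  lra.
by apply: (@avg_affine _ e al be) (ltW e0) => r /andP[]; exact: hl.
Qed.

(** Pigeonhole: among N + 1 equal cells, one has no point of s in its interior. *)
Lemma gap_exists (s : seq R) (N : nat) (a b : R) : a < b -> (size s <= N)%N ->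
  exists al be : R, [/\ a <= al, be <= b, be - al = (b - a) / N.+1%:R & avoids s al be].
Proof.
move=> ab sN; apply: contrapT => H.
pose l := (b - a) / N.+1%:R.
have l0 : 0 < l by rewrite divr_gt0 ?subr_gt0.
have lE : N.+1%:R * l = b - a by rewrite /l mulrC divfK.
have Hx (i : nat) : exists x, (i < N.+1)%N ->
    [/\ x \in s, a + i%:R * l < x & x < a + i.+1%:R * l].
  have [iN|] := ltnP i N.+1; last by exists 0.
  apply: contrapT => nx; apply: H; exists (a + i%:R * l), (a + i.+1%:R * l); split.
  - by rewrite lerDl mulr_ge0// ltW.
  - have : i.+1%:R * l <= N.+1%:R * l by rewrite ler_wpM2r ?(ltW l0)// ler_nat.
    by rewrite lE; lra.
  - by rewrite -/l -[i.+1%:R]natr1; ring.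
  by move=> x xs x1 x2; apply: nx; exists x.
have [f Hf] := choice Hx.
have uf : uniq [seq f i | i <- iota 0 N.+1].
  rewrite map_inj_in_uniq ?iota_uniq// => i j; rewrite !mem_iota !add0n /= => iN jN fij.
  have [_ i1 i2] := Hf i iN; have [_ j1 j2] := Hf j jN; rewrite fij in i1 i2.
  have lt1 : i%:R * l < j.+1%:R * l by lra.
  have lt2 : j%:R * l < i.+1%:R * l by lra.
  move: lt1 lt2; rewrite !ltr_pM2r// !ltr_nat !ltnS => h1 h2.
  by apply/eqP; rewrite eqn_leq h1 h2.
have := uniq_leq_size uf (s2 := s); rewrite size_map size_iota => h.
have : (N.+1 <= size s)%N.
  by apply: h => x /mapP [j]; rewrite mem_iota => /andP[_ jN] ->; have [] := Hf j jN.
by rewrite ltnNge sN.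
Qed.

End piecewise_linear.

(** * The limit function *)

Section phi_limit.
Variable R : realType.

Lemma is_derive_estimate (f : R -> R) (x l : R) :
  (forall e : R, 0 < e -> exists2 dl : R, 0 < dl &
    forall y, `|y - x| <= dl -> `|f y - f x - l * (y - x)| <= e * `|y - x|) ->
  is_derive x 1 f l.
Proof.
move=> H.
have cv : (fun h : R => h^-1 *: (f (h *: (1 : R) + x) - f x)) @ 0^' --> l.
  apply/cvgrPdist_le => e e0; have [dl dl0 Hd] := H e e0.
  exists dl => //= h /=; rewrite sub0r normrN => hd h0.
  have hE : h *: (1 : R) = h by rewrite /GRing.scale /= mulr1.
  have yx : h *: (1 : R) + x - x = h by rewrite hE addrK.
  have := Hd (h *: (1 : R) + x); rewrite yx => /(_ (ltW hd)).
  move: (f (h *: (1 : R) + x) - f x) => q hq.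
  have -> : l - h^-1 *: q = - (h^-1 * (q - l * h)).
    by rewrite /GRing.scale /=; field.
  rewrite normrN normrM normfV ler_pdivrMl ?normr_gt0// [leRHS]mulrC.
  exact: hq.
have dv : derivable f x 1 by apply/cvg_ex; exists l.
apply: DeriveDef => //; exact: cvg_lim.
Qed.

Lemma phi_limit (d : nat -> R) : good_scales d -> exists h v : R -> R,
  [/\ forall t, (fun M => phi_seq d M t) @ \oo --> h t,
      forall t : R, is_derive t 1 h (v t),
      forall M a b, a <= b -> b - a <= 8 * d M -> `|v b - v a| <= 5 * 2^-1 ^+ M &
      forall t, `|v t - 1| <= 6^-1].
Proof.
move=> gd; have [d0 d8 _] := gd.
have hphi t : exists l : R, (fun M => phi_seq d M t) @ \oo --> l.
  have [|l hl _] := @geometric_cauchy_cvg R (fun M => phi_seq d M t) 1.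
    move=> M; apply: le_trans (phi_seq_step gd M t) _.
    by rewrite mul1r ler_piMl ?(ltW (half_gt0 R M))// d_le1.
  by exists l.
have hv t : exists l : R, (fun M => slope_seq d M t) @ \oo --> l /\
    forall M, `|l - slope_seq d M t| <= 2 * 2^-1 ^+ M.
  have [|l hl hb] := @geometric_cauchy_cvg R (fun M => slope_seq d M t) 1.
    by move=> M; rewrite mul1r; exact: slope_seq_step.
  by exists l; split=> // M; have := hb M; rewrite mulr1.
have [h Hh] := choice hphi; have [v Hv] := choice hv.
(* The steps are summed as Lipschitz functions: the tail of 2 * 2^-K from M on is 4 * 2^-M. *)
have lip M a b : a <= b ->
    `|(h b - h a) - (phi_seq d M b - phi_seq d M a)| <= 4 * 2^-1 ^+ M * (b - a).
  move=> ab.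
  have [|l hl hb] := @geometric_cauchy_cvg R
      (fun M => phi_seq d M b - phi_seq d M a) (2 * (b - a)).
    move=> K; have := phi_seq_step_lip gd K ab.
    have -> : phi_seq d K.+1 b - phi_seq d K b - (phi_seq d K.+1 a - phi_seq d K a) =
      phi_seq d K.+1 b - phi_seq d K.+1 a - (phi_seq d K b - phi_seq d K a) by ring.
    by move/le_trans; apply; rewrite mulrAC.
  have hE : h b - h a = l.
    have : (fun M => phi_seq d M b - phi_seq d M a) @ \oo --> h b - h a.
      by apply: cvgB.
    by move/(cvg_unique _); apply.
  rewrite hE; apply: le_trans (hb M) _; rewrite le_eqVlt; apply/orP; left; apply/eqP.
  by ring.
have win M a b : a <= b -> b - a <= 8 * d M -> var_seq d M b - var_seq d M a <= 2^-1 ^+ M.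
  move=> ab bl; apply: le_trans (window_var_seq gd ab bl) _.
  by rewrite gerBl exprn_ge0.
(* The constant 7 is 4 from the Lipschitz tail, 1 from the variation at stage M and 2 from the tail
   of the slopes. *)
have key M a t b : a <= t -> t <= b -> b - a <= 8 * d M ->
    `|h b - h a - v t * (b - a)| <= 7 * 2^-1 ^+ M * (b - a).
  move=> hat htb bl; have ab := le_trans hat htb.
  have ba : 0 <= b - a by lra.
  have [_ sl] := steplike_phi_seq d M.
  have e1 := sl a t b hat htb; have e2 := lip M a b ab.
  have e3 := ler_wpM2r ba (win M a b ab bl).
  have [_ /(_ M) e4] := Hv t.
  have e5 : `|(v t - slope_seq d M t) * (b - a)| <= 2 * 2^-1 ^+ M * (b - a).
    by rewrite normrM (ger0_norm ba) ler_wpM2r.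
  move: e1 e2 e3 e5; clear.
  move: ((2^-1 : R) ^+ M) (h a) (h b) (v t) (phi_seq d M a) (phi_seq d M b).
  move: (slope_seq d M t) (var_seq d M a) (var_seq d M b) => s f g x ha hb vt p q.
  rewrite !ler_norml => /andP[a1 a2] /andP[a3 a4] a5 /andP[a6 a7].
  by apply/andP; split; lra.
exists h, v; split=> //.
- move=> t; apply: is_derive_estimate => e e0.
  have [M hM] : exists M, 7 * 2^-1 ^+ M <= e.
    have : geometric 7 (2^-1 : R) @ \oo --> (0 : R).
      by apply: cvg_geometric; rewrite ger0_norm// invf_lt1// ltr1n.
    move/cvgrPdist_le => /(_ e e0) [M _ /(_ M (leqnn M))] /=.
    by rewrite sub0r normrN => /(le_trans (ler_norm _)); exists M.
  exists (8 * d M); first by rewrite mulr_gt0.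
  move=> y yt; have [ty|/ltW yt'] := leP t y.
    have yt0 : 0 <= y - t by lra.
    rewrite (ger0_norm yt0) in yt *.
    apply: le_trans (key M t t y (lexx t) ty yt) _.
    by rewrite ler_wpM2r.
  have yt0 : 0 <= t - y by lra.
  rewrite distrC (ger0_norm yt0) in yt *.
  have -> : h y - h t - v t * (y - t) = - (h t - h y - v t * (t - y)) by ring.
  rewrite normrN.
  apply: le_trans (key M y t t yt' (lexx t) yt) _.
  by rewrite ler_wpM2r.
- move=> M a b ab bl.
  have [_ /(_ M) e1] := Hv a; have [_ /(_ M) e2] := Hv b.
  have [sl _] := steplike_phi_seq d M.
  have e3 := le_trans (sl a b ab) (win M a b ab bl).
  move: e1 e2 e3; clear; move: ((2^-1 : R) ^+ M) => x.
  rewrite !ler_norml => /andP[a1 a2] /andP[a3 a4] /andP[a5 a6].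
  by apply/andP; split; lra.
move=> t; have [cvt _] := Hv t.
apply: (cvg_dist_le (N := 0%N) cvt) => M _.
apply: le_trans (slope_seq_near1 gd M t) _.
by rewrite ler_piMr// gerBl exprn_ge0.
Qed.

(** The increment over a period is affine in t, hence is removed by averaging minus identity; this
    is why the limit commutes with the shift by 2 pi. *)
Lemma comb_period (M : nat) (t : R) :
  comb (freq R M) (t + 2 * pi) = comb (freq R M) t + (2 ^+ M * t +
    (freq R M)^-1 * ((2 ^+ M * 2 ^+ M - 2 ^+ M) / 2)).
Proof.
set u := freq R M; have u0 : 0 < u := freq_gt0 R M.
have uE : u * (t + 2 * pi) = u * t + (2 ^ M)%:Z%:~R.
  rewrite -[_%:~R]/((2 ^ M)%:R) natrX mulrDr; congr (_ + _).
  by rewrite /u /freq divfK// gt_eqF// twopi_gt0.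
have fE : Num.floor (u * t + (2 ^ M)%:Z%:~R) = Num.floor (u * t) + (2 ^ M)%:Z.
  by rewrite floorDrz ?intr_int// intrKfloor.
rewrite /comb uE /floor_prim fE intrD -[(2 ^ M)%:Z%:~R]/((2 ^ M)%:R) natrX.
by move: ((Num.floor (u * t))%:~R : R) ((2 : R) ^+ M) => x y; field; rewrite gt_eqF.
Qed.

Lemma phi_seq_period (d : nat -> R) M (t : R) :
  phi_seq d M (t + 2 * pi) = phi_seq d M t + 2 * pi.
Proof.
elim: M t => [//|M IH] t /=.
rewrite /avg (_ : t + 2 * pi - d M = t - d M + 2 * pi); last by ring.
rewrite (_ : t + 2 * pi + d M = t + d M + 2 * pi); last by ring.
by rewrite !IH !comb_period; move: (@pi R) => q; field; rewrite gt_eqF ?freq_gt0.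
Qed.

End phi_limit.

(** * Nowhere linearity of the limit *)

Section nowhere_linear.
Variable R : realType.

(** The averaging defect of the comb is a row of tents of height d/2 over its corners k/u. Near a
    corner, the two supporting lines with slopes k and k - 1 bound the averaged values from
    below. *)
Lemma tent_ge (u d t : R) (k : int) : 0 < u -> 0 < d -> u * d <= 1 ->
  (d - `|t - k%:~R / u|) / 2 <= avg d (comb u) t - comb u t.
Proof.
move=> u0 d0 ud; set y := k%:~R / u.
have uy : u * y = k%:~R by rewrite /y mulrC divfK// gt_eqF.
have [far|near] := leP d `|t - y|.
  have := comb_convex d t u0; lra.
have [ty|/ltW ty] := leP y t.
  have tE : comb u t = k%:~R * t - u^-1 * (k%:~R * (k%:~R + 1) / 2).
    apply: comb_line => //; first by rewrite -uy ler_pM2l.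
    rewrite ger0_norm ?subr_ge0// in near.
    have : u * (t - y) <= u * d by rewrite ler_pM2l// ltW.
    by rewrite mulrBr uy; lra.
  have e1 := comb_ge_line k (t + d) u0; have e2 := comb_ge_line (k - 1) (t - d) u0.
  rewrite ger0_norm ?subr_ge0// /avg tE; move: e1 e2; rewrite intrB.
  have : u^-1 * k%:~R = y by rewrite mulrC.
  move: (comb u (t + d)) (comb u (t - d)) => p q.
  move: (k%:~R : R) => x; move: (u^-1) => w <-; clear; move=> h1 h2.
  have -> : (d - (t - w * x)) / 2 = 2^-1 * ((x - 1) * (t - d) - w * ((x - 1) * (x - 1 + 1) / 2))
     + 2^-1 * (x * (t + d) - w * (x * (x + 1) / 2)) - (x * t - w * (x * (x + 1) / 2)) by field.
  lra.
have tE : comb u t = (k - 1)%:~R * t - u^-1 * ((k - 1)%:~R * ((k - 1)%:~R + 1) / 2).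
  apply: comb_line => //; last by rewrite intrB subrK -uy ler_pM2l.
  rewrite ler0_norm ?subr_le0// in near.
  have : u * (y - t) <= u * d by rewrite ler_pM2l//; lra.
  by rewrite mulrBr uy intrB; lra.
have e1 := comb_ge_line k (t + d) u0; have e2 := comb_ge_line (k - 1) (t - d) u0.
rewrite ler0_norm ?subr_le0// /avg tE; move: e1 e2; rewrite intrB.
have : u^-1 * k%:~R = y by rewrite mulrC.
move: (comb u (t + d)) (comb u (t - d)) => p q.
move: (k%:~R : R) => x; move: (u^-1) => w <-; clear; move=> h1 h2.
have -> : (d - - (t - w * x)) / 2 = 2^-1 * ((x - 1) * (t - d) - w * ((x - 1) * (x - 1 + 1) / 2))
   + 2^-1 * (x * (t + d) - w * (x * (x + 1) / 2)) - ((x - 1) * t - w * ((x - 1) * (x - 1 + 1) / 2)) by field.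
lra.
Qed.

Lemma tent_eq0 (u d t : R) : 0 < u -> 0 < d ->
  (forall k : int, d <= `|t - k%:~R / u|) -> avg d (comb u) t = comb u t.
Proof.
move=> u0 d0 far.
have [al [be h]] : affine_on (comb u) (t - d) (t + d).
  apply: comb_affine => //; first lra.
  move=> k k1 k2; have := far k; rewrite leNgt ltr_norml => /negP; apply.
  by apply/andP; split; lra.
by apply: (@avg_affine _ d al be) (ltW d0) => r /andP[]; exact: h.
Qed.

Variable d : nat -> R.

(** Averages of values above a line stay above it, and tents are nonnegative. The margin 2 d_i0 - 2
    d_M pays for the shifts d_j with i0 <= j < M, as d_j <= 2 d_j - 2 d_{j+1}. *)
Lemma local_above (i0 M : nat) (al be A B t : R) : good_scales d ->
  (forall t, A <= t -> t <= B -> phi_seq d i0 t = al * t + be) -> (i0 <= M)%N ->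
  A + 2 * d i0 - 2 * d M <= t -> t <= B - 2 * d i0 + 2 * d M ->
  al * t + be <= phi_seq d M t.
Proof.
move=> [d0 d8 _] hl iM; rewrite -(subnKC iM); elim: (M - i0)%N t => [|m IH] t.
  by rewrite addn0 => h1 h2; rewrite hl//; lra.
rewrite addnS => h1 h2 /=.
have e1 := IH (t - d (i0 + m)%N); have e2 := IH (t + d (i0 + m)%N).
have e3 := comb_convex (d (i0 + m)%N) t (freq_gt0 R (i0 + m)).
have dm := d0 (i0 + m)%N; have dm1 := d8 (i0 + m)%N; have dm2 := d0 (i0 + m).+1.
have f1 : al * (t - d (i0 + m)%N) + be <= phi_seq d (i0 + m) (t - d (i0 + m)%N) by apply: e1; lra.
have f2 : al * (t + d (i0 + m)%N) + be <= phi_seq d (i0 + m) (t + d (i0 + m)%N) by apply: e2; lra.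
have f3 : 0 <= amp R (i0 + m) * (avg (d (i0 + m)%N) (comb (freq R (i0 + m))) t - comb (freq R (i0 + m)) t).
  by rewrite mulr_ge0 ?(ltW (amp_gt0 _ _))// subr_ge0.
rewrite {1}/avg; move: f1 f2 f3; clear.
move: (amp R _ * _) (phi_seq _ _ _) (phi_seq _ _ _) => x y z; lra.
Qed.

(** All points reached from t by the successive shifts must miss the tents. A distance 3 d_j - 2 d_M
    loses at most the later shifts and still leaves d_j at stage j. *)
Lemma local_eq (i0 M : nat) (al be A B t : R) : good_scales d ->
  (forall t, A <= t -> t <= B -> phi_seq d i0 t = al * t + be) -> (i0 <= M)%N ->
  A + 2 * d i0 - 2 * d M <= t -> t <= B - 2 * d i0 + 2 * d M ->
  (forall j (k : int), (i0 <= j)%N -> (j < M)%N -> 3 * d j - 2 * d M <= `|t - k%:~R / freq R j|) ->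
  phi_seq d M t = al * t + be.
Proof.
move=> [d0 d8 _] hl iM; rewrite -(subnKC iM); elim: (M - i0)%N t => [|m IH] t.
  by rewrite addn0 => h1 h2 _; rewrite hl//; lra.
rewrite addnS => h1 h2 far /=.
have dm := d0 (i0 + m)%N; have dm1 := d8 (i0 + m)%N; have dm2 := d0 (i0 + m).+1.
have e0 : avg (d (i0 + m)%N) (comb (freq R (i0 + m))) t = comb (freq R (i0 + m)) t.
  apply: tent_eq0 => // [|k]; first exact: freq_gt0.
  by have := far (i0 + m)%N k (leq_addr _ _) (leqnn _); lra.
have e1 : phi_seq d (i0 + m) (t - d (i0 + m)%N) = al * (t - d (i0 + m)%N) + be.
  apply: IH; [lra|lra|move=> j k ij jm].
  have := far j k ij (ltnW jm : (j < (i0 + m).+1)%N).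
  have := ler_distD (t - d (i0 + m)%N) t (k%:~R / freq R j).
  have -> : `|t - (t - d (i0 + m)%N)| = d (i0 + m)%N.
    by rewrite opprB addrC subrK gtr0_norm.
  lra.
have e2 : phi_seq d (i0 + m) (t + d (i0 + m)%N) = al * (t + d (i0 + m)%N) + be.
  apply: IH; [lra|lra|move=> j k ij jm].
  have := far j k ij (ltnW jm : (j < (i0 + m).+1)%N).
  have := ler_distD (t + d (i0 + m)%N) t (k%:~R / freq R j).
  have -> : `|t - (t + d (i0 + m)%N)| = d (i0 + m)%N.
    by rewrite opprD addrA subrr sub0r normrN gtr0_norm.
  lra.
by rewrite {1}/avg e0 e1 e2; field.
Qed.

(** The tent created at stage i1 survives: each later averaging moves the point by d_K, less than
    the amount 2 d_K - 2 d_{K+1} by which the bound shrinks. *)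
Lemma local_strict (i0 i1 M : nat) (al be A B t : R) (k : int) : good_scales d ->
  (forall t, A <= t -> t <= B -> phi_seq d i0 t = al * t + be) -> (i0 <= i1)%N -> (i1 < M)%N ->
  A + 2 * d i0 - 2 * d M <= t -> t <= B - 2 * d i0 + 2 * d M ->
  amp R i1 / 2 * (d i1 - 2 * d i1.+1 + 2 * d M - `|t - k%:~R / freq R i1|)
    <= phi_seq d M t - (al * t + be).
Proof.
move=> gd hl ii iM; have [d0 d8 du] := gd; rewrite -(subnKC iM).
have a0 := amp_gt0 R i1.
elim: (M - i1.+1)%N t => [|m IH] t.
  rewrite addn0 => h1 h2 /=.
  have dm := d0 i1; have dm1 := d8 i1; have dm2 := d0 i1.+1.
  have f1 : al * (t - d i1) + be <= phi_seq d i1 (t - d i1).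
    by apply: (local_above gd hl ii); lra.
  have f2 : al * (t + d i1) + be <= phi_seq d i1 (t + d i1).
    by apply: (local_above gd hl ii); lra.
  have f3 : (d i1 - `|t - k%:~R / freq R i1|) / 2
      <= avg (d i1) (comb (freq R i1)) t - comb (freq R i1) t.
    apply: tent_ge => //; first exact: freq_gt0.
    apply: le_trans (du i1); rewrite ler_pM2l ?freq_gt0//; lra.
  have f4 := ler_wpM2l (ltW a0) f3.
  rewrite {1}/avg; move: f1 f2 f4.
  move: (amp R i1 * (avg (d i1) (comb (freq R i1)) t - comb (freq R i1) t)).
  move: (phi_seq d i1 (t - d i1)) (phi_seq d i1 (t + d i1)) `|t - k%:~R / freq R i1|.
  by move: (amp R i1) => a x y z w; clear; lra.
rewrite addnS => h1 h2; move: IH h1 h2; move: (i1.+1 + m)%N => K IH h1 h2.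
have -> : phi_seq d K.+1 t = avg (d K) (phi_seq d K) t
    + amp R K * (avg (d K) (comb (freq R K)) t - comb (freq R K) t) by [].
have dm := d0 K; have dm1 := d8 K; have dm2 := d0 K.+1.
have e1 : amp R i1 / 2 * (d i1 - 2 * d i1.+1 + 2 * d K - `|t - d K - k%:~R / freq R i1|)
    <= phi_seq d K (t - d K) - (al * (t - d K) + be) by apply: IH; lra.
have e2 : amp R i1 / 2 * (d i1 - 2 * d i1.+1 + 2 * d K - `|t + d K - k%:~R / freq R i1|)
    <= phi_seq d K (t + d K) - (al * (t + d K) + be) by apply: IH; lra.
have e3 := comb_convex (d K) t (freq_gt0 R K).
have f3 : 0 <= amp R K * (avg (d K) (comb (freq R K)) t - comb (freq R K) t).
  by rewrite mulr_ge0 ?(ltW (amp_gt0 _ _))// subr_ge0.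
have n1 : `|t - d K - k%:~R / freq R i1| <= `|t - k%:~R / freq R i1| + d K.
  rewrite addrAC; apply: le_trans (ler_normB _ _) _.
  by rewrite (gtr0_norm dm).
have n2 : `|t + d K - k%:~R / freq R i1| <= `|t - k%:~R / freq R i1| + d K.
  rewrite addrAC; apply: le_trans (ler_normD _ _) _.
  by rewrite (gtr0_norm dm).
have ah : 0 <= amp R i1 / 2 by rewrite divr_ge0// ltW.
set w := `|t - _| in n1 n2 *.
have g1 : amp R i1 / 2 * (d i1 - 2 * d i1.+1 + 2 * d K.+1 - w) <=
    amp R i1 / 2 * (d i1 - 2 * d i1.+1 + 2 * d K - `|t - d K - k%:~R / freq R i1|).
  by apply: ler_wpM2l => //; lra.
have g2 : amp R i1 / 2 * (d i1 - 2 * d i1.+1 + 2 * d K.+1 - w) <=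
    amp R i1 / 2 * (d i1 - 2 * d i1.+1 + 2 * d K - `|t + d K - k%:~R / freq R i1|).
  by apply: ler_wpM2l => //; lra.
have g1' := le_trans g1 e1; have g2' := le_trans g2 e2.
rewrite {1}/avg; move: g1' g2' f3.
move: (amp R K * (avg (d K) (comb (freq R K)) t - comb (freq R K) t)).
move: (amp R i1 / 2 * (d i1 - 2 * d i1.+1 + 2 * d K.+1 - w)).
move: (phi_seq d K (t - d K)) (phi_seq d K (t + d K)) => p q a b; clear; lra.
Qed.

(* [N / (3 * freq i1)] has no dyadic denominator, and is not an even multiple of
   [1 / freq i1]: this keeps it away from the corners of the finer combs and of
   the coarser ones, respectively. *)
Lemma third_point_far (i0 i1 j : nat) (N k : int) : good_scales d ->
  5 * d i0 <= (freq R i1)^-1 -> (i0 <= j)%N ->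
  (2 %| N)%Z -> ~~ (3 %| N)%Z ->
  3 * d j <= `|N%:~R / 3 / freq R i1 - k%:~R / freq R j|.
Proof.
move=> [d0 d8 du] dc ij N2 N3.
have anti n : d (i0 + n)%N <= d i0.
  elim: n => [|n IH]; first by rewrite addn0.
  by rewrite addnS; have := d8 (i0 + n)%N; have := d0 (i0 + n).+1; lra.
have dj : d j <= d i0 by rewrite -(subnKC ij).
have f1 := freq_gt0 R i1; have fj := freq_gt0 R j.
have fE n m : freq R (n + m) = freq R n * 2 ^+ m by rewrite /freq exprD mulrAC.
have [ji|ij1] := ltnP j i1.
  have [N' NE] : exists N', N = N' * 2 by exists (N %/ 2)%Z; rewrite divzK.
  pose e := (i1 - j.+1)%N.
  have i1E : i1 = (j + e.+1)%N by rewrite /e; lia.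
  have kE : k%:~R / freq R j = (k * 2 ^+ e * 2)%:~R / freq R i1.
    rewrite i1E fE !intrM exprS rmorphXn/=; field.
  by rewrite (gt_eqF fj) andbT expf_neq0.
  have -> : N%:~R / 3 / freq R i1 - k%:~R / freq R j =
    (N' - 3 * (k * 2 ^+ e))%:~R * (2 / 3) * (freq R i1)^-1.
    rewrite kE NE intrB !intrM; field; exact: lt0r_neq0.
  rewrite normrM normrM (gtr0_norm (_ : 0 < (freq R i1)^-1)) ?invr_gt0//.
  rewrite (gtr0_norm (_ : 0 < 2 / 3 :> R)); last by lra.
  have n1 : 1 <= `|(N' - 3 * (k * 2 ^+ e))%:~R : R|.
    rewrite -intr_norm (_ : 1 = 1%:~R)// ler_int.
    have : N' - 3 * (k * 2 ^+ e) != 0.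
      rewrite subr_eq0; apply/eqP => h; move/negP: N3; apply; rewrite NE h.
      by rewrite dvdz_mulr// dvdz_mulr.
    move: (N' - _) => x; lia.
  have : 2 / 3 * (freq R i1)^-1 <= `|(N' - 3 * (k * 2 ^+ e))%:~R : R| * (2 / 3 * (freq R i1)^-1).
    by rewrite ler_peMl// mulr_ge0 ?invr_ge0// ltW.
  rewrite -[in X in _ -> X]mulrA; move: (`|_| * (2 / 3 * _)) => x.
  by move: dc dj (d0 i0); clear; lra.
have fi : freq R j = freq R i1 * 2 ^+ (j - i1) by rewrite -fE subnKC.
have -> : N%:~R / 3 / freq R i1 - k%:~R / freq R j =
    (N * 2 ^+ (j - i1) - 3 * k)%:~R * 3^-1 * (freq R j)^-1.
  rewrite fi intrB !intrM rmorphXn/=; field.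
  by rewrite (gt_eqF f1) ?andbT expf_neq0.
rewrite normrM normrM (gtr0_norm (_ : 0 < (freq R j)^-1)) ?invr_gt0//.
rewrite (gtr0_norm (_ : 0 < 3^-1 :> R)); last by lra.
have n1 : 1 <= `|(N * 2 ^+ (j - i1) - 3 * k)%:~R : R|.
  rewrite -intr_norm (_ : 1 = 1%:~R)// ler_int.
  have : N * 2 ^+ (j - i1) - 3 * k != 0.
    rewrite subr_eq0; apply/eqP => h; have : (3 %| N * 2 ^+ (j - i1))%Z.
      by rewrite h dvdz_mulr.
    rewrite Gauss_dvdzl ?(negPf N3)//.
    by rewrite coprimezXr.
  move: (_ - _) => x; lia.
have h16 : 16 * d j <= (freq R j)^-1.
  by rewrite -div1r ler_pdivlMr// mulrC.
have h1 : (freq R j)^-1 <= `|(N * 2 ^+ (j - i1) - 3 * k)%:~R : R| * (freq R j)^-1.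
  by rewrite ler_peMl// invr_ge0 ltW.
rewrite mulrAC; move: h1 h16 (d0 j); clear.
move: (_ * (freq R j)^-1) => x; lra.
Qed.

Lemma third_points (q : int) :
  [/\ (2 %| 6 * q + 8)%Z, ~~ (3 %| 6 * q + 8)%Z, (2 %| 6 * q + 10)%Z & ~~ (3 %| 6 * q + 10)%Z].
Proof. by split; lia. Qed.

(** Inside ]a, b[ some [phi_seq d i0] coincides with a line. On a later comb, h lies strictly above
    that line at a corner y but on it at the symmetric points y - c/3 and y + c/3, which no affine
    function does. *)
Lemma phi_limit_nowhere_linear (h : R -> R) : good_scales d ->
  (forall t, phi_seq d M t @[M --> \oo] --> h t) ->
  (forall C : R, exists M, C * 4 ^+ M * d M <= 1) -> nowhere_linear h.
Proof.
move=> gd hl small a b ab [A0 [B0 lin]]; have [d0 d8 du] := gd.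
pose w := Num.min (b - a) 16.
have w0 : 0 < w by rewrite lt_min subr_gt0 ab ltr0n.
have wb : w <= b - a by rewrite ge_min lexx.
have w16 : w <= 16 by rewrite ge_min lexx orbT.
(* Half of the interval, divided among at most 19 * 4^i0 cells, must still leave a gap of length 80
   d_i0. *)
have [i0 hi0] := small (80 * 19 / (w / 2)).
have [s ss hs] := piecewise_linear_phi_seq d i0 (a + w / 4).
have w43 : a + w / 4 < a + 3 * w / 4 by lra.
have [al0 [be0 [h1 h2 h3 av]]] := gap_exists w43 ss.
have X1 : 1 <= (4 : R) ^+ i0 by rewrite exprn_ege1// ler1n.
have NE : ((18 * 4 ^ i0).+1%:R : R) = 18 * 4 ^+ i0 + 1.
  by rewrite -[_.+1%:R]natr1 natrM natrX.
have N0 : 0 < ((18 * 4 ^ i0).+1%:R : R) by rewrite ltr0n.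
have dg : 80 * d i0 <= be0 - al0.
  rewrite h3 ler_pdivlMr// NE.
  have e1 : 80 * d i0 * (18 * 4 ^+ i0 + 1) <= 80 * d i0 * (19 * 4 ^+ i0).
    by rewrite ler_wpM2l ?mulr_ge0 ?(ltW (d0 i0))//; move: X1; clear; lra.
  apply: le_trans e1 _.
  move: hi0; rewrite -(ler_pM2l (_ : 0 < w / 2)); last by move: w0; clear; lra.
  have -> : w / 2 * (80 * 19 / (w / 2) * 4 ^+ i0 * d i0) = 80 * d i0 * (19 * 4 ^+ i0).
    by field; rewrite gt_eqF.
  by clear; lra.
have g4 : (be0 - al0) * 4 ^+ i0 <= 1.
  rewrite h3 mulrAC ler_pdivrMr// NE mul1r.
  have : w / 2 * 4 ^+ i0 <= 8 * 4 ^+ i0.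
    by rewrite ler_wpM2r//; move: X1 w16; clear; lra.
  have -> : a + 3 * w / 4 - (a + w / 4) = w / 2 by field.
  by move: X1; clear; lra.
have g0 : 0 < be0 - al0 by have := d0 i0; lra.
have pi2 := pi_ge2 R.
have freq_le i : freq R i <= 4 ^+ i.
  rewrite /freq ler_pdivrMr ?twopi_gt0//.
  have : (2 : R) ^+ i <= 4 ^+ i by rewrite lerXn2r// ?nnegrE; lra.
  have : 0 < (2 : R) ^+ i by rewrite exprn_gt0.
  have : 4 ^+ i * 1 <= 4 ^+ i * (2 * pi) :> R.
    by rewrite ler_wpM2l ?exprn_ge0//; lra.
  by move: (4 ^+ i * (2 * pi)) (2 ^+ i) => x y; clear; lra.
have [al [be hab]] : affine_on (phi_seq d i0) al0 be0.
  by apply: hs => //; have := d0 i0; lra.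
have exi : exists i, 8 <= (be0 - al0) * freq R i.
  pose x := 8 * (2 * pi) / (be0 - al0).
  exists (Num.truncn x).+1.
  have hx : x < (Num.truncn x).+1%:R.
    by have := truncn_itv (ltW (_ : 0 < x)); rewrite divr_gt0 ?mulr_gt0 ?pi_gt0// => /(_ isT)/andP[].
  have h2x : x <= 2 ^+ (Num.truncn x).+1.
    apply: le_trans (ltW hx) _; rewrite -natrX ler_nat; apply: ltnW; exact: ltn_expl.
  move: h2x; rewrite /x ler_pdivrMr// /freq (mulrA (be0 - al0)) ler_pdivlMr ?twopi_gt0//.
  by rewrite [_ * (be0 - al0)]mulrC.
(* By minimality the gap measures between 8 and 16 spacings of the comb: enough corners inside, and
   a spacing large compared with d_i0. *)
have [i1 hi1 mini] := ex_minnP exi.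
have f1 := freq_gt0 R i1.
have i10 : (i0 < i1)%N.
  rewrite ltnNge; apply/negP => le.
  have : (be0 - al0) * freq R i1 <= (be0 - al0) * 4 ^+ i0.
    rewrite ler_pM2l//; apply: le_trans (freq_le i1) _.
    by rewrite ler_weXn2l// ler1n.
  by move: hi1 g4; clear; lra.
have g16 : (be0 - al0) * freq R i1 < 16.
  move: i10 mini; clear -X1; case: i1 => // i _ /(_ i); rewrite ltnn => H.
  have : (be0 - al0) * freq R i < 8 by rewrite ltNge; apply/negP => /H.
  by rewrite (_ : freq R i.+1 = 2 * freq R i) ?[freq _ i.+1]/freq ?exprS ?mulrA//; lra.
have {}i10 := ltnW i10.
pose c := (freq R i1)^-1.
have c0 : 0 < c by rewrite invr_gt0.
have c8 : 8 * c <= be0 - al0 by rewrite /c ler_pdivrMr.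
have c16 : be0 - al0 < 16 * c by rewrite /c ltr_pdivlMr.
have dc : 5 * d i0 <= c by lra.
pose q := Num.floor ((al0 + 2 * d i0) / (2 * c)).
have [q1 q2] : q%:~R * (2 * c) <= al0 + 2 * d i0 /\ al0 + 2 * d i0 < (q%:~R + 1) * (2 * c).
  have c20 : 0 < 2 * c by lra.
  rewrite -ler_pdivlMr// -ltr_pdivrMr//; split; first exact: floor_le_tmp.
  have := floorD1_gt ((al0 + 2 * d i0) / (2 * c)); rewrite -/q intrD; exact.
(* An odd multiple of the spacing c: coarser combs have corners only at even multiples, so y - c/3
   and y + c/3 stay at least 2c/3 away from them. *)
pose y := (2 * q + 3)%:~R * c.
have yE : y = 2 * q%:~R * c + 3 * c by rewrite /y intrD intrM; ring.
have zh (N : int) : (2 %| N)%Z -> ~~ (3 %| N)%Z -> y - c <= N%:~R / 3 * c <= y + c ->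
    h (N%:~R / 3 * c) = al * (N%:~R / 3 * c) + be.
  move=> N2 N3 /andP[z1 z2].
  have E M : (i0 <= M)%N -> phi_seq d M (N%:~R / 3 * c) = al * (N%:~R / 3 * c) + be.
    move=> iM; have dM := d0 M; apply: (local_eq gd hab) => //; [lra|lra|move=> j k ij jM].
    by have := third_point_far (i1 := i1) k gd dc ij N2 N3; rewrite -/c; lra.
  apply/eqP; rewrite eq_le; apply/andP; split.
    by apply: (cvg_le (N := i0) (hl _)) => M iM; rewrite E.
  by apply: (cvg_ge (N := i0) (hl _)) => M iM; rewrite E.
have [n1 n2 n3 n4] := third_points q.
have z1 : h (y - c / 3) = al * (y - c / 3) + be.
  rewrite (_ : y - c / 3 = (6 * q + 8)%:~R / 3 * c).
    apply: zh => //.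
    by rewrite yE intrD !intrM; apply/andP; split; lra.
  by rewrite yE intrD !intrM; field.
have z2 : h (y + c / 3) = al * (y + c / 3) + be.
  rewrite (_ : y + c / 3 = (6 * q + 10)%:~R / 3 * c).
    apply: zh => //.
    by rewrite yE intrD !intrM; apply/andP; split; lra.
  by rewrite yE intrD !intrM; field.
have hy : al * y + be + amp R i1 / 2 * (d i1 - 2 * d i1.+1) <= h y.
  apply: (cvg_ge (N := i1.+1) (hl y)) => M iM; have dM := d0 M.
  have := local_strict (t := y) (2 * q + 3) gd hab i10 iM.
  rewrite -/c -/y subrr normr0 subr0 => H.
  rewrite -lerBrDl; apply: le_trans (H _ _); [|lra|lra].
  by rewrite ler_pM2l ?divr_gt0 ?amp_gt0//; lra.
have pos : 0 < amp R i1 / 2 * (d i1 - 2 * d i1.+1).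
  by rewrite mulr_gt0 ?divr_gt0 ?amp_gt0//; have := d8 i1; have := d0 i1.+1; lra.
have L t : y - c <= t -> t <= y + c -> h t = A0 * t + B0.
  move=> t1 t2; apply: lin; rewrite /= in_itv/=; apply/andP.
  move: (d0 i0) c0 dc c8 q1 q2 yE h1 h2 wb w0 t1 t2; clear.
  move: (y) (c) (d i0) (q%:~R : R) => z u e x.
  have -> : x * (2 * u) = 2 * x * u by ring.
  have -> : (x + 1) * (2 * u) = 2 * x * u + 2 * u by ring.
  by move: (2 * x * u) => xu *; split; lra.
move: z1 z2 hy; rewrite !L; [|by clear -c0; lra..].
move: pos; move: (amp R i1 / 2 * _) => x; clear; lra.
Qed.

End nowhere_linear.

(** * Fourier coefficients of exp(i n h) *)

Section exponential_difference.
Variable R : realType.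
Implicit Types (a b c : R) (F G : R -> R) (S : seq R).

(** Bound for the k-th integral of an exponential of frequency near m over an interval of length
    [dl]. *)
Definition bump (dl : R) (m k : int) : R := Num.min dl (6 / (1 + (absz (k - m))%:R)).

Lemma bump_ge0 dl m k : 0 <= dl -> 0 <= bump dl m k.
Proof. by move=> d0; rewrite le_min d0 divr_ge0// addr_ge0. Qed.

Lemma Int_cos_bump a b (dl x be : R) (k : int) : a <= b -> b - a <= dl -> dl <= 1 ->
  `|Int a b (fun t => cos ((x - k%:~R) * t + be))| <= bump dl (Num.floor x) k.
Proof.
move=> ab bdl dl1; set m := Num.floor x.
have c1 : continuous (fun t => cos ((x - k%:~R) * t + be)).
  by apply: continuous_cos_comp; exact: continuous_affine.
have e1 : `|Int a b (fun t => cos ((x - k%:~R) * t + be))| <= dl.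
  apply: le_trans (Int_abs_le (B := 1) ab c1 _) _; last by rewrite mul1r.
  by move=> t _; rewrite ler_norml cos_geN1 cos_le1.
rewrite /bump le_min e1 /=.
(* For |k - m| <= 5 the second bound is at least 1 >= dl. Beyond, |x - k| >= (1 + |k - m|)/3 and the
   antiderivative gives 2/|x - k|; hence the constant 6. *)
have [j5|j5] := leqP (absz (k - m)) 5.
  apply: le_trans e1 _; apply: le_trans dl1 _.
  rewrite ler_pdivlMr ?mul1r ?ltr_pwDl//.
  have : ((absz (k - m))%:R : R) <= 5 by rewrite ler_nat.
  by clear; lra.
have dist : (1 + (absz (k - m))%:R) / 3 <= `|x - k%:~R|.
  have /andP[m1 m2] := floor_itvE x; rewrite -/m in m1 m2.
  have e2 : `|(k - m)%:~R : R| = (absz (k - m))%:R by rewrite -intr_norm -abszE.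
  have := ler_distD x k%:~R (m%:~R : R); rewrite -intrB e2 (distrC k%:~R).
  have : `|x - m%:~R| <= 1 by rewrite ger0_norm; move: m1 m2; clear; lra.
  have : (6 : R) <= (absz (k - m))%:R by rewrite ler_nat.
  by clear; lra.
have j0 : (0 : R) <= (absz (k - m))%:R by [].
have xk : 0 < `|x - k%:~R| by apply: lt_le_trans dist; move: j0; clear; lra.
apply: le_trans (Int_cos_le be ab _) _; first by rewrite -normr_gt0.
rewrite ler_pdivrMr// mulrAC ler_pdivlMr; last by move: j0; clear; lra.
by move: dist; clear; lra.
Qed.

(* Between consecutive corners the two integrands agree, or the piece is short
   and each of them is a pure exponential. *)
Lemma Int_cos_diff_le (F G : R -> R) (n dl : R) : 0 <= dl -> dl <= 1 ->
  continuous F -> continuous G ->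
  forall (m : nat) S a b, (size S <= m)%N -> a <= b ->
  (forall a' b', a <= a' -> a' <= b' -> b' <= b -> avoids S a' b' ->
     (forall t, a' <= t -> t <= b' -> F t = G t) \/
     [/\ b' - a' <= dl, affine_on F a' b' & affine_on G a' b']) ->
  exists2 L : seq int, (size L <= 2 * (size S).+1)%N & forall (k : int) (c : R),
    `|Int a b (fun t => cos (n * F t - k%:~R * t + c)) -
      Int a b (fun t => cos (n * G t - k%:~R * t + c))| <= \sum_(l <- L) bump dl l k.
Proof.
move=> dl0 dl1 cF cG.
have cc (H : R -> R) (k : int) c : continuous H ->
    continuous (fun t => cos (n * H t - k%:~R * t + c)).
  move=> cH; apply: continuous_cos_comp => t.
  apply: cvgD; last exact: cvg_cst.
  by apply: cvgB; apply: cvgM; [exact: cvg_cst|exact: cH|exact: cvg_cst|exact: cvg_id].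
have base S a b : a <= b -> avoids S a b ->
  (forall a' b', a <= a' -> a' <= b' -> b' <= b -> avoids S a' b' ->
     (forall t, a' <= t -> t <= b' -> F t = G t) \/
     [/\ b' - a' <= dl, affine_on F a' b' & affine_on G a' b']) ->
  exists2 L : seq int, (size L <= 2)%N & forall (k : int) (c : R),
    `|Int a b (fun t => cos (n * F t - k%:~R * t + c)) -
      Int a b (fun t => cos (n * G t - k%:~R * t + c))| <= \sum_(l <- L) bump dl l k.
  move=> ab av /(_ a b (lexx _) ab (lexx _) av) [FG|[bdl [al [be Fab]] [al' [be' Gab]]]].
    exists [::] => // k c; rewrite big_nil.
    rewrite (@eq_Int _ a b _ (fun t => cos (n * G t - k%:~R * t + c))) ?subrr ?normr0//.
    by move=> t /andP[ta tb]; rewrite FG.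
  (* The two frequencies are fixed before k and c, which is what allows summation over k
     afterwards. *)
  exists [:: Num.floor (n * al); Num.floor (n * al')] => // k c.
  rewrite !big_cons big_nil addr0; apply: le_trans (ler_normB _ _) _.
  apply: lerD.
    rewrite (@eq_Int _ a b _ (fun t => cos ((n * al - k%:~R) * t + (n * be + c)))).
      exact: Int_cos_bump.
    by move=> t /andP[ta tb]; rewrite Fab//; congr cos; ring.
  rewrite (@eq_Int _ a b _ (fun t => cos ((n * al' - k%:~R) * t + (n * be' + c)))).
    exact: Int_cos_bump.
  by move=> t /andP[ta tb]; rewrite Gab//; congr cos; ring.
elim=> [|m IH] S a b Sm ab hS; last first.
  have [[x xS [ax xb]]|nx] := pselect (exists2 x, x \in S & a < x /\ x < b).
    pose S1 := [seq y <- S | y < x]; pose S2 := [seq y <- S | x < y].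
    (* The splitting corner belongs to neither half, so the counts 2(size + 1) of the halves add up
       to at most that of [S]. *)
    have sz : ((size S1 + size S2).+1 <= size S)%N.
      have cnt T : (count (fun y => (y < x)%R) T + count (fun y => (x < y)%R) T + count_mem x T
          = size T)%N.
        by elim: T => //= y T IHT; case: (ltgtP y x) => _; move: IHT; clear; lia.
      have : (0 < count_mem x S)%N by rewrite -has_count has_pred1.
      by rewrite /S1 /S2 !size_filter -(cnt S) => c0; rewrite -addn1 leq_add2l.
    have [m1 m2] : (size S1 <= m)%N /\ (size S2 <= m)%N.
      by move: (size S1) (size S2) (size S) sz Sm; clear; lia.
    have [L1 s1 h1] : exists2 L : seq int, (size L <= 2 * (size S1).+1)%N & forall (k : int) (c : R),
        `|Int a x (fun t => cos (n * F t - k%:~R * t + c)) -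
          Int a x (fun t => cos (n * G t - k%:~R * t + c))| <= \sum_(l <- L) bump dl l k.
      apply: IH => //; [exact: ltW|move=> a' b' h1 h2 h3 av].
      apply: hS => //; first by apply: le_trans h3 (ltW xb).
      move=> y yS y1 y2; apply: (av y) => //; rewrite mem_filter yS andbT.
      exact: lt_le_trans h3.
    have [L2 s2 h2] : exists2 L : seq int, (size L <= 2 * (size S2).+1)%N & forall (k : int) (c : R),
        `|Int x b (fun t => cos (n * F t - k%:~R * t + c)) -
          Int x b (fun t => cos (n * G t - k%:~R * t + c))| <= \sum_(l <- L) bump dl l k.
      apply: IH => //; [exact: ltW|move=> a' b' h4 h2 h3 av].
      apply: hS => //; first by apply: le_trans h4; exact: ltW.
      move=> y yS y1 y2; apply: (av y) => //; rewrite mem_filter yS andbT.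
      exact: le_lt_trans y1.
    exists (L1 ++ L2) => [|k c]; first by rewrite size_cat; move: (size L1) (size L2) (size S1) (size S2) (size S) s1 s2 sz; clear; lia.
    rewrite big_cat /= !(Int_split (ltW ax) (ltW xb)); [|exact: cc..].
    apply: le_trans (lerD (h1 k c) (h2 k c)).
    apply: le_trans (ler_normD _ _); rewrite le_eqVlt; apply/orP; left.
    by apply/eqP; congr `|_|; ring.
  have [|L sL hL] := base S a b ab _ hS; last by exists L => //; lia.
  by move=> x xS x1 x2; apply: nx; exists x.
have [|L sL hL] := base S a b ab _ hS; last by exists L => //; lia.
by case: S Sm hS.
Qed.

End exponential_difference.

Import Normc.
Section phi_seq_fourier.
Variable R : realType.

(** The phase c covers both parts, the sine being a cosine shifted by pi/2; the normalisation 1/(2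
    pi) absorbs the factor 2 of the two parts. *)
Lemma fourier_coef_cis_diff (F G : R -> R) (n : R) (k : int) (B : R) :
  continuous F -> continuous G ->
  (forall c : R, `|Int 0 (2 * pi) (fun t => cos (n * F t - k%:~R * t + c)) -
             Int 0 (2 * pi) (fun t => cos (n * G t - k%:~R * t + c))| <= B) ->
  normc (fourier_coef (fun t => cis (n * F t)) k - fourier_coef (fun t => cis (n * G t)) k) <= B.
Proof.
move=> cF cG HB.
have ReE (H : R -> R) : Int 0 (2 * pi) (fun t => complex.Re (cis (n * H t) * cis (- (k%:~R * t))))
    = Int 0 (2 * pi) (fun t => cos (n * H t - k%:~R * t + 0)).
  by apply: eq_Int => t _; rewrite -cisD addr0.
have ImE (H : R -> R) : Int 0 (2 * pi) (fun t => complex.Im (cis (n * H t) * cis (- (k%:~R * t))))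
    = Int 0 (2 * pi) (fun t => cos (n * H t - k%:~R * t + (- (pi / 2)))).
  by apply: eq_Int => t _; rewrite -cisD cosBpihalf.
rewrite /fourier_coef -mulrBr normcM normc_real !circle_integralE !ReE !ImE.
have p0 := twopi_gt0 R.
rewrite ger0_norm ?invr_ge0 ?(ltW p0)// ler_pdivrMl//.
have B0 : 0 <= B := le_trans (normr_ge0 _) (HB 0).
apply: le_trans (normc_le_ReIm _) _; rewrite !raddfB /=.
apply: le_trans (lerD (HB _) (HB _)) _.
have := pi_ge2 R => p2; have : B * 2 <= B * (2 * pi) by rewrite ler_wpM2l//; lra.
by lra.
Qed.

Variable d : nat -> R.

Lemma lipschitz_continuous (F : R -> R) (L : R) :
  (forall a b, a <= b -> `|F b - F a| <= L * (b - a)) -> continuous F.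
Proof.
move=> FL t; have FL' s : `|F t - F s| <= L * `|t - s|.
  have [ts|/ltW st] := leP t s.
    by rewrite distrC (distrC t) [in leRHS]ger0_norm ?subr_ge0// FL.
  by rewrite [in leRHS]ger0_norm ?subr_ge0// FL.
apply/cvgrPdist_le => e e0; near=> s.
apply: le_trans (FL' s) _; have L0 : 0 < `|L| + 1 by rewrite ltr_pwDr.
have : `|t - s| <= e / (`|L| + 1).
  by near: s; apply: cvgr_dist_le; [exact: cvg_id|exact: divr_gt0].
rewrite ler_pdivlMr// mulrC; apply: le_trans; rewrite ler_wpM2r//.
by apply: le_trans (ler_norm _) _; rewrite lerDl.
Unshelve. all: by end_near. Qed.

Lemma phi_seq_continuous M : good_scales d -> continuous (phi_seq d M).
Proof.
move=> gd; suff [L HL] : exists L : R, forall a b, a <= b ->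
    `|phi_seq d M b - phi_seq d M a| <= L * (b - a) by exact: lipschitz_continuous HL.
elim: M => [|M [L HL]]; first by exists 1 => a b ab /=; rewrite mul1r ger0_norm ?subr_ge0.
exists (L + 2 * 2^-1 ^+ M) => a b ab; rewrite mulrDl.
apply: le_trans (lerD (HL _ _ ab) (phi_seq_step_lip gd M ab)).
apply: le_trans (ler_normD _ _); rewrite le_eqVlt; apply/orP; left.
by apply/eqP; congr `|_|; move: (phi_seq d M.+1 b) (phi_seq d M.+1 a) => x y; ring.
Qed.

Lemma phi_seq_diff_coef (n : R) M : good_scales d ->
  exists2 L : seq int, (size L <= 326 * 4 ^ M)%N & forall k : int,
    normc (fourier_coef (fun t => cis (n * phi_seq d M.+1 t)) k
           - fourier_coef (fun t => cis (n * phi_seq d M t)) k) <= \sum_(l <- L) bump (d M) l k.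
Proof.
move=> gd; have [d0 _ _] := gd.
(* The window [-1, 15] contains [0, 2 pi] together with a margin d_M <= 1 for the translated
   corners. *)
have [s1 n1 h1] := piecewise_linear_phi_seq d M (-1).
have [s2 n2 h2] := piecewise_linear_phi_seq d M.+1 (-1).
have [s3 n3 h3] := piecewise_linear_pre_seq d M (-1).
(* In units of 4^M the corners number 18 + 72 + 3 * 24 = 162, whence 2(162 * 4^M + 1) <= 326 * 4^M
   frequencies. *)
pose S := s1 ++ (s2 ++ (s3 ++ ([seq x + d M | x <- s3] ++ [seq x - d M | x <- s3]))).
have p0 := ltW (twopi_gt0 R); have p4 := @pihalf_lt2 R; have d1 := d_le1 gd M.
have sS : (size S <= 162 * 4 ^ M)%N.
  rewrite /S !size_cat !size_map; move: n1 n2 n3; rewrite expnS.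
  by move: (4 ^ M)%N (size s1) (size s2) (size s3); clear; lia.
have hS a b : 0 <= a -> a <= b -> b <= 2 * pi -> avoids S a b ->
    (forall t, a <= t -> t <= b -> phi_seq d M.+1 t = phi_seq d M t) \/
    [/\ b - a <= d M, affine_on (phi_seq d M.+1) a b & affine_on (phi_seq d M) a b].
  move=> a0 ab b2 /avoids_cat[v1] /avoids_cat[v2] /avoids_cat[v3] /avoids_cat[v4 v5].
  have b15 : b + 1 <= -1 + 16 by move: b2 p4; clear; lra.
  have a1 : -1 <= a by move: a0; clear; lra.
  have b16 : b <= -1 + 16 by move: b15; clear; lra.
  have a1d : -1 + d M <= a by move: a0 d1; clear; lra.
  have b15d : b + d M <= -1 + 16 by move: b15 d1; clear; lra.
  have [short|same] := avg_eq_or_short (d0 M) h3 a1d b15d ab v3 v4 v5.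
    by right; split => //; [exact: h2|exact: h1].
  by left=> t ta tb; rewrite phi_seqS same// subrr addr0.
have [L sL hL] := Int_cos_diff_le n (ltW (d0 M)) d1 (@phi_seq_continuous M.+1 gd)
  (@phi_seq_continuous M gd) (leqnn _) p0 hS.
exists L => [|k].
  apply: leq_trans sL _; have : (0 < 4 ^ M)%N by rewrite expn_gt0.
  by move: sS; move: (4 ^ M)%N (size S); clear; lia.
apply: fourier_coef_cis_diff => [||c]; [exact: phi_seq_continuous..|exact: hL].
Qed.

(** The power mean inequality over the frequencies costs (size L)^p in total, and each frequency
    contributes a p-sum of order d_M^((p-1)/2). *)
Lemma phi_seq_diff_sum (p : R) : 1 < p -> good_scales d ->
  exists2 Z : R, 0 < Z & forall (n : R) M s, uniq s ->
    \sum_(k <- s) normc (fourier_coef (fun t => cis (n * phi_seq d M.+1 t)) k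
           - fourier_coef (fun t => cis (n * phi_seq d M t)) k) `^ p
    <= Z * (4 `^ p) ^+ M * d M `^ ((p - 1) / 2).
Proof.
move=> p1 gd; have [d0 _ _] := gd; have [Z Z0 hZ] := sum_min_powR_le p1.
have pp : 0 <= p by lra.
have [c c0 cE] : exists2 c : R, 0 < c & c = 326%:R by exists 326%:R; rewrite ?ltr0n.
exists (c `^ p * Z) => [|n M s us]; first by rewrite mulr_gt0 ?Z0 ?powR_gt0.
have [L sL hL] := phi_seq_diff_coef n M gd.
have b0 l k : 0 <= bump (d M) l k by rewrite bump_ge0// ltW.
apply: (@le_trans _ _ (\sum_(k <- s) (size L)%:R `^ (p - 1) * \sum_(l <- L) bump (d M) l k `^ p)).
  apply: ler_sum => k _; apply: le_trans (powR_sum_le _ (ltW p1) (b0^~ k)).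
  by apply: ge0_ler_powR => //; rewrite ?nnegrE ?normc_ge0 ?sumr_ge0.
rewrite -mulr_sumr exchange_big /=.
have e1 : \sum_(l <- L) \sum_(k <- s) bump (d M) l k `^ p
    <= (size L)%:R * (Z * d M `^ ((p - 1) / 2)).
  elim: (L) => [|l L' IH]; first by rewrite big_nil mul0r.
  by rewrite big_cons [size _]/= -[_.+1%:R]natr1 mulrDl mul1r addrC lerD// hZ.
apply: le_trans (ler_wpM2l (powR_ge0 _ _) e1) _.
have [L0|L0] := eqVneq (size L) 0%N.
  by rewrite L0 mul0r mulr0 !mulr_ge0 ?powR_ge0 ?exprn_ge0 ?(ltW Z0)// powR_ge0.
have powS : (size L)%:R `^ (p - 1) * (size L)%:R = (size L)%:R `^ p :> R.
  by rewrite -[X in _ * X]powRr1 ?ler0n// -powRD ?subrK// pnatr_eq0 L0 implybT.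
rewrite [leLHS]mulrA powS.
have -> : c `^ p * Z * (4 `^ p) ^+ M * d M `^ ((p - 1) / 2) =
   (c * 4 ^+ M) `^ p * (Z * d M `^ ((p - 1) / 2)).
  rewrite powRM ?exprn_ge0// ?(ltW c0)// -powR_mulrn ?powR_ge0// -powRrM mulrC.
  by rewrite -powR_mulrn// -powRrM (mulrC p); ring.
rewrite ler_wpM2r ?mulr_ge0 ?powR_ge0 ?(ltW Z0)//.
apply: ge0_ler_powR => //; rewrite ?nnegrE ?mulr_ge0 ?exprn_ge0 ?(ltW c0)//.
by rewrite cE -natrX -natrM ler_nat.
Qed.

Definition decays : Prop :=
  forall K s : R, 0 < K -> 0 < s -> exists B, forall M, K ^+ M * d M `^ s <= B.

(** Telescoping from phi_0, with the differences rescaled by 2^i so that Jensen applies with the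
    summable weights 2^-i. The price 2^(ip) joins 4^(ip) to give 8^(ip), which the decay of d
    absorbs. *)
Lemma phi_seq_coef_bounded (p : R) : 1 < p -> good_scales d -> decays ->
  exists2 C : R, 0 <= C & forall (n : int) K s, uniq s ->
    \sum_(k <- s) normc (fourier_coef (fun t => cis (n%:~R * phi_seq d K t)) k) `^ p <= C.
Proof.
move=> p1 gd decay; have [Z Z0 hZ] := phi_seq_diff_sum p1 gd; have pp : 0 <= p by lra.
have s0 : 0 < (p - 1) / 2 by lra.
have [B hB] := decay (8 `^ p) ((p - 1) / 2) (powR_gt0 _ (ltr0n _ 8)) s0.
have B0 : 0 <= B by apply: le_trans (hB 0%N); rewrite expr0 mul1r powR_ge0.
exists (2 `^ p * (1 + 2 `^ (p - 1) * (2 * (Z * B)))).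
  by rewrite mulr_ge0 ?powR_ge0// addr_ge0// !mulr_ge0 ?powR_ge0// ltW.
move=> n K s us.
pose u M k := fourier_coef (fun t => cis (n%:~R * phi_seq d M t)) k.
pose D M k : R := normc (u M.+1 k - u M k).
have D0 M k : 0 <= D M k by exact: normc_ge0.
have h0 i : 0 <= (2^-1 : R) ^+ i by exact: ltW (half_gt0 R i).
have geo : \sum_(0 <= i < K) (2^-1 : R) ^+ i <= 2.
  by apply: le_trans (sum_geometric_le _ _ _) _; [lra|lra|rewrite (_ : (1 - 2^-1)^-1 = 2)//; field].
have step k : normc (u K k) `^ p <= 2 `^ p * ((n == k)%:R +
    2 `^ (p - 1) * \sum_(0 <= i < K) 2^-1 ^+ i * (2 ^+ i * D i k) `^ p).
  have e1 : normc (u K k) <= (n == k)%:R + \sum_(0 <= i < K) 2^-1 ^+ i * (2 ^+ i * D i k).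
    have -> : u K k = u 0%N k + \sum_(0 <= i < K) (u i.+1 k - u i k).
      by rewrite telescope_sumr// addrC subrK.
    apply: le_trans (normcD _ _) _; apply: lerD.
      rewrite /u fourier_coef_cis; case: (n == k); last by rewrite normc0.
      by rewrite (normc_real (1 : R)) normr1.
    apply: le_trans (normc_sum _ _) _; apply: ler_sum => i _.
    by rewrite mulrA -exprMn mulVf ?expr1n ?mul1r// pnatr_eq0.
  have S0 : 0 <= \sum_(0 <= i < K) 2^-1 ^+ i * (2 ^+ i * D i k).
    by apply: sumr_ge0 => i _; rewrite !mulr_ge0 ?exprn_ge0.
  apply: (@le_trans _ _ (((n == k)%:R + \sum_(0 <= i < K) 2^-1 ^+ i * (2 ^+ i * D i k)) `^ p)).
    by apply: ge0_ler_powR; rewrite ?nnegrE ?normc_ge0 ?addr_ge0.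
  apply: le_trans (powR_add_le (ltW p1) (ler0n _ _) S0) _.
  rewrite ler_wpM2l ?powR_ge0//; apply: lerD.
    by case: (n == k); rewrite ?powR1// powR0 ?gt_eqF//; lra.
  apply: le_trans (jensen_powR _ (ltW p1) h0 _) _.
    by move=> i; rewrite mulr_ge0 ?exprn_ge0.
  apply: ler_wpM2r; first by apply: sumr_ge0 => i _; rewrite mulr_ge0 ?powR_ge0.
  by apply: ge0_ler_powR => //; rewrite ?nnegrE ?sumr_ge0//; lra.
apply: le_trans (ler_sum _ (fun k _ => step k)) _.
rewrite -mulr_sumr ler_wpM2l ?powR_ge0// big_split /= -mulr_sumr; apply: lerD.
  rewrite -natr_sum (_ : (\sum_(k <- s) (n == k))%N = count_mem n s).
    by rewrite count_uniq_mem// lern1 leq_b1.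
  by rewrite -sum1_count [RHS]big_mkcond; apply: eq_bigr => k _; rewrite /= eq_sym; case: (_ == _).
rewrite ler_wpM2l ?powR_ge0// exchange_big /=.
apply: (@le_trans _ _ (\sum_(0 <= i < K) 2^-1 ^+ i * (Z * B))); last first.
  by rewrite -mulr_suml ler_wpM2r// mulr_ge0// ltW.
apply: ler_sum => i _; rewrite -mulr_sumr ler_wpM2l//.
have -> : \sum_(k <- s) (2 ^+ i * D i k) `^ p = (2 ^+ i) `^ p * \sum_(k <- s) D i k `^ p.
  by rewrite mulr_sumr; apply: eq_bigr => k _; rewrite powRM ?exprn_ge0.
apply: le_trans (ler_wpM2l (powR_ge0 _ _) (hZ n%:~R i s us)) _.
have -> : (2 ^+ i) `^ p * (Z * (4 `^ p) ^+ i * d i `^ ((p - 1) / 2)) =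
    Z * ((8 `^ p) ^+ i * d i `^ ((p - 1) / 2)).
  have -> : (2 ^+ i) `^ p = (2 `^ p) ^+ i :> R.
    by rewrite -[in LHS]powR_mulrn// -powRrM mulrC powRrM powR_mulrn ?powR_ge0.
  rewrite (_ : 8 = 2 * 4); last by ring.
  by rewrite powRM// exprMn; ring.
by rewrite ler_wpM2l// ltW.
Qed.

Lemma normc_cis_dist (x y : R) : normc (cis x - cis y) <= 2 * `|x - y|.
Proof.
have -> : cis x - cis y = cis y * (cis (x - y) - 1).
  by rewrite mulrBr mulr1 -cisD addrCA subrr addr0.
rewrite normcM normc_cis mul1r; move: (x - y) => z.
apply: le_trans (normc_le_ReIm _) _; rewrite !raddfB /= subr0.
have h1 := normr_sin_le z.
have h2 : `|cos z - 1| <= `|z|.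
  rewrite cos_double_sin addrAC subrr add0r normrN normrM ger0_norm// expr2 normrM.
  have := normr_sin_le (z / 2); rewrite normrM [ `|2^-1|]ger0_norm ?invr_ge0//.
  have : `|sin (z / 2)| <= 1 by rewrite ler_norml sin_geN1 sin_le1.
  move: `|sin _| (normr_ge0 (sin (z / 2))) => w w0 w1 wz.
  have : w * w <= w * 1 by rewrite ler_wpM2l.
  lra.
by lra.
Qed.

Lemma phi_limit_coef_bounded (p : R) (h : R -> R) : 1 < p -> good_scales d -> decays ->
  continuous h -> (forall t, phi_seq d M t @[M --> \oo] --> h t) ->
  exists2 C : R, 0 <= C & forall (n : int) s, uniq s ->
    \sum_(k <- s) normc (fourier_coef (fun t => cis (n%:~R * h t)) k) `^ p <= C.
Proof.
move=> p1 gd decay ch hl; have [C C0 hC] := phi_seq_coef_bounded p1 gd decay.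
exists C => // n s us.
have dist M t : `|h t - phi_seq d M t| <= 2 * 1 * 2^-1 ^+ M.
  have [|l ul ll] := @geometric_cauchy_cvg R (fun M => phi_seq d M t) 1.
    move=> m; apply: le_trans (phi_seq_step gd m t) _.
    by rewrite ler_wpM2r ?(ltW (half_gt0 R m))// d_le1.
  suff -> : h t = l by exact: ll.
  exact: (cvg_unique _ (hl t) ul).
have cv k : normc (fourier_coef (fun t => cis (n%:~R * phi_seq d M t)) k) `^ p @[M --> \oo]
    --> normc (fourier_coef (fun t => cis (n%:~R * h t)) k) `^ p.
  apply: cvg_powR; [lra|by move=> M; exact: normc_ge0|].
  apply: (@cvg_geometric_bound _ _ _ (2 * (2 * (`|n%:~R| * 2)))) => M.
  apply: le_trans (normc_dist _ _) _; rewrite -!mulrA.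
  have cM (F : R -> R) : continuous F -> ccont (fun t => cis (n%:~R * F t)).
    by move=> cF; apply: ccont_cis => t; apply: cvgM; [exact: cvg_cst|exact: cF].
  apply: fourier_coef_dist => [||t _].
  - by apply/cM/phi_seq_continuous.
  - exact: cM.
  apply: le_trans (normc_cis_dist _ _) _; rewrite ler_wpM2l//.
  rewrite -mulrBr normrM ler_wpM2l// distrC; apply: le_trans (dist M t) _.
  by rewrite mulr1.
apply: (cvg_le (N := 0%N) (@cvg_sum_seq _ _ s (fun M k =>
  normc (fourier_coef (fun t => cis (n%:~R * phi_seq d M t)) k) `^ p) _ cv)) => M _; exact: hC.
Qed.

End phi_seq_fourier.

(** * Choice of the scales *)

Section scales.
Variable R : realType.

Lemma nbhs_right_geometric (P : R -> Prop) (c : nat) : (\forall x \near 0^'+, P x) ->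
  exists N, forall k, (N <= k)%N -> P (2^-1 ^+ (k * c.+1)).
Proof.
move=> /nbhs_ballP[e /= e0 he].
have cv : (fun k => (2^-1 : R) ^+ k) @ \oo --> (0 : R).
  apply: (@cvg_geometric_bound R _ 0 1) => k.
  by rewrite subr0 mul1r ger0_norm// ltW ?half_gt0.
move: cv => /cvgrPdist_lt /(_ e e0) [N _ hN].
exists N => k Nk; apply: he; last exact: half_gt0.
apply: le_lt_trans (hN k Nk).
rewrite !sub0r !normrN !ger0_norm ?(ltW (half_gt0 R _))//; apply: ler_wiXn2l; [lra|lra|].
by rewrite mulnS leq_addr.
Qed.

Lemma decays_small (d : nat -> R) : (forall M, 0 < d M) -> decays d ->
  forall C : R, exists M, C * 4 ^+ M * d M <= 1.
Proof.
move=> d0 hd C; have [B hB] := hd 8 1 (ltr0n _ 8) ltr01.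
have B0 : 0 <= B by apply: le_trans (hB 0%N); rewrite mulr_ge0// powR_ge0.
pose M := (Num.truncn (`|C| * B)).+1; exists M.
have hM : `|C| * B <= 2 ^+ M.
  have h := ltW (truncnS_gt (`|C| * B)).
  by apply: le_trans h _; rewrite -natrX ler_nat; exact: ltnW (ltn_expl M (isT : (1 < 2)%N)).
have e1 : 4 ^+ M * d M <= B * 2^-1 ^+ M.
  have := hB M; rewrite powRr1 ?(ltW (d0 M))// => h.
  have -> : 4 ^+ M * d M = 8 ^+ M * d M * 2^-1 ^+ M.
    by rewrite mulrAC -exprMn (_ : 8 / 2 = 4)//; field.
  by rewrite ler_wpM2r// ltW ?half_gt0.
rewrite -mulrA; apply: (@le_trans _ _ (`|C| * (B * 2^-1 ^+ M))).
  apply: le_trans (ler_wpM2l (normr_ge0 C) e1).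
  by rewrite ler_wpM2r ?ler_norm// mulr_ge0 ?exprn_ge0// ltW.
rewrite mulrA; apply: le_trans (ler_wpM2r (ltW (half_gt0 R M)) hM) _.
by rewrite -exprMn divff ?expr1n// pnatr_eq0.
Qed.

(** A diagonal choice: d_M = 2^-(10 + 3M + M a(M)), where a(M) tends to infinity as slowly as omega
    requires. The terms 10 + 3M secure [good_scales], and a(M) secures the decay. *)
Lemma scales_exist (omega : R -> R) :
  (forall x y : R, 0 <= x -> x <= y -> omega x <= omega y) ->
  (forall eps : R, 0 < eps -> omega d / (d `^ eps) @[d --> 0^'+] --> +oo) ->
  exists d : nat -> R, [/\ good_scales d, decays d &
    exists N, forall M, (N <= M)%N -> 2^-1 ^+ M <= omega (d M)].
Proof.
move=> mono growth.
(* The growth condition with exponent 1/(A + 13) makes this true for large M; 13 leaves room for the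
   terms 10 + 3M. *)
pose Q A M := forall k, (M <= k)%N -> (2^-1 : R) ^+ k <= omega (2^-1 ^+ (k * (A + 13))).
have Qex A : exists M, Q A M.
  have eps0 : 0 < (A + 13)%:R^-1 :> R by rewrite invr_gt0 ltr0n addnS.
  have /cvgryPge/(_ 1) h := growth _ eps0.
  have [N hN] := nbhs_right_geometric (A + 12)%N h.
  exists N => k Nk; have := hN k Nk; rewrite -addnS.
  rewrite ler_pdivlMr ?powR_gt0 ?half_gt0// mul1r; apply: le_trans.
  rewrite exprM -[X in X `^ _]powR_mulrn ?(ltW (half_gt0 R _))// -powRrM divff ?powRr1 ?(ltW (half_gt0 R _))//.
have Qmono A M M' : (M <= M')%N -> Q A M -> Q A M'.
  by move=> MM h k Mk; apply: h; exact: leq_trans Mk.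
(* The largest exponent admissible from M on, capped at M to keep the maximum finite. *)
pose a M := (\max_(A < M.+1 | `[< Q A M >]) A)%N.
have a_ge A M : (A <= M)%N -> Q A M -> (A <= a M)%N.
  move=> AM hQ; have AM' : (A < M.+1)%N by [].
  by apply: (@leq_bigmax_cond _ (fun i : 'I_M.+1 => `[< Q i M >]) _ (Ordinal AM')); apply/asboolP.
have a_mono M : (a M <= a M.+1)%N.
  apply/bigmax_leqP => i /asboolP hQ; apply: a_ge.
    by apply: ltnW; exact: ltn_ord.
  exact: Qmono hQ.
(* [Q 0 M] makes the range of the maximum nonempty; over an empty range the maximum defaults to 0,
   which need not be admissible. *)
have aQ M : Q 0%N M -> Q (a M) M.
  move=> h0; have : (0 < #|[pred i : 'I_M.+1 | `[< Q i M >]]|)%N.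
    by apply/card_gt0P; exists ord0; rewrite inE; apply/asboolP; apply/asboolP; exact: h0.
  by move=> /(eq_bigmax_cond (fun i : 'I_M.+1 => nat_of_ord i))[i /asboolP hi]; rewrite /a => ->.
pose e M := (10 + 3 * M + M * a M)%N.
have half1 : (2^-1 : R) <= 1 by lra.
have half0 : 0 <= (2^-1 : R) by lra.
have dle M : (2^-1 : R) ^+ e M <= 1 by exact: half_le1.
exists (fun M => 2^-1 ^+ e M); split.
- split=> M; first exact: half_gt0.
    rewrite (_ : 8 * 2^-1 ^+ e M.+1 = 2^-1 ^+ (e M.+1 - 3)).
      apply: ler_wiXn2l => //; rewrite /e.
      have : (M * a M <= M.+1 * a M.+1)%N by rewrite leq_mul.
      by move: (M * a M)%N (M.+1 * a M.+1)%N => x y; lia.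
    have e3 : (e M.+1 = 3 + (e M.+1 - 3))%N by rewrite subnKC// /e; lia.
    rewrite [in LHS]e3 exprD mulrA (_ : 8 * 2^-1 ^+ 3 = 1) ?mul1r//.
    by field.
  rewrite /freq; have p0 := twopi_gt0 R.
  rewrite mulrAC ler_pdivrMr// mul1r.
  apply: (@le_trans _ _ 1); last by have := pi_ge2 R; lra.
  have -> : e M = (M + (4 + (6 + 2 * M + M * a M)))%N by rewrite /e; lia.
  rewrite exprD; set z := 2^-1 ^+ (4 + _).
  have -> : 2 ^+ M * (16 * (2^-1 ^+ M * z)) = (2 / 2) ^+ M * (16 * z).
    by rewrite exprMn; move: (2 ^+ M) (2^-1 ^+ M) => x y; ring.
  rewrite divff ?pnatr_eq0// expr1n mul1r /z exprD mulrA.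
  rewrite (_ : 16 * 2^-1 ^+ 4 = 1) ?mul1r ?half_le1//.
  by field.
(* Once a(M) >= A, d_M <= 2^-(A M) and its power s beats K^M; the finitely many earlier M are
   absorbed by (1 + K)^(N + A). *)
- move=> K s K0 s0; pose A := (Num.truncn (K `^ s^-1)).+1.
  have hA : K <= (2 ^+ A) `^ s.
    have hA' : K `^ s^-1 <= 2 ^+ A.
      apply: le_trans (ltW (truncnS_gt _)) _; rewrite -natrX ler_nat; apply: ltnW.
      exact: ltn_expl.
    have -> : K = (K `^ s^-1) `^ s by rewrite -powRrM mulVf ?gt_eqF// powRr1// ltW.
    by apply: ge0_ler_powR; rewrite ?nnegrE ?powR_ge0 ?exprn_ge0 ?(ltW s0).
  have [N hN] := Qex A.
  exists ((1 + K) ^+ (N + A)) => M; have [small|big] := ltnP M (N + A).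
    apply: (@le_trans _ _ ((1 + K) ^+ M * 1)).
      apply: ler_pM; rewrite ?exprn_ge0 ?powR_ge0 ?(ltW K0)//.
        by apply: lerXn2r; rewrite ?nnegrE; lra.
      apply: (@le_trans _ _ (1 `^ s)); last (by rewrite powR1); apply: ge0_ler_powR; rewrite ?nnegrE ?(ltW s0) ?ler01 ?(ltW (half_gt0 R _))//.
    by rewrite mulr1; apply: ler_weXn2l; [lra|exact: ltnW].
  have aA : (A <= a M)%N.
    apply: a_ge; first exact: leq_trans (leq_addl _ _) big.
    by apply: Qmono hN; exact: leq_trans (leq_addr _ _) big.
  apply: (@le_trans _ _ 1); last by rewrite exprn_ege1//; lra.
  apply: (@le_trans _ _ (((2 ^+ A) `^ s) ^+ M * (2^-1 ^+ (A * M)) `^ s)).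
    apply: ler_pM; rewrite ?exprn_ge0 ?powR_ge0 ?(ltW K0)//.
      by apply: lerXn2r; rewrite ?nnegrE ?powR_ge0 ?(ltW K0).
    apply: ge0_ler_powR; rewrite ?nnegrE ?(ltW s0) ?(ltW (half_gt0 R _))//.
    apply: ler_wiXn2l => //; rewrite /e mulnC.
    by apply: leq_trans (leq_addl _ _); rewrite leq_mul.
  rewrite -powR_mulrn ?powR_ge0// -powRrM mulrC [s * _]mulrC powRrM powR_mulrn ?exprn_ge0//.
  rewrite -exprM -powRM ?exprn_ge0// mulrC -exprMn divff ?pnatr_eq0// expr1n powR1.
  by [].
(* Starting at N + 1 ensures M >= 1, so that 10 + 3M <= 13 M. *)
have [N hN] := Qex 0%N; exists N.+1 => M NM.
have := aQ M (Qmono _ _ _ (ltnW NM) hN) M (leqnn _).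
move/le_trans; apply; apply: mono; first exact: ltW (half_gt0 R _).
apply: ler_wiXn2l => //; rewrite /e mulnDr addnC.
by move: (M * a M)%N NM => x; lia.
Qed.

End scales.

(** * Boundedness, smoothness and invertibility of the limit *)

Section diffeomorphism.
Variable R : realType.

Lemma superposition_bounded_exp (p C : R) (h : R -> R) : 1 < p -> 0 <= C ->
  circle_map h -> continuous h ->
  (forall (n : int) s, uniq s ->
    \sum_(k <- s) normc (fourier_coef (fun t => cis (n%:~R * h t)) k) `^ p <= C) ->
  superposition_bounded p h.
Proof.
move=> p1 C0 hc ch HC; have p0 : 0 < p by lra.
have key (f : R -> R[i]) : in_A f -> (Ap_norm p (f \o h) <= (C `^ p^-1)%:E * A_norm f)%E.
  move=> fA; have [_ _ /A_norm_lty_bounded[W -> hW]] := fA.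
  have W0 : 0 <= W by have := hW [::] isT; rewrite big_nil.
  rewrite -EFinM; apply: Ap_norm_le => // [|s us]; first by rewrite mulr_ge0 ?powR_ge0.
  rewrite powRM ?powR_ge0// -powRrM mulVf ?gt_eqF// powRr1// mulrC.
  exact: superposition_sum_le (ltW p1) C0 ch fA hW HC _ us.
split; last by exists (C `^ p^-1).
move=> f fA; have [pf _ fN] := fA; split.
- by move=> t; exact: eq_mod2pi_periodic pf (hc t).
- have [c1 c2] := ccont_comp (in_A_ccont fA) ch.
  by split; exact: continuous_integrable.
apply: le_lt_trans (key f fA) _.
by have [W -> _] := A_norm_lty_bounded fN; rewrite -EFinM ltry.
Qed.

Lemma derive1_eq (h v : R -> R) : (forall t : R, is_derive t 1 h (v t)) -> derive1 h = v.
Proof. by move=> dh; apply/funext => t; rewrite derive1E; exact: derive_val. Qed.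

Lemma modulus_C1omega (d : nat -> R) (omega h v : R -> R) : good_scales d -> decays d ->
  (forall x y : R, 0 <= x -> x <= y -> omega x <= omega y) ->
  (exists N, forall M, (N <= M)%N -> 2^-1 ^+ M <= omega (d M)) ->
  (forall t : R, is_derive t 1 h (v t)) ->
  (forall M a b, a <= b -> b - a <= 8 * d M -> `|v b - v a| <= 5 * 2^-1 ^+ M) ->
  C1omega_smooth omega h.
Proof.
move=> gd hd mono [N hN] dh hv; have [d0 d8 _] := gd.
split=> [t|]; first by case: (dh t).
(* For the first M with d_M < e, slopes at distance e differ by at most 5 * 2^-(M-1) = 10 * 2^-M <=
   10 omega(d_M) <= 10 omega(e). *)
exists 10; near=> e => t1 t2; rewrite (derive1_eq dh).
have e0 : 0 < e by near: e; exact: nbhs_right_gt.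
have eN : e <= d N by near: e; exact: nbhs_right_le.
have exM : exists M, d M < e.
  have [M hM] := decays_small d0 hd (2 / e); exists M.
  have X1 : 1 <= (4 : R) ^+ M by rewrite exprn_ege1// ler1n.
  have : 2 / e * d M <= 1.
    apply: le_trans hM; rewrite ler_wpM2r ?(ltW (d0 M))// ler_peMr// divr_ge0// ltW.
  by rewrite mulrAC ler_pdivrMr// mul1r; have := d0 M; lra.
have [M hM mini] := ex_minnP exM.
have anti m k : d (m + k)%N <= d m.
  elim: k => [|k IH]; first by rewrite addn0.
  by rewrite addnS; have := d8 (m + k)%N; have := d0 (m + k).+1; lra.
have NM : (N < M)%N.
  rewrite ltnNge; apply/negP => le; have := anti M (N - M)%N; rewrite subnKC//.
  by move: hM eN; clear; lra.
have [K KE] : exists K, M = K.+1 by case: (M) NM => // K _; exists K.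
have dK : e <= d K by rewrite leNgt; apply/negP => /mini; rewrite KE ltnn.
have oe : 2^-1 ^+ M <= omega e.
  by apply: le_trans (hN M (ltnW NM)) _; apply: mono; exact: ltW.
have main a b : a <= b -> b - a <= e -> `|v b - v a| <= 10 * omega e.
  move=> ab ba; apply: le_trans (hv K a b ab _) _; first by have := d0 K; lra.
  by move: oe; rewrite KE exprS; move: (2^-1 ^+ K) => x; clear; lra.
move=> t12; have [t21|/ltW t21] := leP t1 t2.
  by rewrite distrC main// -(ger0_norm (_ : 0 <= t2 - t1)) ?subr_ge0// distrC.
by rewrite main// -(ger0_norm (_ : 0 <= t1 - t2)) ?subr_ge0.
Unshelve. all: by end_near. Qed.

(** Slopes of at least 5/6 make h a bijection of the line with differentiable inverse, and
    commutation with the shift by 2 pi carries both maps to the circle. *)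
Lemma near_id_diffeomorphism (h v : R -> R) :
  (forall t : R, is_derive t 1 h (v t)) -> continuous v ->
  (forall t, `|v t - 1| <= 6^-1) -> (forall t, h (t + 2 * pi) = h t + 2 * pi) ->
  circle_diffeomorphism h.
Proof.
move=> dh cv v1 hp.
have vlo t : 5 / 6 <= v t by have := v1 t; rewrite ler_norml => /andP[]; lra.
have v0 t : v t != 0 by rewrite gt_eqF//; have := vlo t; lra.
have ch : continuous h.
  by move=> t; apply/differentiable_continuous/derivable1_diffP; case: (dh t).
have grow a b : a <= b -> 5 / 6 * (b - a) <= h b - h a.
  move=> ab; have [c _ ->] := MVT_segment ab (fun x _ => dh x) (continuous_subspaceT ch).
  by rewrite ler_wpM2r ?subr_ge0.
have inj : injective h.
  move=> x y hxy; apply/eqP; rewrite eq_le; apply/andP.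
  split; rewrite leNgt; apply/negP => /[dup] lt /ltW /grow; move: lt; rewrite hxy subrr; lra.
have hint (k : int) t : h (t + k%:~R * (2 * pi)) = h t + k%:~R * (2 * pi).
  have ph : periodic2pi (fun t => h t - t) by move=> s; rewrite hp; ring.
  have := periodic2pi_int ph k t => /= E.
  by rewrite -[LHS](subrK (t + k%:~R * (2 * pi))) E; ring.
have surj y : exists x, h x = y.
  (* Slope at least 5/6 moves h by at least (5/3)|y - h 0| over length B, so y is enclosed. *)
  pose B := 2 * `|y - h 0|.
  have B0 : 0 <= B by rewrite mulr_ge0.
  have BB : - B <= 0 by lra.
  have h1 := grow 0 B B0; have h2 := grow (- B) 0 BB.
  have ab : - B <= B by lra.
  have := ler_norm (y - h 0); have := ler_norm (h 0 - y); rewrite distrC => n1 n2.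
  have yB : Num.min (h (- B)) (h B) <= y <= Num.max (h (- B)) (h B).
    rewrite ge_min le_max; apply/andP; split; apply/orP; [left|right].
      by move: h2 n1; have := normr_ge0 (y - h 0); rewrite /B; clear; lra.
    by move: h1 n2; have := normr_ge0 (y - h 0); rewrite /B; clear; lra.
  by have [c _ hc] := IVT ab (continuous_subspaceT ch) yB; exists c.
have [g hg] := choice surj.
have gh t : g (h t) = t by apply: inj; rewrite hg.
have dg (y : R) : is_derive y 1 g (v (g y))^-1.
  rewrite -{1}(hg y); apply: is_derive_inverse => //.
    by near=> t; exact: gh.
  by near=> t; exact: ch.
have cg : continuous g.
  by move=> t; apply/differentiable_continuous/derivable1_diffP; case: (dg t).
have hcm : circle_map h by move=> t; exists 1; rewrite hp mul1r addrAC subrr add0r.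
split.
- split=> // t1 t2 [k hk]; exists k.
  have : h t1 = h (t2 + k%:~R * (2 * pi)) by rewrite hint -hk addrC subrK.
  by move/inj => ->; rewrite addrAC subrr add0r.
- by split=> [t|]; [case: (dh t)|rewrite (derive1_eq dh)].
exists g.
  split=> [t|t|t].
  - exists 1; have -> : g (t + 2 * pi) = g t + 2 * pi by apply: inj; rewrite hp !hg.
    by rewrite mul1r addrAC subrr add0r.
  - by exists 0; rewrite gh subrr mul0r.
  - by exists 0; rewrite hg subrr mul0r.
split=> [t|]; first by case: (dg t).
rewrite (derive1_eq dg) => t; apply: cvgV => //.
exact: (continuous_comp (cg t) (cv _)).
Unshelve. all: by end_near.
Qed.

End diffeomorphism.

(** * Assembly of the sufficiency part *)

Section sufficiency.
Variable R : realType.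

Lemma modulus_continuous (d : nat -> R) (v : R -> R) : (forall M, 0 < d M) ->
  (forall M a b, a <= b -> b - a <= 8 * d M -> `|v b - v a| <= 5 * 2^-1 ^+ M) -> continuous v.
Proof.
move=> d0 hv t; apply/cvgrPdist_le => e e0.
have cv : (fun M => 5 * (2^-1 : R) ^+ M) @ \oo --> (0 : R).
  apply: (@cvg_geometric_bound R _ 0 5) => M.
  by rewrite subr0 ger0_norm// mulr_ge0 ?(ltW (half_gt0 R M)).
move: cv => /cvgrPdist_le /(_ e e0) [M _ /(_ M (leqnn _))] /=.
rewrite sub0r normrN ger0_norm ?mulr_ge0 ?(ltW (half_gt0 R M))// => Me.
near=> s; apply: le_trans Me.
have ts : `|t - s| <= 8 * d M.
  by near: s; apply: cvgr_dist_le; [exact: cvg_id|rewrite mulr_gt0].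
have [st|/ltW st] := leP s t.
  by apply: hv => //; rewrite ger0_norm ?subr_ge0 in ts.
by rewrite distrC; apply: hv => //; rewrite distrC ger0_norm ?subr_ge0 in ts.
Unshelve. all: by end_near. Qed.

Lemma nowhere_linear_nonlinear (h : R -> R) : nowhere_linear h -> nonlinear h.
Proof. by move=> nl [a [b hl]]; apply: (nl 0 1 ltr01); exists a, b => t _; exact: hl. Qed.

Lemma sufficiency (omega : R -> R) :
  (forall x y : R, 0 <= x -> x <= y -> omega x <= omega y) ->
  (forall eps : R, 0 < eps -> omega d / (d `^ eps) @[d --> 0^'+] --> +oo) ->
  exists h : R -> R,
    [/\ C1omega_diffeomorphism omega h, nowhere_linear h &
        forall p : R, 1 < p -> p <= 2 -> superposition_bounded p h].
Proof.
move=> mono growth; have [d [gd hd dN]] := scales_exist mono growth.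
have [d0 _ _] := gd; have [h [v [hl dh hv v1]]] := phi_limit gd.
have cv := modulus_continuous d0 hv.
have hp t : h (t + 2 * pi) = h t + 2 * pi.
  have l2 : (fun M => phi_seq d M t + 2 * pi) @ \oo --> h t + 2 * pi.
    by apply: cvgD; [exact: hl|exact: cvg_cst].
  apply: (cvg_unique _ _ l2) => //.
  rewrite (_ : (fun M => _) = (fun M => phi_seq d M (t + 2 * pi))); first exact: hl.
  by apply/funext => M; rewrite phi_seq_period.
have hdiff := near_id_diffeomorphism dh cv v1 hp.
have [[hc ch _] _ _] := hdiff.
exists h; split.
- by split=> //; exact: modulus_C1omega gd hd mono dN dh hv.
- exact: phi_limit_nowhere_linear gd hl (decays_small d0 hd).
move=> p p1 _; have [C C0 hC] := phi_limit_coef_bounded p1 gd hd ch hl.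
exact: superposition_bounded_exp hC.
Qed.

End sufficiency.

Unset Implicit Arguments.

Theorem mainTheorem8 (R : realType) (omega : R -> R)
    (omega_cont : {within `[0, +oo[, continuous omega})
    (omega_mono : forall x y : R, 0 <= x -> x <= y -> omega x <= omega y)
    (omega0 : omega 0 = 0) :
  ((exists phi : R -> R,
      [/\ circle_map phi, C1omega_smooth omega phi, nonlinear phi &
          forall f : R -> R[i], in_A f ->
            forall p : R, 1 < p -> p <= 2 -> in_Ap p (f \o phi)])
   <->
   (forall eps : R, 0 < eps ->
      omega d / (d `^ eps) @[d --> 0^'+] --> +oo))
  /\
  ((forall eps : R, 0 < eps ->
      omega d / (d `^ eps) @[d --> 0^'+] --> +oo) ->
   exists h : R -> R,
     [/\ C1omega_diffeomorphism omega h, nowhere_linear h &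
         forall p : R, 1 < p -> p <= 2 -> superposition_bounded p h]).

Proof.
split; last exact: sufficiency.
split=> [[phi [cphi sphi nl hphi]]|growth]; first exact: (necessity omega_cont).
have [h [[hdiff hs] nl hb]] := sufficiency omega_mono growth.
have [[hc _ _] _ _] := hdiff.
exists h; split=> //; first exact: nowhere_linear_nonlinear.
by move=> f fA p p1 p2; have [H _] := hb p p1 p2; exact: H.
Qed.
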